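(* Let $d\ge1$, let $0<s<2$, and let $0\le\gamma\in L^\infty(\mathbb{R}^d)$. Then there exist $C,\omega>0$ such that whenever $(u(0),u_t(0))\in H^{s/2}(\mathbb{R}^d)\times L^2(\mathbb{R}^d)$, $$E(t)\le C\exp(-\omega t)\,E(0)$$ holds for any $t\ge0$, if and only if $\operatorname{ess\,inf}_{\mathbb{R}^d}\gamma>0$.
   Context: Let $\mathcal{F}$ be the (unitary) Fourier transform on $L^2(\mathbb{R}^d)$. For $r\ge 0$, $H^r(\mathbb{R}^d)=\{u\in L^2(\mathbb{R}^d):\|u\|_{H^r}^2=\int_{\mathbb{R}^d}(|\xi|^2+1)^r|\mathcal{F}u(\xi)|^2\,d\xi<\infty\}$ (complex-valued functions), and $(-\Delta+1)^{r/2}u=\mathcal{F}^{-1}(|\xi|^2+1)^{r/2}\mathcal{F}u$. Product spaces carry the norm $\|(u,v)\|_{X\times Y}^2=\|u\|_X^2+\|v\|_Y^2$. For $s>0$ and $0\le\gamma\in L^\infty(\mathbb{R}^d)$, consider the fractional damped Klein--Gordon equation $u_{tt}(t,x)+\gamma(x)u_t(t,x)+(-\Delta+1)^{s/2}u(t,x)=0$ for $(t,x)\in\mathbb{R}_{\ge0}\times\mathbb{R}^d$. For $U=(u,u_t)$ it is the first-order equation $U_t=\mathcal{A}_\gamma U$, where $$\mathcal{A}_\gamma=\begin{pmatrix}0&I\\-(-\Delta+1)^{s/2}&-\gamma(x)\end{pmatrix}$$ has domain $H^s(\mathbb{R}^d)\times H^{s/2}(\mathbb{R}^d)$ and generates a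 $C_0$-semigroup $(e^{t\mathcal{A}_\gamma})_{t\ge0}$ on $H^{s/2}(\mathbb{R}^d)\times L^2(\mathbb{R}^d)$. The energy is $$E(t)=\|e^{t\mathcal{A}_\gamma}(u(0),u_t(0))\|_{H^{s/2}\times L^2}=\Big(\int_{\mathbb{R}^d}\big(|(-\Delta+1)^{s/4}u(t,x)|^2+|u_t(t,x)|^2\big)\,dx\Big)^{1/2}.$$ *)

(* Defs.v *)
From HB Require Import structures.
From mathcomp Require Import all_boot all_order all_algebra.
From mathcomp Require Import all_classical all_reals all_analysis.
From mathcomp Require Import ess_sup_inf.
From mathcomp Require Import complex.

Set Implicit Arguments.
Unset Strict Implicit.
Unset Printing Implicit Defensive.

Import Order.TTheory GRing.Theory Num.Theory.
Import numFieldNormedType.Exports.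

Local Open Scope classical_set_scope.
Local Open Scope ring_scope.
Local Open Scope complex_scope.

Notation Rn R n := (n.-tuple (measurableTypeR R)).

Definition dot (R : realType) (n : nat) (x y : Rn R n) : R :=
  \sum_(i < n) (tnth x i : R) * (tnth y i : R).

Definition cons_Rn (R : realType) (n : nat)
  (p : measurableTypeR R * Rn R n) : Rn R n.+1 := [tuple of p.1 :: p.2].

Lemma measurable_cons_Rn (R : realType) (n : nat) :
  measurable_fun [set: measurableTypeR R * Rn R n] (@cons_Rn R n).
Proof. exact: (measurable_cons measurable_fst measurable_snd). Qed.

(* R^(n+1) carries the image of the product measure under (x, v) |-> x :: v. *)
Section lebesgue_succ.
Variables (R : realType) (n : nat).
Variable mu : {sigma_finite_measure set (Rn R n) -> \bar R}.

Definition lebesgue_succ : set (Rn R n.+1) -> \bar R :=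
  pushforward (lebesgue_measure \x mu)%E (@cons_Rn R n).

Let lebesgue_succ0 : lebesgue_succ set0 = 0%E.
Proof. by rewrite /lebesgue_succ /pushforward preimage_set0 measure0. Qed.

Let lebesgue_succ_ge0 A : (0 <= lebesgue_succ A)%E.
Proof. by rewrite /lebesgue_succ /pushforward; exact: measure_ge0. Qed.

Let lebesgue_succ_sigma_additive : semi_sigma_additive lebesgue_succ.
Proof.
move=> F mF tF mUF; rewrite /lebesgue_succ /pushforward preimage_bigcup.
have mpre A : measurable A -> measurable (@cons_Rn R n @^-1` A).
  by move=> mA; rewrite -[X in measurable X]setTI; exact: measurable_cons_Rn.
apply: measure_semi_sigma_additive.
- by move=> k; exact: mpre.
- apply/trivIsetP => /= i j _ _ ij; rewrite -preimage_setI.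
  by move/trivIsetP : tF => /(_ _ _ _ _ ij) ->//; rewrite preimage_set0.
- by rewrite -preimage_bigcup; exact: mpre.
Qed.

HB.instance Definition _ := isMeasure.Build _ _ _ lebesgue_succ
  lebesgue_succ0 lebesgue_succ_ge0 lebesgue_succ_sigma_additive.

Let uncons (v : Rn R n.+1) : measurableTypeR R * Rn R n :=
  (thead v, [tuple of behead v]).

Let measurable_uncons : measurable_fun setT uncons.
Proof.
by apply/measurable_fun_pairP; split;
  [exact: measurable_tnth | exact: measurable_behead].
Qed.

Let cons_RnK : cancel (@cons_Rn R n) uncons.
Proof. by case=> x v; congr pair => //; apply/val_inj. Qed.

Let lebesgue_succ_sigma_finite : sigma_finite setT lebesgue_succ.
Proof.
have /sigma_finiteP[F [TF ndF Foo]] := sigma_finiteT (@lebesgue_measure R).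
have /sigma_finiteP[G [TG ndG Goo]] := sigma_finiteT mu.
exists (fun k => uncons @^-1` (F k `*` G k)).
  apply/esym; rewrite -subTset => v _.
  have : (\bigcup_i F i) (uncons v).1 by rewrite -TF.
  have : (\bigcup_i G i) (uncons v).2 by rewrite -TG.
  move=> [k _ Gk] [l _ Fl]; exists (maxn k l) => //; split.
  - by move: Fl; exact/subsetPset/ndF/leq_maxr.
  - by move: Gk; exact/subsetPset/ndG/leq_maxl.
move=> k; have [mF Fk] := Foo k; have [mG Gk] := Goo k; split.
  rewrite -[X in measurable X]setTI.
  by apply: measurable_uncons => //; exact: measurableX.
rewrite /lebesgue_succ /pushforward -comp_preimage.
rewrite (_ : uncons \o _ = id) ?preimage_id; last exact/funext/cons_RnK.
by rewrite product_measure1E// lte_mul_pinfty// ge0_fin_numE.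
Qed.

HB.instance Definition _ := Measure_isSigmaFinite.Build _ _ _ lebesgue_succ
  lebesgue_succ_sigma_finite.

End lebesgue_succ.

Fixpoint lebesgue_Rn (R : realType) (n : nat) :
    {sigma_finite_measure set (Rn R n) -> \bar R} :=
  match n with
  | 0 => \d_([tuple] : Rn R 0)
  | m.+1 => lebesgue_succ (lebesgue_Rn R m)
  end.

Section fourier_sobolev.
Variables (R : realType) (d : nat).
Local Notation mu := (lebesgue_Rn R d).
Local Notation cfun := (Rn R d -> R[i]).
Local Notation normc := (@Normc.normc R).

Definition cmeasurable (u : cfun) : Prop :=
  measurable_fun setT (fun x => complex.Re (u x)) /\
  measurable_fun setT (fun x => complex.Im (u x)).

Definition cLnorm (p : \bar R) (u : cfun) : \bar R :=
  ('N[mu]_p[EFin \o (normc \o u)])%E.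

Definition cLp (p : \bar R) (u : cfun) : Prop :=
  cmeasurable u /\ (cLnorm p u < +oo)%E.

Definition cintegral (f : cfun) : R[i] :=
  Rintegral mu setT (fun x => complex.Re (f x)) +i*
  Rintegral mu setT (fun x => complex.Im (f x)).

(* (2 pi)^{-d/2} \int e^{- i x . xi} f(x) dx, so that -Delta has symbol |xi|^2 *)
Definition fourier_int (f : cfun) : cfun := fun xi =>
  ((2 * pi) `^ (- (d%:R / 2)))%:C *
  cintegral (fun x => (cos (dot x xi) -i* sin (dot x xi)) * f x).

(* Extension by continuity from L^1 \cap L^2 to L^2; v is only determined up to
   a null set. *)
Definition is_fourier (u v : cfun) : Prop :=
  [/\ cLp 2%:E u, cLp 2%:E v &
  exists un : nat -> cfun,
    [/\ forall n, cLp 1%:E (un n) /\ cLp 2%:E (un n),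
        cLnorm 2%:E (un n - u) @[n --> \oo] --> 0%E &
        cLnorm 2%:E (fourier_int (un n) - v) @[n --> \oo] --> 0%E]].

Definition fourier (u : cfun) : cfun := xget 0 [set v | is_fourier u v].

Definition fourier_inv (v : cfun) : cfun := xget 0 [set u | is_fourier u v].

Definition japanese (xi : Rn R d) : R := dot xi xi + 1.

Definition sobolev_sqnorm (r : R) (u : cfun) : \bar R :=
  (\int[mu]_xi (japanese xi `^ r * normc (fourier u xi) ^+ 2)%:E)%E.

Definition sobolev (r : R) : set cfun :=
  [set u | cLp 2%:E u /\ (sobolev_sqnorm r u < +oo)%E].

(* (- Delta + 1)^a, so (- Delta + 1)^{s/2} is [bessel (s / 2)] *)
Definition bessel (a : R) (u : cfun) : cfun :=
  fourier_inv (fun xi => (japanese xi `^ a)%:C * fourier u xi).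

End fourier_sobolev.

(* Elements of V are representatives: N is a seminorm on the subspace X, and
   vectors of X at N-distance 0 are identified; hence equations between vectors
   read "N of the difference is 0". *)
Section semigroup.
Variables (R : realType) (V : lmodType R[i]) (X : set V) (N : V -> R).

Definition bounded_linear_on (L : V -> V) : Prop :=
  [/\ forall U, X U -> X (L U),
      forall (a : R[i]) U W, X U -> X W ->
        N (L (a *: U + W) - (a *: L U + L W)) = 0 &
      exists M : R, forall U, X U -> N (L U) <= M * N U].

Definition C0_semigroup (T : R -> V -> V) : Prop :=
  [/\ forall t, 0 <= t -> bounded_linear_on (T t),
      forall U, X U -> N (T 0 U - U) = 0,
      forall t t' U, 0 <= t -> 0 <= t' -> X U ->
        N (T (t + t') U - T t (T t' U)) = 0 &
      forall U, X U -> N (T t U - U) @[t --> 0^'+] --> 0].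

Definition generates (D : set V) (A : V -> V) (T : R -> V -> V) : Prop :=
  C0_semigroup T /\
  forall U W, X U -> X W ->
    (N ((h^-1)%:C *: (T h U - U) - W) @[h --> 0^'+] --> 0) <->
    (D U /\ N (A U - W) = 0).

End semigroup.

Notation state R d := ((Rn R d -> R[i]) * (Rn R d -> R[i]))%type.

Section klein_gordon.
Variables (R : realType) (d : nat) (s : R) (gamma : Rn R d -> R).

Definition energy_space : set (state R d) :=
  [set U | sobolev (s / 2) U.1 /\ cLp 2%:E U.2].

Definition energy_norm (U : state R d) : R :=
  Num.sqrt (fine (sobolev_sqnorm (s / 2) U.1) + fine (cLnorm 2%:E U.2) ^+ 2).

Definition KG_domain : set (state R d) :=
  [set U | sobolev s U.1 /\ sobolev (s / 2) U.2].

Definition KG_op (U : state R d) : state R d :=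
  (U.2, fun x => - bessel (s / 2) U.1 x - (gamma x)%:C * U.2 x).

End klein_gordon.

(* Main.v *)
Require Import Defs.
From HB Require Import structures.
From mathcomp Require Import all_boot all_order all_algebra.
From mathcomp Require Import all_classical all_reals all_analysis.
From mathcomp Require Import measurable_realfun ess_sup_inf.
From mathcomp Require Import complex.
From mathcomp Require Import ring lra.

Set Implicit Arguments.
Unset Strict Implicit.
Unset Printing Implicit Defensive.

Import Order.TTheory GRing.Theory Num.Theory.
Import numFieldNormedType.Exports.

Local Open Scope classical_set_scope.
Local Open Scope ring_scope.

(** Why the theorem holds.  If gamma >= c > 0, the damping dissipates the
    velocity only: Re (U, A U) = - int gamma |v|^2 for U = (u, v).  Adding the small
    multiple 2 ep Re (u, v) of the cross term to the energy makes the position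
    dissipate as well, so that the modified form satisfies Re (U, A U) <= - kap |U|^2
    (qform_dissip); as it is equivalent to the energy, the semigroup decays
    (dissipative_decay).

    Conversely, exponential decay bounds the resolvent on the imaginary axis:
    N U <= K N (A U - i lam U), uniformly in the real number lam (decay_resolvent).
    This is tested on wave packets U = (u, i lam u), where u is a function phi with
    transform supported in a ball, multiplied by a character of large frequency a,
    and lam = <a>^{s/2}, which solves the dispersion relation.  Then
    A U - i lam U = (0, - ((1 - Delta)^{s/2} - lam^2) u - i lam gamma u).  On the
    support of the transform of u the symbol <xi>^s differs from <a>^s by
    O (<a>^{s - 1}), and this is o (lam) exactly because s < 2: dividing by lam and
    letting a tend to infinity leaves |phi| <= K |gamma phi|, first for band-limited
    phi (band_limited_bound) and by density for all phi in L^2 (damping_bound).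
    Indicators of bounded pieces of {gamma < c} with K c < 1 violate this unless
    they are null (damping_bounded_below), hence ess inf gamma > 0.

    Only the fact that A generates T is given.  Local boundedness of T follows
    from strong continuity by a gliding hump (C0_bounded), and both uses of the
    generator replace differentiation of orbits by products of many small steps
    (resolvent_estimate, dissipative_decay_domain).

    The space of states needs the unitary Fourier transform of L^2 (R^n), in
    particular its surjectivity.  Inner products of transforms of intervals are
    computed from the Fejer integral (integral_fejer, ihat_gram); tensor products
    extend them to boxes and linearity to step functions (stepf_isometry), which
    are dense because boxes generate the measurable sets (stepf_dense).
    Completeness then yields the transform of every square integrable function
    (is_fourier_exists), and the adjoint relation with step functions its
    uniqueness and surjectivity (is_fourier_unique, is_fourier_surj). *)

Local Notation re := (@complex.Re _).
Local Notation im := (@complex.Im _).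

(** * Seminorms and completeness *)

Section seminorm.
Local Open Scope complex_scope.
Variables (R : realType) (V : lmodType R[i]).
Local Notation normc := (@Normc.normc R).

Lemma normc_real (a : R) : normc a%:C = `|a|.
Proof. by rewrite /= expr0n /= addr0 sqrtr_sqr. Qed.

Lemma normc_ge0 (z : R[i]) : 0 <= normc z.
Proof. by case: z => a b; exact: sqrtr_ge0. Qed.

Lemma normcX (z : R[i]) n : normc (z ^+ n) = normc z ^+ n.
Proof. by elim: n => [|n IH]; rewrite ?expr0 ?Normc.normc1// !exprS Normc.normcM IH. Qed.

Definition lin_closed (X : set V) : Prop :=
  X 0 /\ forall (c : R[i]) u v, X u -> X v -> X (c *: u + v).

Record seminorm_on (X : set V) (N : V -> R) : Prop := SeminormOn {
  sn_lin : lin_closed X;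
  sn_tri : forall u v, X u -> X v -> N (u + v) <= N u + N v;
  sn_hom : forall (c : R[i]) u, X u -> N (c *: u) = normc c * N u }.

Section lin_closed.
Variable X : set V.
Hypothesis XL : lin_closed X.

Lemma lin0 : X 0. Proof. by case: XL. Qed.

Lemma linZ (c : R[i]) u : X u -> X (c *: u).
Proof. by case: XL => X0 XD Xu; rewrite -[_ *: _]addr0; exact: XD. Qed.

Lemma linD u v : X u -> X v -> X (u + v).
Proof. by case: XL => X0 XD Xu Xv; rewrite -[u]scale1r; exact: XD. Qed.

Lemma linN u : X u -> X (- u).
Proof. by move=> Xu; rewrite -scaleN1r; exact: linZ. Qed.

Lemma linB u v : X u -> X v -> X (u - v).
Proof. by move=> Xu Xv; apply: linD => //; exact: linN. Qed.

End lin_closed.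

Section seminorm_theory.
Variables (X : set V) (N : V -> R).
Hypothesis XN : seminorm_on X N.
Let XL := sn_lin XN.

Lemma sn0 : N 0 = 0.
Proof. by rewrite -(scale0r (0 : V)) (sn_hom XN) ?Normc.normc0 ?mul0r//; exact: lin0 XL. Qed.

Lemma snN u : X u -> N (- u) = N u.
Proof.
move=> Xu; rewrite -scaleN1r (sn_hom XN)// (_ : -1 = (-1)%:C).
  by rewrite normc_real normrN1 mul1r.
by rewrite rmorphN.
Qed.

Lemma sn_homR (a : R) u : X u -> N (a%:C *: u) = `|a| * N u.
Proof. by move=> Xu; rewrite (sn_hom XN)// normc_real. Qed.

Lemma sn_ge0 u : X u -> 0 <= N u.
Proof.
move=> Xu; have := sn_tri XN Xu (linN XL Xu).
by rewrite subrr sn0 snN//; lra.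
Qed.

Lemma sn_distC u v : X u -> X v -> N (u - v) = N (v - u).
Proof. by move=> Xu Xv; rewrite -opprB snN//; exact: linB. Qed.

Lemma sn_triB u v : X u -> X v -> N (u - v) <= N u + N v.
Proof. by move=> Xu Xv; rewrite -(snN Xv); exact: (sn_tri XN Xu (linN XL Xv)). Qed.

Lemma sn_tri3 u v w : X u -> X v -> X w -> N (u - w) <= N (u - v) + N (v - w).
Proof.
move=> Xu Xv Xw; rewrite -(subrKA v u (- w)).
by apply: (sn_tri XN); exact: linB.
Qed.

Lemma sn_le_sub u v : X u -> X v -> N u <= N v + N (u - v).
Proof.
by move=> Xu Xv; rewrite -{1}(subrK v u) addrC; apply: (sn_tri XN) => //; exact: linB.
Qed.

Lemma sn_eq u v : X u -> X v -> N (u - v) = 0 -> N u = N v.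
Proof.
move=> Xu Xv uv0; apply/eqP; rewrite eq_le.
have := sn_le_sub Xu Xv; have := sn_le_sub Xv Xu.
by rewrite sn_distC// uv0 !addr0 => -> ->.
Qed.

End seminorm_theory.

(** Only rapidly Cauchy sequences are asked to converge: the gliding hump and
    the projection below can choose their rate, and Riesz-Fischer is immediate
    at a geometric rate. *)
Definition complete_on (X : set V) (N : V -> R) : Prop :=
  forall u : nat -> V, (forall n, X (u n)) ->
    (forall n, N (u n.+1 - u n) <= 4^-1 ^+ n) ->
    exists2 l, X l & N (u n - l) @[n --> \oo] --> 0.

Section complete.
Variables (X : set V) (N : V -> R).
Hypotheses (XN : seminorm_on X N) (XC : complete_on X N).
Let XL := sn_lin XN.

Lemma complete_rate (u : nat -> V) : (forall n, X (u n)) ->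
    (forall n, N (u n.+1 - u n) <= 4^-1 ^+ n) ->
  exists2 l, X l & forall n, N (u n - l) <= 4 / 3 * 4^-1 ^+ n.
Proof.
move=> Xu ucau; have [l Xl ul] := XC Xu ucau; exists l => // n.
have tel k : N (u n - u (n + k)%N) <= 4 / 3 * (4^-1 ^+ n - 4^-1 ^+ (n + k)).
  elim: k => [|k IH]; first by rewrite addn0 !subrr mulr0 (sn0 XN).
  apply: (le_trans (sn_tri3 XN (Xu n) (Xu (n + k)%N) (Xu _))).
  apply: (le_trans (lerD IH (lexx _))).
  rewrite (sn_distC XN)// addnS; have := ucau (n + k)%N.
  rewrite exprS; lra.
have lim_le k : N (u n - l) <= 4 / 3 * 4^-1 ^+ n + N (u (n + k)%N - l).
  apply: (le_trans (sn_tri3 XN (Xu n) (Xu (n + k)%N) Xl)).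
  apply: lerD => //; apply: (le_trans (tel k)).
  have : 0 <= 4^-1 ^+ (n + k) :> R by rewrite exprn_ge0// invr_ge0.
  lra.
apply/ler_addgt0Pr => e e0.
have := cvgr_lt 0 ul _ e0; move=> [m _ mP].
apply: (le_trans (lim_le m)); rewrite lerD2l ltW//.
by apply: mP; rewrite /= leq_addl.
Qed.

End complete.

End seminorm.

(** * Strongly continuous semigroups are locally bounded *)

Section bounded_operators.
Local Open Scope complex_scope.
Variables (R : realType) (V : lmodType R[i]).
Local Notation normc := (@Normc.normc R).
Variables (X : set V) (N : V -> R).
Hypothesis XN : seminorm_on X N.
Let XL := sn_lin XN.

Section one_operator.
Variable L : V -> V.
Hypothesis LB : bounded_linear_on X N L.

Lemma bl_X U : X U -> X (L U). Proof. by case: LB => + _ _; exact. Qed.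

Lemma bl_D U W : X U -> X W -> N (L (U + W) - (L U + L W)) = 0.
Proof. by case: LB => _ + _ XU XW => /(_ 1 U W XU XW); rewrite !scale1r. Qed.

Lemma bl_0 : N (L 0) = 0.
Proof.
have X0 := lin0 XL; have := bl_D X0 X0; rewrite addr0 opprD addrA subrr add0r.
by rewrite (snN XN)//; exact: bl_X.
Qed.

Lemma bl_lin (a : R[i]) U W : X U -> X W -> N (L (a *: U + W)) = N (a *: L U + L W).
Proof.
case: LB => LX LL _ XU XW; apply: (sn_eq XN); last exact: LL.
- by apply: LX; apply: (XL.2).
- by apply: (XL.2); apply: LX.
Qed.

Lemma bl_B U W : X U -> X W -> N (L (U - W)) = N (L U - L W).
Proof.
move=> XU XW; rewrite addrC -scaleN1r bl_lin// scaleN1r addrC //.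
Qed.

Lemma bl_Z (a : R[i]) U : X U -> N (L (a *: U)) = normc a * N (L U).
Proof.
move=> XU; have X0 := lin0 XL; rewrite -[a *: U]addr0 bl_lin//.
have XLU := bl_X XU; have XL0 := bl_X X0.
rewrite -(sn_hom XN)//; apply: (sn_eq XN).
- exact: (XL.2).
- exact: linZ.
- by rewrite addrAC subrr add0r bl_0.
Qed.

(** M is the infimum of the admissible bounds: two thirds of it is not admissible,
    and scaling moves a vector that violates it to any prescribed radius. *)
Lemma near_optimal_vector (K : R) : 0 < K ->
  ~ (forall U, X U -> N (L U) <= K * N U) ->
  exists M, [/\ K <= M, forall U, X U -> N (L U) <= M * N U &
    forall r, 0 < r -> exists U, [/\ X U, N U <= r & 2 / 3 * M * r <= N (L U)]].
Proof.
move=> K0 notK; case: LB => LX _ [M0 LM0].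
pose B := [set M | 0 <= M /\ forall U, X U -> N (L U) <= M * N U].
have B0 : B !=set0.
  exists `|M0|; split => // U XU; apply: (le_trans (LM0 _ XU)).
  by rewrite ler_wpM2r ?ler_norm// (sn_ge0 XN).
have hB : has_inf B by split => //; exists 0 => M [].
have Bge M : B M -> K <= M.
  move=> [M0' BM]; rewrite leNgt; apply/negP => MK; apply: notK => U XU.
  apply: (le_trans (BM _ XU)); rewrite ler_wpM2r ?(sn_ge0 XN)//; exact: ltW.
have KB : K <= inf B by apply: lb_le_inf.
have M0' : 0 < inf B by exact: lt_le_trans KB.
have infB U : X U -> N (L U) <= inf B * N U.
  move=> XU; have := sn_ge0 XN XU; rewrite le_eqVlt => /orP[/eqP NU0|NU0].
    by have [M [_ /(_ U XU)]] := B0; rewrite -NU0 !mulr0.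
  rewrite -ler_pdivrMr//; apply: lb_le_inf => // M [_ BM].
  by rewrite ler_pdivrMr//; exact: BM.
exists (inf B); split => // r r0.
have [U XU LU] : exists2 U, X U & 2 / 3 * inf B * N U < N (L U).
  apply: contrapT => /forall2NP h.
  suff : inf B <= 2 / 3 * inf B by lra.
  apply: ge_inf; first by case: hB.
  split; first by lra.
  by move=> U XU; case: (h U) => // /negP; rewrite -leNgt.
have NU0 : 0 < N U.
  rewrite lt_neqAle (sn_ge0 XN)// andbT; apply/eqP => NU0.
  by have := lt_le_trans LU (infB U XU); rewrite -NU0 !mulr0 ltxx.
exists ((r / N U)%:C *: U); split; first exact: linZ.
- by rewrite (sn_homR XN)// ger0_norm ?divfK ?gt_eqF// divr_ge0// ltW.
- rewrite bl_Z// normc_real ger0_norm; last by rewrite divr_ge0// ltW.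
  rewrite [leRHS]mulrAC ler_pdivlMr//.
  have -> : 2 / 3 * inf B * r * N U = r * (2 / 3 * inf B * N U) by ring.
  by rewrite ler_pM2l// ltW.
Qed.

End one_operator.

Section C0.
Hypothesis XC : complete_on X N.
Variable T : R -> V -> V.
Hypothesis TC : C0_semigroup X N T.

Lemma C0_X t U : 0 <= t -> X U -> X (T t U).
Proof. by case: TC => TB _ _ _ t0; exact: (bl_X (TB _ t0)). Qed.

Lemma C0_id U : X U -> N (T 0 U) = N U.
Proof.
move=> XU; apply: (sn_eq XN) => //; first exact: C0_X.
by case: TC => _ + _ _; exact.
Qed.

Lemma C0_add t t' U : 0 <= t -> 0 <= t' -> X U -> N (T (t + t') U) = N (T t (T t' U)).
Proof.
move=> t0 t'0 XU; apply: (sn_eq XN); [apply: C0_X => //; exact: addr_ge0| |].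
- by apply: C0_X => //; apply: C0_X.
- by case: TC => _ _ + _; exact.
Qed.

(** Uniform boundedness near time 0 by the gliding hump: were it false, vectors
    x_n with |x_{n+1} - x_n| <= 4^-n could be chosen so that T_{t_n} x_{n+1} is
    large at times t_n -> 0, and T_{t_n} would stay large on their limit. *)
Lemma C0_bounded_near0 : exists2 del, 0 < del &
  exists M, forall t U, 0 <= t <= del -> X U -> N (T t U) <= M * N U.
Proof.
apply: contrapT => notB.
have bad n : exists t, [/\ 0 < t, t <= n.+1%:R^-1 &
    ~ (forall U, X U -> N (T t U) <= 16 ^+ n * N U)].
  apply: contrapT => /forallNP h; apply: notB; exists n.+1%:R^-1 => //.
  exists (16 ^+ n) => t U /andP[]; rewrite le_eqVlt => /orP[/eqP <- _ XU|t0 tn XU].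
    by rewrite C0_id// ler_peMl ?(sn_ge0 XN)// exprn_ege1// ler1n.
  by apply: contrapT => h'; apply: (h t); split => // /(_ U XU).
pose t n := sval (cid (bad n)).
have tP n : [/\ 0 < t n, t n <= n.+1%:R^-1 &
  ~ (forall U, X U -> N (T (t n) U) <= 16 ^+ n * N U)] by exact: (svalP (cid (bad n))).
have TB n : bounded_linear_on X N (T (t n)).
  by case: TC => + _ _ _; apply; case: (tP n) => /ltW.
(* One of x + U and x - U is moved far by T_{t_n} as soon as U is; the last
   conclusion says that later corrections cannot undo this. *)
have step n x : X x -> exists y, [/\ X y, N (y - x) <= 4^-1 ^+ n &
    forall l, X l -> N (y - l) <= 4 / 3 * 4^-1 ^+ n.+1 ->
      4 ^+ n / 3 <= N (T (t n) l)].
  move=> Xx; have [t0 tn nB] := tP n.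
  have [M [KM MB big]] := near_optimal_vector (TB n) (exprn_gt0 n (ltr0Sn _ _)) nB.
  have q0 : 0 < 4^-1 ^+ n :> R by rewrite exprn_gt0// invr_gt0.
  have [U [XU NU TU]] := big _ q0.
  have [y [Xy yx Ty]] : exists y, [/\ X y, N (y - x) <= 4^-1 ^+ n &
      N (T (t n) U) <= N (T (t n) y)].
    have XD := linD XL Xx XU; have XB := linB XL Xx XU.
    have tri : 2 * N (T (t n) U) <= N (T (t n) (x + U)) + N (T (t n) (x - U)).
      have XTD := bl_X (TB n) XD; have XTB := bl_X (TB n) XB.
      have -> : 2 * N (T (t n) U) = N (T (t n) (2%:C *: U)).
        by rewrite (bl_Z (TB n))// normc_real ger0_norm.
      have -> : 2%:C *: U = (x + U) - (x - U).
        by rewrite opprB addrC addrA subrK rmorphMn /= scaler_nat mulr2n.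
      by rewrite (bl_B (TB n))//; exact: (sn_triB XN).
    have [hle|hlt] := lerP (N (T (t n) U)) (N (T (t n) (x + U))).
      by exists (x + U); split => //; rewrite addrAC subrr add0r.
    exists (x - U); split => //; last by lra.
    by rewrite addrAC subrr add0r (snN XN).
  exists y; split => // l Xl yl.
  have := sn_le_sub XN (bl_X (TB n) Xy) (bl_X (TB n) Xl).
  rewrite -(bl_B (TB n))// => h.
  have h2 := le_trans (MB _ (linB XL Xy Xl)) (ler_wpM2l _ yl).
  have M0 : 0 <= M by apply: le_trans KM; exact: exprn_ge0.
  have {}h2 := h2 M0; rewrite exprS in h2.
  have : 4 ^+ n <= M * 4^-1 ^+ n.
    rewrite exprVn ler_pdivlMr ?exprn_gt0// -exprMn (_ : 4 * 4 = 16 :> R)//; lra.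
  nra.
pose next n x := if pselect (X x) is left Xx then sval (cid (step n x Xx)) else 0.
pose fix x n := if n is m.+1 then next m (x m) else 0.
have Xx n : X (x n).
  elim: n => [|n IH] /=; first exact: lin0 XL.
  rewrite /next; case: pselect => // Xx.
  by case: (svalP (cid (step n (x n) Xx))).
have xP n : N (x n.+1 - x n) <= 4^-1 ^+ n /\
    forall l, X l -> N (x n.+1 - l) <= 4 / 3 * 4^-1 ^+ n.+1 ->
      4 ^+ n / 3 <= N (T (t n) l).
  rewrite /= /next; case: pselect => [h|/(_ (Xx n))//].
  by case: (svalP (cid (step n (x n) h))).
have [l Xl xl] := complete_rate XN XC Xx (fun n => (xP n).1).
have large n : 4 ^+ n / 3 <= N (T (t n) l) by apply: (xP n).2 => //; exact: xl.
have cv : N (T h l - l) @[h --> 0^'+] --> 0 by case: TC => _ _ _; exact.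
have [e /= e0 eP] : \forall h \near 0^'+, N (T h l - l) < 1 by exact: cvgr_lt cv _ ltr01.
have tsmall : \forall n \near \oo, t n < e.
  near=> n; have [_ + _] := tP n; move=> /le_lt_trans; apply.
  near: n; exact: near_infty_natSinv_lt (PosNum e0).
have lbig : \forall n \near \oo, 3 * (N l + 1) < 4 ^+ n.
  near=> n; apply: lt_le_trans (_ : n%:R <= _).
    near: n; exact: nbhs_infty_gtr.
  rewrite -natrX ler_nat; exact/ltnW/ltn_expl.
near \oo => n.
have te : N (T (t n) l - l) < 1.
  apply: eP; last by case: (tP n).
  rewrite /= sub0r normrN gtr0_norm; last by case: (tP n).
  by near: n.
have b : 3 * (N l + 1) < 4 ^+ n by near: n.
have := sn_le_sub XN (_ : X (T (t n) l)) Xl.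
have := large n; have XTl : X (T (t n) l) by apply: C0_X => //; case: (tP n) => /ltW.
move=> h /(_ XTl); lra.
Unshelve. all: by end_near. Qed.

Lemma C0_bounded t : 0 <= t -> exists2 M, 0 <= M &
  forall r U, 0 <= r <= t -> X U -> N (T r U) <= M * N U.
Proof.
move=> t0; have [del del0 [M0 MB0]] := C0_bounded_near0.
pose M : R := `|M0|.
have M_ge0 : 0 <= M by exact: normr_ge0.
have MB r U : 0 <= r <= del -> X U -> N (T r U) <= M * N U.
  move=> rd XU; apply: (le_trans (MB0 r U rd XU)).
  by rewrite ler_wpM2r ?ler_norm// (sn_ge0 XN).
pose m := (Num.truncn (t / del)).+1.
have m0 : 0 < m%:R :> R by rewrite ltr0n.
exists (M ^+ m) => [|r U /andP[r0 rt] XU]; first by rewrite exprn_ge0.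
have rm : 0 <= r / m%:R <= del.
  rewrite divr_ge0//= ler_pdivrMr// (le_trans rt)// mulrC -ler_pdivrMr//.
  by rewrite ltW// truncnS_gt.
have it k : N (T (k%:R * (r / m%:R)) U) <= M ^+ k * N U.
  have hk j : 0 <= j%:R * (r / m%:R) by rewrite mulr_ge0//; case/andP: rm.
  elim: k => [|k IH]; first by rewrite mul0r expr0 mul1r C0_id.
  rewrite -natr1 mulrDl mul1r addrC C0_add//; last by case/andP: rm.
  apply: (le_trans (MB _ _ rm (C0_X (hk k) XU))).
  by rewrite exprS -mulrA ler_wpM2l.
by have := it m; rewrite mulrC divfK// gt_eqF.
Qed.

End C0.
End bounded_operators.

(** * Resolvent bound and decay from the generator *)

Section generator.
Local Open Scope complex_scope.
Variables (R : realType) (V : lmodType R[i]).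
Local Notation normc := (@Normc.normc R).
Variables (X : set V) (N : V -> R).
Hypothesis XN : seminorm_on X N.
Let XL := sn_lin XN.
Variables (D : set V) (A : V -> V) (T : R -> V -> V).
Hypothesis TG : generates X N D A T.
Hypothesis DX : forall U, D U -> X U /\ X (A U).
Let TC : C0_semigroup X N T := TG.1.
Let TB t : 0 <= t -> bounded_linear_on X N (T t). Proof. by case: TC => + _ _ _; exact. Qed.

Lemma generator_cvg U : D U -> N ((h^-1)%:C *: (T h U - U) - A U) @[h --> 0^'+] --> 0.
Proof.
move=> DU; have [XU XAU] := DX DU; apply/(TG.2 U (A U) XU XAU); split => //.
by rewrite subrr (sn0 XN).
Qed.

(** Powers of T_h / (1 + i lam h) telescope, which avoids differentiating the
    orbit: the contraction factor 1 / (1 + i lam h) stands in for e^{-i lam h}. *)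
Lemma resolvent_estimate (C t lam : R) U :
  0 <= C -> 0 < t -> D U -> (forall r W, 0 <= r -> X W -> N (T r W) <= C * N W) ->
  N U <= N (T t U) + t * C * N (A U - (0 +i* lam) *: U).
Proof.
move=> C0 t0 DU Tbnd; have [XU XAU] := DX DU.
pose W := A U - (0 +i* lam) *: U.
have XW : X W by apply: (linB XL) => //; exact: linZ.
have step n : (0 < n)%N -> N U <= N (T t U) +
    t * C * (N W + N (((t / n%:R)^-1)%:C *: (T (t / n%:R) U - U) - A U)).
  move=> n0; set h := t / n%:R.
  have h0 : 0 < h by rewrite divr_gt0// ltr0n.
  have hk k : 0 <= k%:R * h by rewrite mulr_ge0// ltW.
  set e := N (_ - A U).
  pose z : R[i] := (1 +i* (lam * h))^-1.
  have nz : normc z <= 1.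
    rewrite Normc.normcV invf_le1; last first.
      by rewrite /= sqrtr_gt0 expr1n ltr_wpDr ?sqr_ge0.
    rewrite /= -[leLHS]sqrtr1 ler_sqrt ?addr_ge0 ?sqr_ge0//.
    by rewrite expr1n lerDl sqr_ge0.
  have nzX k : normc (z ^+ k) <= 1 by rewrite normcX exprn_ile1// normc_ge0.
  have z1 : z * (1 +i* (lam * h)) = 1.
    rewrite mulVf//; apply/eqP => /(congr1 (@complex.Re R))/= /eqP.
    by rewrite oner_eq0.
  have XTh : X (T h U) by apply: (C0_X TC) => //; exact: ltW.
  have XT k : X (T (k%:R * h) U) by exact: (C0_X TC).
  (* (1 + i lam h) (z T_h U - U) = T_h U - U - i lam h U = h (W + o(1)). *)
  have one : N (z *: T h U - U) <= h * (N W + e).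
    have -> : z *: T h U - U = z *: (T h U - (1 +i* (lam * h)) *: U).
      by rewrite scalerBr scalerA z1 scale1r.
    have eqW : T h U - (1 +i* (lam * h)) *: U =
        h%:C *: (W + ((h^-1)%:C *: (T h U - U) - A U)).
      rewrite /W [A U - _]addrC -addrA [A U + _]addrC subrK.
      rewrite scalerDr scalerA -rmorphM/= divff ?gt_eqF// rmorph1 scale1r.
      rewrite scalerN scalerA [RHS]addrC -[RHS]addrA; congr (_ + _).
      rewrite -opprD; congr (- _).
      rewrite -{2}(scale1r U) -scalerDl; congr (_ *: _).
      by apply/eqP; rewrite eq_complex/=; apply/andP; split; apply/eqP; ring.
    have XE : X ((h^-1)%:C *: (T h U - U) - A U).
      by apply: (linB XL) => //; apply: (linZ XL); exact: linB.
    rewrite (sn_hom XN); last by apply: (linB XL) => //; exact: linZ.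
    apply: (le_trans (ler_wpM2r _ nz)).
      by apply: (sn_ge0 XN); apply: (linB XL) => //; exact: linZ.
    rewrite mul1r eqW (sn_homR XN); last exact: linD.
    by rewrite gtr0_norm// ler_pM2l//; exact: (sn_tri XN).
  have it k : N (z ^+ k *: T (k%:R * h) U - U) <= k%:R * (C * (h * (N W + e))).
    elim: k => [|k IH].
      rewrite expr0 scale1r !mul0r.
      by case: TC => _ /(_ _ XU) -> _ _.
    have XB : X (z *: T h U - U) by apply: (linB XL) => //; exact: linZ.
    have -> : z ^+ k.+1 *: T (k.+1%:R * h) U - U =
      z ^+ k *: (z *: T (k.+1%:R * h) U - T (k%:R * h) U) +
      (z ^+ k *: T (k%:R * h) U - U).
      by rewrite scalerBr scalerA -exprSr addrA subrK.
    have XS : X (z *: T (k.+1%:R * h) U - T (k%:R * h) U).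
      by apply: (linB XL) => //; exact: linZ.
    apply: (le_trans (sn_tri XN (linZ XL _ XS) _)).
      by apply: (linB XL) => //; exact: linZ.
    rewrite -[k.+1%:R in leRHS]natr1 mulrDl mul1r [leRHS]addrC; apply: lerD => //.
    rewrite (sn_hom XN)//; apply: (le_trans (ler_wpM2r (sn_ge0 XN XS) (nzX k))).
    rewrite mul1r.
    have -> : N (z *: T (k.+1%:R * h) U - T (k%:R * h) U) =
        N (T (k%:R * h) (z *: T h U - U)).
      rewrite (bl_B XN (TB (hk k)))//; last exact: linZ.
      have XTT : X (T (k%:R * h) (T h U)) by exact: (C0_X TC).
      have XTz : X (T (k%:R * h) (z *: T h U)) by apply: (C0_X TC) => //; exact: linZ.
      apply: (sn_eq XN) => //; first exact: linB.
      rewrite opprB addrA subrK.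
      apply/eqP; rewrite eq_le (sn_ge0 XN) ?andbT; last by apply: (linB XL) => //; exact: linZ.
      apply: (le_trans (sn_tri3 XN _ (linZ XL z XTT) _)) => //; first exact: linZ.
      rewrite -scalerBr (sn_hom XN); last exact: linB.
      case: TC => _ _ /(_ (k%:R * h) h U (hk k) (ltW h0) XU) + _.
      rewrite -natr1 mulrDl mul1r => ->; rewrite mulr0 add0r.
      have [_ /(_ z (T h U) 0 XTh (lin0 XL)) + _] := TB (hk k).
      rewrite addr0 (sn_distC XN)//; last exact: linZ.
      move=> E; have XT0 := bl_X (TB (hk k)) (lin0 XL).
      rewrite (sn_eq XN (_ : X (T (k%:R * h) (z *: T h U) - z *: T (k%:R * h) (T h U)))
        (_ : X (T (k%:R * h) (z *: T h U) - (z *: T (k%:R * h) (T h U) + T (k%:R * h) 0)))) ?E//.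
      + by apply: (linB XL) => //; exact: linZ.
      + by apply: (linB XL) => //; apply: (linD XL) => //; exact: linZ.
      + by rewrite opprB addrC addrA subrK addrAC subrr add0r (bl_0 XN (TB (hk k))).
    apply: (le_trans (Tbnd _ _ (hk k) XB)).
    by rewrite ler_wpM2l.
  have := it n; have nh : n%:R * h = t.
    by rewrite /h mulrC divfK// pnatr_eq0 -lt0n.
  rewrite nh => itn.
  have XTt := C0_X TC (ltW t0) XU.
  have := sn_le_sub XN XU (linZ XL (z ^+ n) XTt).
  move=> /le_trans; apply; apply: lerD.
    rewrite (sn_hom XN)// ler_piMl//; exact: (sn_ge0 XN).
  rewrite (sn_distC XN)//; last exact: linZ.
  apply: (le_trans itn); rewrite -nh; lra.
have cv := generator_cvg DU.
apply/ler_addgt0Pr => e e0.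
have d0 : 0 < e / (t * C + 1) by rewrite divr_gt0// ltr_wpDl// mulr_ge0// ltW.
have [r /= r0 rP] := cvgr_lt 0 cv _ d0.
near \oo => n.
have n0 : (0 < n)%N by near: n; exact: nbhs_infty_gt.
have tn : t / n%:R < r.
  rewrite ltr_pdivrMr ?ltr0n// mulrC -ltr_pdivrMr//.
  by near: n; exact: nbhs_infty_gtr.
have tn0 : 0 < t / n%:R by rewrite divr_gt0// ltr0n.
have small := rP (t / n%:R).
rewrite /= sub0r normrN gtr0_norm// in small; have {}small := small tn tn0.
apply: (le_trans (step n n0)); rewrite mulrDr addrA lerD2l.
apply: (le_trans (ler_wpM2l _ (ltW small))); first by rewrite mulr_ge0// ltW.
rewrite mulrA ler_pdivrMr; last by rewrite ltr_wpDl// mulr_ge0// ltW.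
by rewrite mulrC ler_pM2l// lerDl.
Unshelve. all: by end_near. Qed.

Section decay.
Hypothesis XC : complete_on X N.
Variables (n : V -> R) (c1 kap : R).
Hypotheses (Xn : seminorm_on X n) (c1_ge0 : 0 <= c1) (kap0 : 0 < kap).
Hypothesis nN : forall U, X U -> n U <= c1 * N U.
Hypothesis dissip : forall U h, D U -> 0 < h ->
  (1 + kap * h) * n U <= n (U - h%:C *: A U).
Hypothesis dense : forall U e, X U -> 0 < e -> exists2 W, D W & N (U - W) < e.

Let n_eq U W : X U -> X W -> N (U - W) = 0 -> n U = n W.
Proof.
move=> XU XW UW; apply: (sn_eq Xn) => //; have XUW := linB XL XU XW.
by apply/eqP; rewrite eq_le (sn_ge0 Xn)// (le_trans (nN _))// UW mulr0.
Qed.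

(** T_t commutes with the difference quotients that define A. *)
Lemma generator_invariant t U : 0 <= t -> D U ->
  D (T t U) /\ N (A (T t U) - T t (A U)) = 0.
Proof.
move=> t0 DU; have [XU XAU] := DX DU.
have XT r W : 0 <= r -> X W -> X (T r W) by exact: (C0_X TC).
apply/(TG.2 (T t U) (T t (A U)) (XT _ _ t0 XU) (XT _ _ t0 XAU)).
have [M M0 MB] := C0_bounded XN XC TC t0.
apply: (@squeeze_cvgr _ _ _ _ (cst 0)
  (fun h => M * N ((h^-1)%:C *: (T h U - U) - A U))); last 2 first.
- exact: cvg_cst.
- rewrite -[X in _ --> X](mulr0 M); apply: cvgMr; exact: generator_cvg.
near=> h.
have h0 : 0 < h by near: h; exact: nbhs_right_gt.
have XTh := XT h U (ltW h0) XU; have XB := linB XL XTh XU.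
have XE := linB XL (linZ XL (h^-1)%:C XB) XAU.
have XTT := XT t _ t0 XTh.
have XhT := XT h _ (ltW h0) (XT t U t0 XU).
have XtA := XT t _ t0 XAU; have XtU := XT t U t0 XU.
have XF := linB XL (linZ XL (h^-1)%:C (linB XL XhT XtU)) XtA.
rewrite (sn_ge0 XN XF)/=.
apply: (le_trans _ (MB t _ _ XE)); last by rewrite t0 lexx.
rewrite (bl_B XN (TB t0))//; last exact: linZ.
have XtB := XT t _ t0 XB; have XtZ := XT t _ t0 (linZ XL (h^-1)%:C XB).
have XG := linB XL XtZ XtA.
apply: (le_trans (sn_le_sub XN XF XG)); rewrite gerDl.
rewrite opprB addrA subrK.
have XH := linZ XL (h^-1)%:C XtB.
apply: (le_trans (sn_tri3 XN (linZ XL _ (linB XL XhT XtU)) XH XtZ)).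
have [_ tlin _] := TB t0.
have -> : N ((h^-1)%:C *: (T h (T t U) - T t U) - (h^-1)%:C *: T t (T h U - U)) = 0.
  rewrite -scalerBr (sn_hom XN); last by apply: (linB XL) => //; exact: linB.
  rewrite (_ : N _ = 0) ?mulr0//.
  have e1 : N (T (h + t) U - T h (T t U)) = 0.
    by case: TC => _ _ + _; apply=> //; exact: ltW.
  have e2 : N (T (t + h) U - T t (T h U)) = 0.
    by case: TC => _ _ + _; apply=> //; exact: ltW.
  rewrite [t + h]addrC in e2.
  have e3 : N (T t (T h U - U) - (T t (T h U) - T t U)) = 0.
    by have := tlin (-1) U (T h U) XU XTh; rewrite !scaleN1r ![- _ + _]addrC.
  have XS : X (T (h + t) U) by apply: XT => //; rewrite addr_ge0// ltW.
  have e4 : N (T h (T t U) - T t (T h U)) = 0.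
    apply/eqP; rewrite eq_le (sn_ge0 XN (linB XL XhT XTT)) andbT.
    apply: (le_trans (sn_tri3 XN XhT XS XTT)).
    by rewrite (sn_distC XN)// e1 e2 addr0.
  have XQ := linB XL XTT XtU; have XP := linB XL XhT XtU.
  apply/eqP; rewrite eq_le (sn_ge0 XN (linB XL XP XtB)) andbT.
  apply: (le_trans (sn_tri3 XN XP XQ XtB)).
  by rewrite opprB addrA subrK e4 (sn_distC XN)// e3 addr0.
rewrite add0r (sn_distC XN)//.
have := bl_lin XN (TB t0) (h^-1)%:C XB (lin0 XL).
have := tlin (h^-1)%:C _ _ XB (lin0 XL); rewrite addr0 => e1 _.
have X0 := XT t _ t0 (lin0 XL).
rewrite (sn_eq XN (linB XL XtZ XH) (linB XL XtZ (linD XL XH X0))) ?e1//.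
by rewrite opprB addrC addrA subrK addrAC subrr add0r (bl_0 XN (TB t0)).
Unshelve. all: by end_near. Qed.

(** Implicit Euler: T_{tau + h} U - h A T_{tau + h} U differs from T_tau U by
    T_tau of a remainder o(h) which does not depend on tau, so that the resolvent
    bound (1 + kap h)^-1 can be iterated t / h times. *)
Lemma dissipative_decay_domain t U : 0 <= t -> D U ->
  n (T t U) <= expR (- (kap / 2 * t)) * n U.
Proof.
rewrite le_eqVlt => /orP[/eqP <-|t0] DU; have [XU XAU] := DX DU.
  rewrite mulr0 oppr0 expR0 mul1r; rewrite (_ : n (T 0 U) = n U)//; apply: n_eq => //.
    exact: (C0_X TC).
  by case: TC => _ + _ _; exact.
have XT r W : 0 <= r -> X W -> X (T r W) by exact: (C0_X TC).
have [M M0 MB] := C0_bounded XN XC TC (ltW t0).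
pose eta h := N ((h^-1)%:C *: (T h U - U) - A U) + N (T h (A U) - A U).
have eta0 : eta h @[h --> 0^'+] --> 0.
  rewrite -[X in _ --> X]addr0; apply: cvgD; first exact: generator_cvg.
  by case: TC => _ _ _; exact.
(* The remainder of one implicit Euler step started at U. *)
have rho_le h : 0 < h -> N (T h U - h%:C *: T h (A U) - U) <= h * eta h.
  move=> h0; have XTh := XT h U (ltW h0) XU; have XTA := XT h _ (ltW h0) XAU.
  have XB := linB XL XTh XU; have XE := linB XL (linZ XL (h^-1)%:C XB) XAU.
  have XF := linB XL XTA XAU.
  have -> : T h U - h%:C *: T h (A U) - U =
     h%:C *: (((h^-1)%:C *: (T h U - U) - A U) - (T h (A U) - A U)).
    rewrite opprB addrA subrK scalerBr scalerA -rmorphM/= divff ?gt_eqF//.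
    by rewrite rmorph1 scale1r addrAC.
  rewrite (sn_homR XN); last exact: linB.
  by rewrite gtr0_norm// ler_pM2l//; exact: (sn_triB XN).
have one tau h : 0 <= tau <= t -> 0 < h ->
    (1 + kap * h) * n (T (tau + h) U) <= n (T tau U) + c1 * (M * (h * eta h)).
  move=> /andP[tau0 taut] h0.
  have th0 : 0 <= tau + h by rewrite addr_ge0// ltW.
  have [DT AT] := generator_invariant th0 DU.
  apply: (le_trans (dissip DT h0)).
  have XTh := XT h U (ltW h0) XU; have XTA := XT h _ (ltW h0) XAU.
  pose rho := T h U - h%:C *: T h (A U) - U.
  have Xr : X rho by apply: (linB XL) => //; apply: (linB XL) => //; exact: linZ.
  have XATt := (DX DT).2.
  have X1 := XT _ _ th0 XU; have X2 := XT _ _ th0 XAU.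
  have X3 := XT _ _ tau0 XTh; have X4 := XT _ _ tau0 XTA.
  have X5 := XT _ _ tau0 XU; have X6 := XT _ _ tau0 Xr.
  have XZ := linZ XL h%:C XTA.
  have X7 := XT _ _ tau0 (linB XL XTh XZ).
  have [_ tlin _] := TB tau0.
  have -> : n (T (tau + h) U - h%:C *: A (T (tau + h) U)) = n (T tau (T h U - h%:C *: T h (A U))).
    apply: n_eq => //; first by apply: (linB XL) => //; exact: linZ.
    have XW := linB XL X3 (linZ XL h%:C X4).
    have XQ := linB XL X1 (linZ XL h%:C XATt).
    apply/eqP; rewrite eq_le (sn_ge0 XN (linB XL XQ X7)) andbT.
    apply: (le_trans (sn_tri3 XN XQ XW X7)).
    have -> : N (T tau (T h U) - h%:C *: T tau (T h (A U)) - T tau (T h U - h%:C *: T h (A U))) = 0.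
      rewrite (sn_distC XN)//.
      by have := tlin (- h%:C) _ _ XTA XTh; rewrite !scaleNr ![- _ + T _ _]addrC.
    rewrite addr0 opprB.
    have XR := linB XL (linZ XL h%:C X4) (linZ XL h%:C XATt).
    rewrite [X in N X](_ : _ = (T (tau + h) U - T tau (T h U)) +
      (h%:C *: T tau (T h (A U)) - h%:C *: A (T (tau + h) U))); last first.
      by rewrite addrACA [RHS]addrACA; congr (_ + _); rewrite addrC.
    apply: (le_trans (sn_tri XN (linB XL X1 X3) XR)).
    case: TC => _ _ + _ => /[dup] /(_ tau h U tau0 (ltW h0) XU) ->.
    move=> /(_ tau h (A U) tau0 (ltW h0) XAU) e1.
    rewrite add0r -scalerBr (sn_hom XN); last exact: linB.
    rewrite pmulr_rle0; last by rewrite normc_real normr_gt0 gt_eqF.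
    apply: (le_trans (sn_tri3 XN X4 X2 XATt)).
    by rewrite (sn_distC XN)// e1 (sn_distC XN)// AT addr0.
  have -> : T h U - h%:C *: T h (A U) = U + rho by rewrite /rho [RHS]addrC subrK.
  have -> : n (T tau (U + rho)) = n (T tau U + T tau rho).
    apply: n_eq; [by apply: XT => //; exact: linD|exact: linD|].
    by have := tlin 1 U rho XU Xr; rewrite !scale1r.
  apply: (le_trans (sn_tri Xn X5 X6)); rewrite lerD2l.
  apply: (le_trans (nN X6)); rewrite ler_wpM2l//.
  apply: (le_trans (MB tau rho _ Xr)); first by rewrite tau0.
  by rewrite ler_wpM2l// rho_le.
have eta_ge0 h : 0 < h -> 0 <= eta h.
  move=> h0; rewrite addr_ge0// (sn_ge0 XN)//; apply: (linB XL) => //.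
    by apply: (linZ XL); apply: (linB XL) => //; apply: XT => //; exact: ltW.
  by apply: XT => //; exact: ltW.
have it m h : 0 < h -> m%:R * h <= t ->
    n (T (m%:R * h) U) <= (1 + kap * h) ^- m * n U + m%:R * (c1 * (M * (h * eta h))).
  move=> h0; have r0 : 0 <= c1 * (M * (h * eta h)).
    by have h0' := ltW h0; have eh := eta_ge0 _ h0; rewrite !mulr_ge0.
  have q0 : 1 <= 1 + kap * h by rewrite lerDl mulr_ge0// ltW.
  have q0' : 0 < 1 + kap * h by rewrite (lt_le_trans ltr01).
  elim: m => [_|m IH mt].
    rewrite mul0r mul0r expr0 invr1 mul1r addr0; rewrite (_ : n (T 0 U) = n U)//; apply: n_eq => //.
      exact: XT.
    by case: TC => _ + _ _; exact.
  have mt' : m%:R * h <= t by apply: le_trans mt; rewrite ler_wpM2r ?ler_nat// ltW.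
  have mh0 : 0 <= m%:R * h by rewrite mulr_ge0// ltW.
  have := one (m%:R * h) h; rewrite mh0 mt' => /(_ isT h0).
  rewrite (_ : m%:R * h + h = m.+1%:R * h); last by rewrite -natr1 mulrDl mul1r.
  rewrite mulrC -ler_pdivlMr//.
  move=> /le_trans; apply.
  rewrite ler_pdivrMr// exprSr invfM.
  apply: (le_trans (lerD (IH mt') (lexx _))).
  rewrite mulrDl [_ * n U * _]mulrAC divfK ?gt_eqF// -addrA lerD2l.
  rewrite -{2}[c1 * _]mul1r -mulrDl natr1.
  by rewrite ler_peMr// mulr_ge0.
apply/ler_addgt0Pr => e e0.
have K0 : 0 < t * (c1 * M) + 1 by rewrite ltr_wpDl// mulr_ge0 ?mulr_ge0// ltW.
have d0 : 0 < e / (t * (c1 * M) + 1) by rewrite divr_gt0.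
have [r /= r0 rP] := cvgr_lt 0 eta0 _ d0.
near \oo => m.
have m0 : (0 < m)%N by near: m; exact: nbhs_infty_gt.
pose h := t / m%:R.
have h0 : 0 < h by rewrite divr_gt0// ltr0n.
have hr : h < r.
  rewrite ltr_pdivrMr ?ltr0n// mulrC -ltr_pdivrMr//.
  by near: m; exact: nbhs_infty_gtr.
have hk : kap * h <= 1.
  rewrite mulrA ler_pdivrMr ?ltr0n// mul1r.
  by near: m; exact: nbhs_infty_ger.
have small := rP h.
rewrite /= sub0r normrN gtr0_norm// in small; have {}small := small hr h0.
have mh : m%:R * h = t by rewrite /h mulrC divfK// pnatr_eq0 -lt0n.
have := it m h h0; rewrite mh lexx => /(_ isT) /le_trans; apply.
apply: lerD.
  rewrite ler_wpM2r ?(sn_ge0 Xn)// -exprVn.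
  have -> : - (kap / 2 * t) = - (kap * h / 2) * m%:R by rewrite -mh; ring.
  rewrite [_ * m%:R]mulrC expRM_natl; apply: lerXn2r; rewrite ?nnegrE ?expR_ge0//.
    by rewrite invr_ge0 addr_ge0// mulr_ge0// ltW.
  apply: le_trans (expR_ge1Dx _).
  have kh0 : 0 <= kap * h by rewrite mulr_ge0// ltW.
  (* (1 + x)^-1 <= 1 - x / 2 for 0 <= x <= 1, at the price of half the rate. *)
  rewrite -div1r ler_pdivrMr; first nra.
  by rewrite ltr_wpDr.
have -> : m%:R * (c1 * (M * (h * eta h))) = t * (c1 * M) * eta h by rewrite -mh; ring.
apply: (le_trans (ler_wpM2l _ (ltW small))).
  by rewrite mulr_ge0 ?mulr_ge0// ltW.
rewrite mulrA ler_pdivrMr// mulrC ler_pM2l// lerDl//.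
Unshelve. all: by end_near. Qed.

(** By density of the domain, both sides being continuous in U. *)
Lemma dissipative_decay t U : 0 <= t -> X U ->
  n (T t U) <= expR (- (kap / 2 * t)) * n U.
Proof.
move=> t0 XU; have [M M0 MB] := C0_bounded XN XC TC t0.
apply/ler_addgt0Pr => e e0.
pose K := c1 * M + c1.
have K0 : 0 < K + 1 by rewrite ltr_wpDl// addr_ge0// mulr_ge0.
have [W DW UW] := dense XU (divr_gt0 e0 K0).
have [XW _] := DX DW; have XB := linB XL XU XW.
have XT Z : X Z -> X (T t Z) by exact: (C0_X TC).
have q1 : expR (- (kap / 2 * t)) <= 1.
  by rewrite -expR0 ler_expR oppr_le0 mulr_ge0// divr_ge0// ltW.
have h1 : n (T t U) <= n (T t W) + c1 * M * N (U - W).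
  apply: (le_trans (sn_le_sub Xn (XT _ XU) (XT _ XW))); rewrite lerD2l.
  apply: (le_trans (nN (linB XL (XT _ XU) (XT _ XW)))).
  rewrite -mulrA ler_wpM2l// -(bl_B XN (TB t0))//.
  by apply: MB => //; rewrite t0 lexx.
have h2 := dissipative_decay_domain t0 DW.
have h3 : n W <= n U + c1 * N (U - W).
  apply: (le_trans (sn_le_sub Xn XW XU)); rewrite lerD2l.
  by rewrite (sn_distC XN)//; apply: nN; exact: linB.
have N0 := sn_ge0 XN XB.
have e1 : K * N (U - W) <= e.
  have : (K + 1) * N (U - W) <= e by rewrite mulrC -ler_pdivlMr// ltW.
  rewrite mulrDl; lra.
have : expR (- (kap / 2 * t)) * n W <= expR (- (kap / 2 * t)) * n U + c1 * N (U - W).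
  apply: (le_trans (ler_wpM2l (expR_ge0 _) h3)); rewrite mulrDr lerD2l.
  by rewrite ler_piMl// mulr_ge0.
move: e1; rewrite /K mulrDl; lra.
Qed.

End decay.
End generator.

(** * Positive forms *)

Section positive_form.
Local Open Scope complex_scope.
Variables (R : realType) (V : lmodType R[i]).
Local Notation normc := (@Normc.normc R).

(** Complex functions are handled through the real part of their inner product:
    every argument below is about quadratic forms over the reals. *)
Record pos_form (X : set V) (b : V -> V -> R) : Prop := PosForm {
  pf_lin : lin_closed X;
  pf_sym : forall u v, X u -> X v -> b u v = b v u;
  pf_linl : forall (a : R) u v w, X u -> X v -> X w ->
    b (a%:C *: u + v) w = a * b u w + b v w;
  pf_ge0 : forall u, X u -> 0 <= b u u;
  pf_hom : forall (c : R[i]) u, X u -> b (c *: u) (c *: u) = normc c ^+ 2 * b u u }.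

Definition fnorm (b : V -> V -> R) (u : V) : R := Num.sqrt (b u u).

Section theory.
Variables (X : set V) (b : V -> V -> R).
Hypothesis bX : pos_form X b.
Let XL := pf_lin bX.

Lemma pf_D u v w : X u -> X v -> X w -> b (u + v) w = b u w + b v w.
Proof. by move=> *; rewrite -[u]scale1r -(rmorph1 (real_complex R)) (pf_linl bX)// mul1r rmorph1 scale1r. Qed.

Lemma pf_0 w : X w -> b 0 w = 0.
Proof.
by move=> Xw; have X0 := lin0 XL; have := pf_D X0 X0 Xw; rewrite addr0; lra.
Qed.

Lemma pf_Z (a : R) u w : X u -> X w -> b (a%:C *: u) w = a * b u w.
Proof.
by move=> Xu Xw; rewrite -[_ *: _]addr0 (pf_linl bX) ?pf_0 ?addr0//; exact: lin0.
Qed.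

Lemma pf_N u w : X u -> X w -> b (- u) w = - b u w.
Proof.
move=> Xu Xw; rewrite -scaleN1r -(rmorph1 (real_complex R)) -rmorphN pf_Z//.
by rewrite mulN1r.
Qed.

Lemma pf_B u v w : X u -> X v -> X w -> b (u - v) w = b u w - b v w.
Proof. by move=> *; rewrite pf_D ?pf_N//; exact: linN. Qed.

Lemma pf_Dr u v w : X u -> X v -> X w -> b u (v + w) = b u v + b u w.
Proof.
move=> *; rewrite (pf_sym bX)//; last exact: linD.
by rewrite pf_D// [b v _](pf_sym bX)// [b w _](pf_sym bX).
Qed.

Lemma pf_Zr (a : R) u v : X u -> X v -> b u (a%:C *: v) = a * b u v.
Proof.
move=> *; rewrite (pf_sym bX)//; last exact: linZ.
by rewrite pf_Z// [b v _](pf_sym bX).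
Qed.

Lemma pf_Br u v w : X u -> X v -> X w -> b u (v - w) = b u v - b u w.
Proof.
move=> *; rewrite (pf_sym bX)//; last exact: linB.
by rewrite pf_B// [b v _](pf_sym bX)// [b w _](pf_sym bX).
Qed.

Lemma pf_sqD u v : X u -> X v -> b (u + v) (u + v) = b u u + 2 * b u v + b v v.
Proof.
move=> Xu Xv; have Xuv := linD XL Xu Xv.
by rewrite pf_D// !pf_Dr// [b v u](pf_sym bX)//; ring.
Qed.

Lemma pf_sqB u v : X u -> X v -> b (u - v) (u - v) = b u u - 2 * b u v + b v v.
Proof.
move=> Xu Xv; have Xuv := linB XL Xu Xv.
by rewrite pf_B// !pf_Br// [b v u](pf_sym bX)//; ring.
Qed.

Lemma pf_CS_sq u v : X u -> X v -> b u v ^+ 2 <= b u u * b v v.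
Proof.
move=> Xu Xv.
have pos t : 0 <= t ^+ 2 * b u u + 2 * t * b u v + b v v.
  have XZ := linZ XL t%:C Xu.
  have := pf_ge0 bX (linD XL XZ Xv); rewrite pf_sqD//.
  by rewrite !pf_Z// pf_Zr// => h; apply: le_trans h _; rewrite le_eqVlt; apply/orP; left; apply/eqP; ring.
have := pf_ge0 bX Xu; rewrite le_eqVlt => /orP[/eqP u0|u0].
  have [->|b0] := eqVneq (b u v) 0; first by rewrite expr0n/= -u0 mul0r.
  have := pos (- (b v v + 1) / (2 * b u v)).
  rewrite -u0 mulr0 add0r.
  have -> : 2 * (- (b v v + 1) / (2 * b u v)) * b u v = - (b v v + 1) by field.
  lra.
have := pos (- (b u v) / b u u).
have -> : (- b u v / b u u) ^+ 2 * b u u + 2 * (- b u v / b u u) * b u v + b v v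
   = b v v - b u v ^+ 2 / b u u by field; rewrite gt_eqF.
by rewrite subr_ge0 ler_pdivrMr// mulrC.
Qed.

Lemma fnorm_sq u : X u -> fnorm b u ^+ 2 = b u u.
Proof. by move=> Xu; rewrite sqr_sqrtr// (pf_ge0 bX). Qed.

Lemma fnorm_ge0 u : 0 <= fnorm b u.
Proof. exact: sqrtr_ge0. Qed.

Lemma pf_CS u v : X u -> X v -> `|b u v| <= fnorm b u * fnorm b v.
Proof.
move=> Xu Xv; rewrite -(@ler_pXn2r _ 2%N)// ?nnegrE ?mulr_ge0 ?fnorm_ge0//.
by rewrite real_normK ?num_real// exprMn !fnorm_sq// pf_CS_sq.
Qed.

Lemma pf_seminorm : seminorm_on X (fnorm b).
Proof.
split => // [u v Xu Xv|c u Xu].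
  rewrite -(@ler_pXn2r _ 2%N)// ?nnegrE ?addr_ge0 ?fnorm_ge0//.
  rewrite fnorm_sq; last exact: linD.
  rewrite pf_sqD// sqrrD !fnorm_sq//.
  by have := le_trans (ler_norm _) (pf_CS Xu Xv); lra.
rewrite /fnorm (pf_hom bX)// sqrtrM ?sqr_ge0// sqrtr_sqr ger0_norm//.
exact: normc_ge0.
Qed.

(** Projection theorem: a minimising sequence of M for the distance to f is Cauchy
    by the parallelogram identity, and f minus its limit is orthogonal to M. *)
Lemma total_dense (M : set V) : complete_on X (fnorm b) ->
  M `<=` X -> M 0 -> (forall (a : R) u v, M u -> M v -> M (a%:C *: u + v)) ->
  (forall f, X f -> (forall m, M m -> b f m = 0) -> fnorm b f = 0) ->
  forall f e, X f -> 0 < e -> exists2 m, M m & fnorm b (f - m) < e.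
Proof.
move=> XC MX M0 ML tot f e Xf e0.
have nX := pf_seminorm.
pose S := [set b (f - m) (f - m) | m in M].
have S0 : S !=set0 by exists (b (f - 0) (f - 0)); exists 0.
have lbS : lbound S 0 by move=> _ [m Mm <-]; apply: (pf_ge0 bX); apply: linB => //; exact: MX.
have hS : has_inf S by split => //; exists 0.
pose s := inf S.
have sle m : M m -> s <= b (f - m) (f - m) by move=> Mm; apply: ge_inf; [exact: hS.2|exists m].
(* Chosen so that consecutive minimisers are 4^-n apart. *)
pose ep n : R := 16^-1 ^+ n / 4.
have ep0 n : 0 < ep n by rewrite divr_gt0// exprn_gt0// invr_gt0.
have ex n : exists m, M m /\ b (f - m) (f - m) < s + ep n.
  by have [_ [m Mm <-] h] := inf_adherent (ep0 n) hS; exists m.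
pose m n := sval (cid (ex n)).
have mM n : M (m n) by case: (svalP (cid (ex n))).
have mlt n : b (f - m n) (f - m n) < s + ep n by case: (svalP (cid (ex n))).
have Xm n : X (m n) by exact: MX.
have Xfm n : X (f - m n) by exact: linB.
have cau n : fnorm b (m n.+1 - m n) <= 4^-1 ^+ n.
  rewrite -(@ler_pXn2r _ 2%N)// ?nnegrE ?fnorm_ge0 ?exprn_ge0 ?invr_ge0//.
  rewrite fnorm_sq; last exact: linB.
  pose h := (2^-1 : R)%:C *: m n + (2^-1 : R)%:C *: m n.+1.
  have Mh : M h.
    by apply: (ML) => //; rewrite -[_ *: _]addr0; exact: ML.
  have hle := sle _ Mh.
  have e1 : b (f - h) (f - h) =
     2^-1 * b (f - m n) (f - m n) + 2^-1 * b (f - m n.+1) (f - m n.+1)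
     - 4^-1 * b (m n.+1 - m n) (m n.+1 - m n).
    have Xh : X h by exact: MX.
    have X1 := linZ XL (2^-1 : R)%:C (Xm n).
    have X2 := linZ XL (2^-1 : R)%:C (Xm n.+1).
    rewrite !pf_sqB// /h pf_Dr// pf_sqD// !pf_Zr// !pf_Z//.
    rewrite [b (m n.+1) (m n)](pf_sym bX)//.
    by field.
  have := mlt n; have := mlt n.+1.
  rewrite /ep exprS -exprM mulnC exprM (_ : (4^-1 ^+ 2) = 16^-1 :> R); last by field.
  have : 0 <= 16^-1 ^+ n :> R by rewrite exprn_ge0// invr_ge0.
  move: hle; rewrite e1; lra.
have [p Xp mp] := complete_rate nX XC Xm cau.
have fp0 : fnorm b (f - p) = 0.
  apply: tot => [|w Mw]; first exact: linB.
  have Xw := MX _ Mw.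
  have Bn n : b (f - m n) w ^+ 2 <= ep n * (b w w + 1).
    set B := b (f - m n) w; set Q := b w w + 1.
    have ww := pf_ge0 bX Xw.
    have Q0 : 0 < Q by rewrite ltr_wpDl.
    (* B / Q is nearly the optimal step from m n in the direction w; the 1 in Q
       avoids dividing by zero. *)
    have Mt : M ((B / Q)%:C *: w + m n) by exact: ML.
    have := sle _ Mt; rewrite opprD [- _ - _]addrC addrA pf_sqB//; last exact: linZ.
    rewrite pf_Zr// pf_Z//; last exact: linZ.
    rewrite pf_Zr// -/B.
    have := mlt n => h1 h2.
    have h3 : 2 * (B / Q * B) - B / Q * (B / Q * b w w) <= ep n by lra.
    have h4 : B / Q * (B / Q * b w w) <= B ^+ 2 / Q.
      rewrite [leLHS](_ : _ = B ^+ 2 / Q * (b w w / Q)); last by ring.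
      rewrite ler_piMr//; first by rewrite divr_ge0 ?sqr_ge0// ltW.
      by rewrite ler_pdivrMr// mul1r lerDl.
    rewrite -ler_pdivrMr//; move: h3 h4.
    have -> : B / Q * B = B ^+ 2 / Q by ring.
    lra.
  apply/eqP; rewrite -normr_le0; apply/ler_addgt0Pr => eta eta0; rewrite add0r.
  have small n : `|b (f - p) w| <= (b w w + 1) * ep n / (eta / 2) + eta / 4 + 4 / 3 * 4^-1 ^+ n * fnorm b w.
    have -> : f - p = (f - m n) + (m n - p) by rewrite addrA subrK.
    have Xmp : X (m n - p) by exact: linB.
    rewrite pf_D//; apply: (le_trans (ler_normD _ _)); apply: lerD.
      have := Bn n; set B := b _ _ => hB.
      have h : 0 <= (`|B| - eta / 2) ^+ 2 by exact: sqr_ge0.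
      rewrite -(ler_pM2r (divr_gt0 eta0 (ltr0Sn R 1))) mulrDl divfK; last by rewrite gt_eqF// divr_gt0.
      move: h; rewrite sqrrB real_normK ?num_real//.
      rewrite [(_ + 1) * _]mulrC; nra.
    by apply: (le_trans (pf_CS Xmp Xw)); rewrite ler_wpM2r ?fnorm_ge0.
  pose K := (b w w + 1) / (eta / 2) + 4 / 3 * fnorm b w.
  have K0 : 0 <= K.
    rewrite addr_ge0// ?mulr_ge0 ?fnorm_ge0//; last by rewrite invr_ge0 divr_ge0// ltW.
    by rewrite addr_ge0// (pf_ge0 bX).
  have q_small : \forall n \near \oo, (4^-1 : R) ^+ n < eta / 4 / (K + 1).
    apply: (cvgr_lt 0); last by rewrite divr_gt0 ?divr_gt0// ltr_wpDl.
    by apply: cvg_expr; rewrite ger0_norm ?invr_ge0// invf_lt1// ltr1n.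
  near \oo => n.
  apply: (le_trans (small n)).
  have q1 : (4^-1 : R) ^+ n < eta / 4 / (K + 1) by near: n.
  have epq : ep n <= 4^-1 ^+ n.
    rewrite /ep; have : (16^-1 : R) ^+ n <= 4^-1 ^+ n.
      by apply: lerXn2r; rewrite ?nnegrE ?invr_ge0// lef_pV2 ?posrE// ler_nat.
    have : 0 <= (16^-1 : R) ^+ n by rewrite exprn_ge0// invr_ge0.
    lra.
  have h1 : (b w w + 1) * ep n / (eta / 2) <= (b w w + 1) / (eta / 2) * 4^-1 ^+ n.
    rewrite mulrAC ler_wpM2l// mulr_ge0//; first by rewrite addr_ge0// (pf_ge0 bX).
    by rewrite invr_ge0 divr_ge0// ltW.
  have h2 : K * 4^-1 ^+ n <= eta / 4.
    have : (K + 1) * 4^-1 ^+ n <= eta / 4 by rewrite mulrC -ler_pdivlMr ?ltW// ltr_wpDl.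
    have : 0 <= (4^-1 : R) ^+ n by rewrite exprn_ge0// invr_ge0.
    lra.
  move: h2; rewrite {1}/K; nra.
have q_small : \forall n \near \oo, (4^-1 : R) ^+ n < e / 2.
  apply: (cvgr_lt 0); last by rewrite divr_gt0.
  by apply: cvg_expr; rewrite ger0_norm ?invr_ge0// invf_lt1// ltr1n.
near \oo => n.
exists (m n) => //.
apply: (le_lt_trans (sn_tri3 nX Xf Xp (Xm n))); rewrite fp0 add0r.
rewrite (sn_distC nX)//; apply: (le_lt_trans (mp n)).
have : (4^-1 : R) ^+ n < e / 2 by near: n.
lra.
Unshelve. all: by end_near. Qed.

End theory.
End positive_form.

(** * Square integrable complex functions *)

Section sequences.
Variable R : realType.

Lemma geometric_cauchy (a : nat -> R) (C : R) :
  (forall n, `|a n.+1 - a n| <= C * 2^-1 ^+ n) ->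
  exists l, forall n, `|a n - l| <= 2 * C * 2^-1 ^+ n.
Proof.
move=> aC.
have q0 n : 0 <= (2^-1 : R) ^+ n by rewrite exprn_ge0// invr_ge0.
have C0 : 0 <= C by have := le_trans (normr_ge0 _) (aC 0%N); rewrite expr0 mulr1.
pose b n := a n - 2 * C * 2^-1 ^+ n.
pose c n := a n + 2 * C * 2^-1 ^+ n.
have bnd : nondecreasing_seq b.
  apply/nondecreasing_seqP => n; have := aC n; rewrite ler_norml /b exprS.
  by have := q0 n; nra.
have cni : nonincreasing_seq c.
  apply/nonincreasing_seqP => n; have := aC n; rewrite ler_norml /c exprS.
  by have := q0 n; nra.
have bc n m : b n <= c m.
  apply: le_trans (bnd _ _ (leq_maxl n m)) _.
  apply: le_trans _ (cni _ _ (leq_maxr n m)).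
  by rewrite /b /c; have := q0 (maxn n m); nra.
have bub m : ubound (range b) (c m) by move=> _ [n _ <-].
have hs : has_sup (range b) by split; [exists (b 0%N), 0%N|exists (c 0%N)].
exists (sup (range b)) => n.
have h1 : b n <= sup (range b) by apply: ub_le_sup; [exact: hs.2|exists n].
have h2 : sup (range b) <= c n by apply: ge_sup; [exact: hs.1|exact: bub].
by rewrite ler_norml; move: h1 h2; rewrite /b /c; lra.
Qed.

End sequences.

Section complex_functions.
Local Open Scope complex_scope.
Context d (T : measurableType d) (R : realType).
Variable mu : {measure set T -> \bar R}.
Local Notation normc := (@Normc.normc R).
Implicit Types u v : T -> R[i].

Definition cmeas u : Prop :=
  measurable_fun setT (fun x => re (u x)) /\ measurable_fun setT (fun x => im (u x)).

Definition sqn (z : R[i]) : R := re z ^+ 2 + im z ^+ 2.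

Lemma sqn_ge0 z : 0 <= sqn z.
Proof. by rewrite addr_ge0// sqr_ge0. Qed.

Lemma sqn_normc z : normc z ^+ 2 = sqn z.
Proof. by case: z => a b; rewrite /sqn sqr_sqrtr// addr_ge0// sqr_ge0. Qed.

Lemma normc_sqn z : normc z = Num.sqrt (sqn z).
Proof. by case: z. Qed.

Lemma sqnM z w : sqn (z * w) = sqn z * sqn w.
Proof. by rewrite -!sqn_normc Normc.normcM exprMn. Qed.

Lemma sqnD_le z w : sqn (z + w) <= 2 * (sqn z + sqn w).
Proof.
case: z w => a b [a' b']; rewrite /sqn /=.
have := sqr_ge0 (a - a'); have := sqr_ge0 (b - b'); nra.
Qed.

Lemma cmeasD u v : cmeas u -> cmeas v -> cmeas (fun x => u x + v x).
Proof.
move=> [ru iu] [rv iv]; split.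
  rewrite (_ : (fun _ => _) = (fun x => re (u x) + re (v x))); first exact: measurable_funD.
  by apply/funext => x; case: (u x) (v x) => ? ? [].
rewrite (_ : (fun _ => _) = (fun x => im (u x) + im (v x))); first exact: measurable_funD.
by apply/funext => x; case: (u x) (v x) => ? ? [].
Qed.

Lemma cmeasM u v : cmeas u -> cmeas v -> cmeas (fun x => u x * v x).
Proof.
move=> [ru iu] [rv iv]; split.
  rewrite (_ : (fun _ => _) = (fun x => re (u x) * re (v x) - im (u x) * im (v x))).
    by apply: measurable_funB; exact: measurable_funM.
  by apply/funext => x; case: (u x) (v x) => ? ? [].
rewrite (_ : (fun _ => _) = (fun x => re (u x) * im (v x) + im (u x) * re (v x))).
  by apply: measurable_funD; exact: measurable_funM.
by apply/funext => x; case: (u x) (v x) => ? ? [].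
Qed.

Lemma cmeas_cst (c : R[i]) : cmeas (fun=> c).
Proof. by split. Qed.

Lemma cmeas_real (f : T -> R) : measurable_fun setT f -> cmeas (fun x => (f x)%:C).
Proof. by move=> mf; split. Qed.

Lemma cmeas_conj u : cmeas u -> cmeas (fun x => (u x)^*).
Proof.
move=> [ru iu]; split.
  by rewrite (_ : (fun _ => _) = fun x => re (u x))//; apply/funext => x; case: (u x).
rewrite (_ : (fun _ => _) = fun x => - im (u x)); first exact: measurableT_comp.
by apply/funext => x; case: (u x).
Qed.

Lemma measurable_sqn u : cmeas u -> measurable_fun setT (fun x => sqn (u x)).
Proof. by move=> [ru iu]; apply: measurable_funD; exact: measurable_funX. Qed.

Local Notation intble f := (mu.-integrable setT (EFin \o f)).

Lemma integrableR_le (f g : T -> R) : measurable_fun setT f ->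
  (forall x, `|f x| <= `|g x|) -> intble g -> intble f.
Proof.
move=> mf fg ig; apply: le_integrable ig => //=.
  exact/measurable_EFinP.
by move=> x _; rewrite lee_fin.
Qed.

Lemma integrableRD (f g : T -> R) : intble f -> intble g -> intble (fun x => f x + g x).
Proof. by move=> fi gi; exact: (integrableD measurableT fi gi). Qed.

Lemma integrableRB (f g : T -> R) : intble f -> intble g -> intble (fun x => f x - g x).
Proof. by move=> fi gi; exact: (integrableB measurableT fi gi). Qed.

Lemma integrableRZ (k : R) (f : T -> R) : intble f -> intble (fun x => k * f x).
Proof. by move=> fi; exact: (integrableZl measurableT k fi). Qed.

Lemma integrableR_meas (f : T -> R) : intble f -> measurable_fun setT f.
Proof. by move/measurable_int => /measurable_EFinP. Qed.

Definition L2 : set (T -> R[i]) := [set u | cmeas u /\ intble (fun x => sqn (u x))].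

Definition ip u v : R := Rintegral mu setT (fun x => re (u x) * re (v x) + im (u x) * im (v x)).

Lemma ip_sqn u : ip u u = Rintegral mu setT (fun x => sqn (u x)).
Proof. by []. Qed.

Lemma L2_lin : lin_closed L2.
Proof.
split=> [|c u v [mu_ iu] [mv iv]].
  split; first exact: (cmeas_cst 0).
  rewrite (_ : _ \o _ = cst 0%E); first exact: integrable0.
  by apply/funext => x /=; rewrite /sqn expr0n/= addr0.
have m : cmeas (c *: u + v).
  by apply: cmeasD => //; apply: cmeasM => //; exact: cmeas_cst.
split => //.
apply: (@integrableR_le _ (fun x => 2 * (sqn c * sqn (u x) + sqn (v x)))).
- exact: measurable_sqn.
- move=> x; rewrite !ger0_norm ?sqn_ge0//; last first.
    by rewrite mulr_ge0// addr_ge0 ?sqn_ge0// mulr_ge0// sqn_ge0.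
  by rewrite -sqnM; exact: sqnD_le.
- by apply: integrableRZ; apply: integrableRD => //; exact: integrableRZ.
Qed.

Lemma ip_integrable u v : L2 u -> L2 v ->
  intble (fun x => re (u x) * re (v x) + im (u x) * im (v x)).
Proof.
move=> [mu_ iu] [mv iv].
apply: (@integrableR_le _ (fun x => sqn (u x) + sqn (v x))).
- by case: mu_ mv => ? ? [? ?]; apply: measurable_funD; exact: measurable_funM.
- move=> x; rewrite [leRHS]ger0_norm; last by apply: addr_ge0; exact: sqn_ge0.
  case: (u x) (v x) => a b [a' b']; rewrite /sqn/= ler_norml.
  have := sqr_ge0 (a - a'); have := sqr_ge0 (b - b').
  have := sqr_ge0 (a + a'); have := sqr_ge0 (b + b').
  by nra.
- exact: integrableRD.
Qed.

Lemma ip_form : pos_form L2 ip.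
Proof.
split.
- exact: L2_lin.
- by move=> u v _ _; apply: eq_Rintegral => x _; rewrite ![re (u x) * _]mulrC ![im (u x) * _]mulrC.
- move=> a u v w Lu Lv Lw; rewrite /ip -RintegralZl//; last exact: ip_integrable.
  rewrite -RintegralD//; [|by apply: integrableRZ; exact: ip_integrable|exact: ip_integrable].
  apply: eq_Rintegral => x _.
  by rewrite -[(_ + _) x]/(a%:C * u x + v x); case: (u x) (v x) (w x) => ? ? [? ?] [? ?] /=; ring.
- by move=> u _; apply: Rintegral_ge0 => x _; exact: sqn_ge0.
- move=> c u [_ iu]; rewrite !ip_sqn -RintegralZl//.
  by apply: eq_Rintegral => x _; rewrite sqn_normc -sqnM.
Qed.

Lemma ipC u v : ip u v = ip v u.
Proof. by apply: eq_Rintegral => x _; rewrite ![re (u x) * _]mulrC ![im (u x) * _]mulrC. Qed.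

Definition nrm u : R := fnorm ip u.

Lemma nrm_seminorm : seminorm_on L2 nrm.
Proof. exact: pf_seminorm ip_form. Qed.

(** With G = sum_n 4^n |u_{n+1} - u_n|^2, which is integrable, one has
    |u_{n+1} - u_n| <= 2^-n sqrt G pointwise: this gives at once the almost
    everywhere limit l and the bound |u_n - l|^2 <= 8 G 4^-n, to be integrated. *)
Lemma L2_complete : complete_on L2 nrm.
Proof.
move=> u Lu ucau.
pose g n x := sqn (u n.+1 x - u n x).
have LB n : L2 (u n.+1 - u n) by exact: (linB L2_lin).
have mg n : measurable_fun setT (g n) by exact: measurable_sqn (LB n).1.
have ig n : (\int[mu]_x (g n x)%:E <= (16^-1 ^+ n)%:E)%E.
  have := ucau n; rewrite -(@ler_pXn2r _ 2%N)// ?nnegrE ?fnorm_ge0 ?exprn_ge0 ?invr_ge0//.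
  rewrite /nrm (fnorm_sq ip_form)// -exprM mulnC exprM (_ : 4^-1 ^+ 2 = 16^-1 :> R); last by field.
  rewrite ip_sqn /Rintegral -lee_fin fineK//.
  by apply: integrable_fin_num => //; exact: (LB n).2.
pose G x := (\sum_(n <oo) (4 ^+ n * g n x)%:E)%E.
have G0 x : (0 <= G x)%E.
  by apply: nneseries_ge0 => n _ _; rewrite lee_fin mulr_ge0 ?exprn_ge0 ?sqn_ge0.
have mt n : measurable_fun setT (fun x => (4 ^+ n * g n x)%:E).
  by apply/measurable_EFinP; apply: measurable_funM.
have mG : measurable_fun setT G.
  apply: ge0_emeasurable_sum => [n x _ _|n _]; last exact: mt.
  by rewrite lee_fin mulr_ge0 ?exprn_ge0 ?sqn_ge0.
have iG : (\int[mu]_x G x <= 2%:E)%E.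
  rewrite integral_nneseries//; last by move=> n x _; rewrite lee_fin mulr_ge0 ?exprn_ge0 ?sqn_ge0.
  apply: (@le_trans _ _ (\sum_(n <oo) (2 / (2 ^ (n + 1))%:R)%:E)%E); last first.
    have := @cvg_geometric_eseries_half R 2 0; rewrite expr0 divr1 => h.
    by have := cvg_lim _ h; rewrite /eseries/= => ->.
  apply: lee_nneseries => [n _ _|n _].
    by apply: integral_ge0 => x _; rewrite lee_fin mulr_ge0 ?exprn_ge0 ?sqn_ge0.
  under eq_integral do rewrite EFinM.
  rewrite ge0_integralZl//; last 2 first.
  - exact/measurable_EFinP.
  - by move=> x _; rewrite lee_fin sqn_ge0.
  apply: (@le_trans _ _ ((4 ^+ n)%:E * (16^-1 ^+ n)%:E)%E).
    by rewrite lee_pmul2l// ?lte_fin ?exprn_gt0.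
  rewrite -EFinM lee_fin -exprMn natrX addn1 exprS invfM mulrA divff// mul1r -exprVn.
  by apply: lerXn2r; rewrite ?nnegrE ?divr_ge0//; lra.
pose E := [set x | (G x < +oo)%E].
have mE : measurable E by rewrite /E -[X in measurable X]setTI; exact: emeasurable_fun_infty_o.
have bnd x n : E x -> normc (u n.+1 x - u n x) <= Num.sqrt (fine (G x)) * 2^-1 ^+ n.
  move=> Ex; have Gf : G x \is a fin_num by rewrite ge0_fin_numE.
  have h : 4 ^+ n * g n x <= fine (G x).
    rewrite -lee_fin fineK//.
    apply: le_trans _ (nneseries_lim_ge n.+1 _); last first.
      by move=> k _ _; rewrite lee_fin mulr_ge0 ?exprn_ge0 ?sqn_ge0.
    rewrite big_nat_recr//= leeDr// sume_ge0// => k _.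
    by rewrite lee_fin mulr_ge0 ?exprn_ge0 ?sqn_ge0.
  rewrite normc_sqn -[2^-1 ^+ n]ger0_norm ?exprn_ge0 ?invr_ge0// -sqrtr_sqr.
  rewrite -sqrtrM ?fine_ge0// ler_wsqrtr//.
  rewrite -exprM mulnC exprM (_ : 2^-1 ^+ 2 = 4^-1 :> R); last by field.
  by rewrite exprVn ler_pdivlMr ?exprn_gt0// mulrC.
have re_le (z : R[i]) : `|re z| <= normc z.
  by case: z => a b /=; rewrite -(@sqrtr_sqr _ a) ler_wsqrtr// lerDl sqr_ge0.
have im_le (z : R[i]) : `|im z| <= normc z.
  by case: z => a b /=; rewrite -(@sqrtr_sqr _ b) ler_wsqrtr// lerDr sqr_ge0.
have reB (z w : R[i]) : re (z - w) = re z - re w by case: z w => ? ? [].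
have imB (z w : R[i]) : im (z - w) = im z - im w by case: z w => ? ? [].
have exl x : exists l : R[i], (E x -> forall n,
    `|re (u n x) - re l| <= 2 * Num.sqrt (fine (G x)) * 2^-1 ^+ n /\
    `|im (u n x) - im l| <= 2 * Num.sqrt (fine (G x)) * 2^-1 ^+ n) /\ (~ E x -> l = 0).
  have [Ex|nEx] := pselect (E x); last by exists 0.
  have [a aP] := @geometric_cauchy R (fun n => re (u n x)) (Num.sqrt (fine (G x)))
    (fun n => le_trans (eq_ind _ (fun z => `|z| <= _) (re_le _) _ (reB _ _)) (bnd x n Ex)).
  have [b bP] := @geometric_cauchy R (fun n => im (u n x)) (Num.sqrt (fine (G x)))
    (fun n => le_trans (eq_ind _ (fun z => `|z| <= _) (im_le _) _ (imB _ _)) (bnd x n Ex)).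
  by exists (a +i* b); split.
pose l x := sval (cid (exl x)).
have lP x : E x -> forall n,
    `|re (u n x) - re (l x)| <= 2 * Num.sqrt (fine (G x)) * 2^-1 ^+ n /\
    `|im (u n x) - im (l x)| <= 2 * Num.sqrt (fine (G x)) * 2^-1 ^+ n.
  by case: (svalP (cid (exl x))).
have l0 x : ~ E x -> l x = 0 by case: (svalP (cid (exl x))).
have geo0 (C : R) : C * 2^-1 ^+ n @[n --> \oo] --> 0.
  rewrite -[X in _ --> X](mulr0 C); apply: cvgMr.
  by apply: cvg_expr; rewrite ger0_norm ?invr_ge0// invf_lt1// ltr1n.
have cv (p : R[i] -> R) : p 0 = 0 -> (forall x, E x -> forall n,
    `|p (u n x) - p (l x)| <= 2 * Num.sqrt (fine (G x)) * 2^-1 ^+ n) ->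
    (forall n, measurable_fun setT (fun x => p (u n x))) ->
    measurable_fun setT (fun x => p (l x)).
  move=> p0 pP mp.
  apply: (@measurable_fun_cvg _ _ _ _ (fun n x => \1_E x * p (u n x))) => [n|x _].
    by apply: measurable_funM => //; exact: measurable_indic.
  have [Ex|nEx] := pselect (E x); last first.
    rewrite l0// p0 indicE memNset//.
    by under eq_fun do rewrite mul0r; exact: cvg_cst.
  rewrite indicE mem_set//; under eq_fun do rewrite mul1r.
  apply/cvgrPdistC_lt => e e0.
  near=> n; apply: le_lt_trans (pP x Ex n) _.
  by near: n; apply: (cvgr_lt 0) => //; exact: geo0.
have ml : cmeas l.
  split; apply: cv => //.
  - by move=> x Ex n; case: (lP x Ex n).
  - by move=> n; case: (Lu n) => -[].
  - by move=> x Ex n; case: (lP x Ex n).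
  - by move=> n; case: (Lu n) => -[].
have Eae : {ae mu, forall x, E x}.
  have iGG : mu.-integrable setT G.
    apply/integrableP; split => //.
    under eq_integral do rewrite gee0_abs//.
    by apply: le_lt_trans iG _; rewrite ltry.
  have := integrable_ae measurableT iGG; apply: filterS => x /(_ I).
  by rewrite ge0_fin_numE.
have dist n x : E x -> ((sqn (u n x - l x))%:E <= (8 * 4^-1 ^+ n)%:E * G x)%E.
  move=> Ex; have Gf : G x \is a fin_num by rewrite ge0_fin_numE.
  have [h1 h2] := lP x Ex n.
  rewrite -(fineK Gf) -EFinM lee_fin /sqn reB imB.
  set a := re _ - _ in h1 *; set b := im _ - _ in h2 *.
  have fG0 : 0 <= fine (G x) by rewrite fine_ge0.
  pose K := 2 * Num.sqrt (fine (G x)) * 2^-1 ^+ n.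
  have sq (c : R) : `|c| <= K -> c ^+ 2 <= K ^+ 2.
    move=> h; rewrite -[c ^+ 2]real_normK ?num_real//.
    by apply: lerXn2r; rewrite ?nnegrE// (le_trans _ h).
  have K2 : K ^+ 2 = 4 * fine (G x) * 4^-1 ^+ n.
    rewrite /K !exprMn sqr_sqrtr// -exprM mulnC exprM.
    by rewrite (_ : 2^-1 ^+ 2 = 4^-1 :> R); [congr (_ * _ * _); rewrite expr2; ring|field].
  have := sq _ h1; have := sq _ h2; rewrite K2; nra.
have mul_n n : cmeas (u n - l).
  apply: cmeasD; first exact: (Lu n).1.
  rewrite (_ : (- l) = (fun x => (-1) * l x)); first by apply: cmeasM => //; exact: cmeas_cst.
  by apply/funext => x; rewrite mulN1r.
have int_dist n : (\int[mu]_x (sqn (u n x - l x))%:E <= (16 * 4^-1 ^+ n)%:E)%E.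
  apply: (@le_trans _ _ (\int[mu]_x ((8 * 4^-1 ^+ n)%:E * G x))%E).
    apply: ae_ge0_le_integral => //.
    - by move=> x _; rewrite lee_fin sqn_ge0.
    - by apply/measurable_EFinP; exact: measurable_sqn (mul_n n).
    - by move=> x _; rewrite mule_ge0// lee_fin mulr_ge0// exprn_ge0// invr_ge0.
    - by apply: emeasurable_funM => //; exact: measurable_cst.
    - by move: Eae; apply: filterS => x Ex _; exact: dist.
  rewrite ge0_integralZl//.
  apply: (@le_trans _ _ ((8 * 4^-1 ^+ n)%:E * 2%:E)%E).
    by rewrite lee_wpmul2l// lee_fin mulr_ge0// exprn_ge0// invr_ge0.
  by rewrite -EFinM lee_fin; lra.
have Ld n : L2 (u n - l).
  split => //; apply/integrableP; split.
    by apply/measurable_EFinP; exact: measurable_sqn (mul_n n).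
  under eq_integral do rewrite /= ger0_norm ?sqn_ge0//.
  by apply: le_lt_trans (int_dist n) _; rewrite ltry.
exists l.
  by rewrite -[l](subKr (u 0%N)); exact: (linB L2_lin).
apply/cvgr0Pnorm_lt => e e0.
have e2 : 0 < e ^+ 2 / 16 by rewrite divr_gt0// exprn_gt0.
near=> n.
have hn : 1 * 2^-1 ^+ n < e ^+ 2 / 16.
  by near: n; apply: (cvgr_lt 0) => //; exact: geo0.
rewrite mul1r in hn.
rewrite ger0_norm ?fnorm_ge0//.
rewrite -(@ltr_pXn2r _ 2%N)// ?nnegrE ?fnorm_ge0 ?(ltW e0)//.
rewrite /nrm (fnorm_sq ip_form)// ip_sqn.
have : Rintegral mu setT (fun x => sqn ((u n - l) x)) <= 16 * 4^-1 ^+ n.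
  by rewrite -lee_fin /Rintegral fineK ?int_dist//; apply: integrable_fin_num => //; exact: (Ld n).2.
move=> /le_lt_trans; apply.
have : (4^-1 : R) ^+ n <= 2^-1 ^+ n by apply: lerXn2r; rewrite ?nnegrE ?invr_ge0//; lra.
lra.
Unshelve. all: by end_near. Qed.

End complex_functions.

Section almost_everywhere.
Local Open Scope complex_scope.
Context d (T : measurableType d) (R : realType).
Variable mu : {measure set T -> \bar R}.
Local Notation normc := (@Normc.normc R).
Implicit Types u v : T -> R[i].
Local Notation intble f := (mu.-integrable setT (EFin \o f)).
Local Notation nrm := (nrm mu).
Local Notation ip := (ip mu).
Local Notation L2 := (@L2 _ T R mu).

Lemma sqn_eq0 (z : R[i]) : sqn z = 0 -> z = 0.
Proof.
case: z => a b; rewrite /sqn /= => /eqP; rewrite paddr_eq0 ?sqr_ge0//.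
by rewrite !sqrf_eq0 => /andP[/eqP -> /eqP ->].
Qed.

Lemma nrm_ge0 u : 0 <= nrm u.
Proof. exact: fnorm_ge0. Qed.

Lemma nrm_sq u : L2 u -> nrm u ^+ 2 = ip u u.
Proof. exact: (fnorm_sq (ip_form mu)). Qed.

Lemma nrm_sqE u : L2 u -> (nrm u ^+ 2)%:E = (\int[mu]_x (sqn (u x))%:E)%E.
Proof.
move=> Lu; rewrite nrm_sq// ip_sqn /Rintegral fineK//.
by apply: integrable_fin_num => //; exact: Lu.2.
Qed.

Lemma ip_CS u v : L2 u -> L2 v -> `|ip u v| <= nrm u * nrm v.
Proof. exact: (pf_CS (ip_form mu)). Qed.

Lemma L2B u v : L2 u -> L2 v -> L2 (u - v).
Proof. exact: (linB (L2_lin mu)). Qed.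

Lemma L2D u v : L2 u -> L2 v -> L2 (u + v).
Proof. exact: (linD (L2_lin mu)). Qed.

Lemma L2Z (c : R[i]) u : L2 u -> L2 (c *: u).
Proof. exact: (linZ (L2_lin mu)). Qed.

Lemma L2_dominated (B : R) u v : 0 <= B -> cmeas v -> L2 u ->
  {ae mu, forall x, sqn (v x) <= B * sqn (u x)} ->
  L2 v /\ nrm v ^+ 2 <= B * nrm u ^+ 2.
Proof.
move=> B0 mv Lu vu.
have h : (\int[mu]_x (sqn (v x))%:E <= (B * nrm u ^+ 2)%:E)%E.
  rewrite EFinM nrm_sqE// -ge0_integralZl//; last 2 first.
  - by apply/measurable_EFinP; exact: measurable_sqn Lu.1.
  - by move=> x _; rewrite lee_fin sqn_ge0.
  apply: ae_ge0_le_integral => //.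
  - by move=> x _; rewrite lee_fin sqn_ge0.
  - by apply/measurable_EFinP; exact: measurable_sqn mv.
  - by move=> x _; rewrite mule_ge0// lee_fin sqn_ge0.
  - apply: emeasurable_funM; first exact: measurable_cst.
    by apply/measurable_EFinP; exact: measurable_sqn Lu.1.
  - by apply: filterS vu => x vux _; rewrite -EFinM lee_fin.
have Lv : L2 v.
  split => //; apply/integrableP; split.
    by apply/measurable_EFinP; exact: measurable_sqn mv.
  under eq_integral do rewrite /= ger0_norm ?sqn_ge0//.
  by apply: le_lt_trans h _; rewrite ltry.
by split => //; rewrite -lee_fin nrm_sqE.
Qed.

Lemma nrm_eq0 u : L2 u -> nrm u = 0 -> {ae mu, forall x, u x = 0}.
Proof.
move=> Lu u0; have : (\int[mu]_x `|(sqn (u x))%:E|)%E = 0%E.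
  under eq_integral do rewrite /= ger0_norm ?sqn_ge0//.
  by rewrite -nrm_sqE// u0 expr0n.
move/(ae_eq_integral_abs mu measurableT); move=> /(_ _)/wrap[].
  by apply/measurable_EFinP; exact: measurable_sqn Lu.1.
by apply: filterS => x /(_ I)/=[] /sqn_eq0.
Qed.

Lemma ae_L2_nrm u v : L2 u -> cmeas v -> {ae mu, forall x, v x = u x} ->
  L2 v /\ nrm (v - u) = 0.
Proof.
move=> Lu mv vu.
have [Lv _] : L2 v /\ nrm v ^+ 2 <= 1 * nrm u ^+ 2.
  by apply: L2_dominated => //; apply: filterS vu => x ->; rewrite mul1r.
split => //.
have [_] : L2 (v - u) /\ nrm (v - u) ^+ 2 <= 0 * nrm u ^+ 2.
  apply: L2_dominated => //; first exact: (L2B Lv Lu).1.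
  apply: filterS vu => x E.
  by rewrite -[(v - u) x]/(v x - u x) E subrr mul0r /sqn expr0n/= addr0.
rewrite mul0r => h; apply/eqP; rewrite -sqrf_eq0 eq_le h sqr_ge0//.
Qed.

Definition cut (j : T -> R) (c : R) u : T -> R[i] := fun x => if j x <= c then u x else 0.

Lemma sqn0 : sqn (0 : R[i]) = 0.
Proof. by rewrite /sqn expr0n/= addr0. Qed.

Lemma cmeas_if (b : T -> bool) u v : measurable_fun setT b -> cmeas u -> cmeas v ->
  cmeas (fun x => if b x then u x else v x).
Proof.
move=> mb [ru iu] [rv iv]; split.
  by under eq_fun do rewrite (fun_if (@complex.Re R)); exact: measurable_fun_ifT.
by under eq_fun do rewrite (fun_if (@complex.Im R)); exact: measurable_fun_ifT.
Qed.

Lemma cmeas_cut (j : T -> R) c u : measurable_fun setT j -> cmeas u -> cmeas (cut j c u).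
Proof.
move=> mj mu_; apply: cmeas_if => //; exact: measurable_fun_ler.
Qed.

Lemma L2_cut (j : T -> R) c u : measurable_fun setT j -> L2 u -> L2 (cut j c u).
Proof.
move=> mj Lu; have [//] : L2 (cut j c u) /\ nrm (cut j c u) ^+ 2 <= 1 * nrm u ^+ 2.
apply: L2_dominated => //; first exact: cmeas_cut Lu.1.
apply: nearW => x; rewrite /cut mul1r; case: ifP => // _.
by rewrite sqn0 sqn_ge0.
Qed.

(** The sublevel sets of j exhaust the space, and dominated convergence applies. *)
Lemma L2_truncation (j : T -> R) u e : measurable_fun setT j -> L2 u -> 0 < e ->
  exists n : nat, nrm (u - cut j n%:R u) < e.
Proof.
move=> mj Lu e0.
have Lc n : L2 (u - cut j n%:R u) by apply: L2B => //; exact: L2_cut.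
pose f (n : nat) x := (sqn ((u - cut j n%:R u) x))%:E.
have fE n x : f n x = (if j x <= n%:R then 0 else sqn (u x))%:E.
  rewrite /f -[(_ - _) x]/(u x - cut j n%:R u x) /cut.
  by case: ifP => _; rewrite ?subrr ?sqn0// subr0.
have mf n : measurable_fun setT (f n).
  by apply/measurable_EFinP; exact: measurable_sqn (Lc n).1.
have f0 : {ae mu, forall x, setT x -> f ^~ x @ \oo --> (cst 0%E : T -> \bar R) x}.
  apply: nearW => x _; apply: cvg_near_cst; near=> n; rewrite fE ifT//.
  by near: n; exact: nbhs_infty_ger.
have fle : {ae mu, forall x n, setT x -> (`|f n x| <= (sqn (u x))%:E)%E}.
  apply: nearW => x n _; rewrite fE gee0_abs; case: ifP => _;
  by rewrite ?lee_fin ?sqn_ge0.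
have [_ _] := dominated_convergence measurableT mf (measurable_cst _) f0 Lu.2 fle.
rewrite integral0 => h.
have e2 : ((0 : R)%:E < (e ^+ 2)%:E)%E by rewrite lte_fin exprn_gt0.
have [n _ nP] : \forall n \near \oo, (\int[mu]_x f n x < (e ^+ 2)%:E)%E.
  apply: (h [set z | (z < (e ^+ 2)%:E)%E]).
  by apply: open_nbhs_nbhs; split => //; exact: open_ereal_lt_ereal.
exists n; have := nP n (leqnn n); rewrite /f -nrm_sqE// lte_fin.
by rewrite ltr_pXn2r// nnegrE ?nrm_ge0// ltW.
Unshelve. all: by end_near. Qed.

End almost_everywhere.

Lemma measurable_sqrt (R : realType) : measurable_fun [set: R] (@Num.sqrt R).
Proof. apply: continuous_measurable_fun; exact: sqrt_continuous. Qed.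

(** * Complex integrals *)

Section complex_integral.
Local Open Scope complex_scope.
Context d (T : measurableType d) (R : realType).
Variable mu : {measure set T -> \bar R}.
Implicit Types u v : T -> R[i].
Local Notation intble f := (mu.-integrable setT (EFin \o f)).

Definition L1 : set (T -> R[i]) :=
  [set u | intble (fun x => re (u x)) /\ intble (fun x => im (u x))].

Definition cint u : R[i] :=
  Rintegral mu setT (fun x => re (u x)) +i* Rintegral mu setT (fun x => im (u x)).

Lemma L1_meas u : L1 u -> cmeas u.
Proof. by move=> [ru iu]; split; apply: (integrableR_meas (mu := mu)). Qed.

Lemma eq_cint u v : u =1 v -> cint u = cint v.
Proof. by move=> uv; congr cint; apply/funext. Qed.

Lemma L1_dominated u (f : T -> R) : cmeas u -> intble f ->
  (forall x, sqn (u x) <= f x ^+ 2) -> L1 u.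
Proof.
move=> [ru iu] fi uf.
have h (c : R) x : c ^+ 2 <= f x ^+ 2 -> `|c| <= `|f x|.
  rewrite -[c ^+ 2]real_normK ?num_real// -[f x ^+ 2]real_normK ?num_real//.
  by rewrite ler_pXn2r// nnegrE.
split; (apply: integrableR_le; [by []| |exact: fi]) => x; apply: h;
  apply: le_trans (uf x); by rewrite /sqn ?lerDl ?lerDr sqr_ge0.
Qed.

Lemma L1_sqrt u : L1 u -> intble (fun x => Num.sqrt (sqn (u x))).
Proof.
move=> [ru iu]; have mu_ := L1_meas (conj ru iu).
have h := integrableRD (integrable_norm ru) (integrable_norm iu).
apply: (integrableR_le _ _ h) => [|x].
  exact: (measurableT_comp (@measurable_sqrt R) (measurable_sqn mu_)).
rewrite ger0_norm ?sqrtr_ge0// [leRHS]ger0_norm ?addr_ge0//=.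
rewrite -[leRHS]ger0_norm ?addr_ge0// -sqrtr_sqr ler_wsqrtr//.
rewrite sqrrD !real_normK ?num_real// /sqn -addrA lerD2l lerDr.
by rewrite mulrn_wge0// mulr_ge0.
Qed.

Lemma L1D u v : L1 u -> L1 v -> L1 (fun x => u x + v x).
Proof.
move=> [ru iu] [rv iv]; split.
  rewrite (_ : (fun _ => _) = (fun x => re (u x) + re (v x))); first exact: integrableRD.
  by apply/funext => x; case: (u x) (v x) => ? ? [].
rewrite (_ : (fun _ => _) = (fun x => im (u x) + im (v x))); first exact: integrableRD.
by apply/funext => x; case: (u x) (v x) => ? ? [].
Qed.

Lemma L1Z (c : R[i]) u : L1 u -> L1 (fun x => c * u x).
Proof.
move=> Lu; apply: (@L1_dominated _ (fun x => Num.sqrt (sqn c) * Num.sqrt (sqn (u x)))).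
- by apply: cmeasM; [exact: cmeas_cst|exact: L1_meas].
- by apply: integrableRZ; exact: L1_sqrt.
- by move=> x; rewrite exprMn !sqr_sqrtr ?sqn_ge0// sqnM.
Qed.

Lemma L1_bounded_mul (k u : T -> R[i]) (B : R) : cmeas k ->
  (forall x, sqn (k x) <= B) -> L1 u -> L1 (fun x => k x * u x).
Proof.
move=> mk kB Lu.
apply: (@L1_dominated _ (fun x => Num.sqrt B * Num.sqrt (sqn (u x)))).
- by apply: cmeasM => //; exact: L1_meas.
- by apply: integrableRZ; exact: L1_sqrt.
- move=> x; have B0 : 0 <= B by apply: le_trans (kB x); exact: sqn_ge0.
  by rewrite exprMn !sqr_sqrtr ?sqn_ge0// sqnM ler_wpM2r ?sqn_ge0.
Qed.

Lemma cintD u v : L1 u -> L1 v -> cint (fun x => u x + v x) = cint u + cint v.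
Proof.
move=> [ru iu] [rv iv]; rewrite /cint; apply/eqP; rewrite eq_complex/=.
rewrite -!RintegralD//; apply/andP; split; apply/eqP; apply: eq_Rintegral => x _;
  by case: (u x) (v x) => ? ? [].
Qed.

Lemma cintZ (c : R[i]) u : L1 u -> cint (fun x => c * u x) = c * cint u.
Proof.
case: c => a b [ru iu]; rewrite /cint; apply/eqP; rewrite eq_complex/=.
rewrite -!RintegralZl// -RintegralB//; try exact: integrableRZ.
rewrite -RintegralD//; try exact: integrableRZ.
by apply/andP; split; apply/eqP; apply: eq_Rintegral => x _; case: (u x).
Qed.

Lemma L2_mul u v : L2 mu u -> L2 mu v -> L1 (fun x => u x * (v x)^*).
Proof.
move=> [mu_ iu] [mv iv].
apply: (@L1_dominated _ (fun x => sqn (u x) + sqn (v x))).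
- by apply: cmeasM => //; exact: cmeas_conj.
- exact: integrableRD.
- move=> x; rewrite sqnM (_ : sqn (v x)^* = sqn (v x)); last first.
    by case: (v x) => a b; rewrite /sqn/= sqrrN.
  by have := sqn_ge0 (u x); have := sqn_ge0 (v x); nra.
Qed.

Lemma ip_cint u v : ip mu u v = re (cint (fun x => u x * (v x)^*)).
Proof.
rewrite /cint/=; apply: eq_Rintegral => x _.
by case: (u x) (v x) => ? ? [? ?] /=; ring.
Qed.

Local Notation normc := (@Normc.normc R).

Lemma Lnorm2_sq u : cmeas u ->
  (Lnorm mu 2%:E (EFin \o (normc \o u)) `^ 2 = \int[mu]_x (sqn (u x))%:E)%E.
Proof.
move=> mu_; rewrite poweR_Lnorm//; apply: eq_integral => x _ /=.
by rewrite powR_mulrn ?normr_ge0// real_normK ?num_real// sqn_normc.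
Qed.

Lemma L2_Lnorm u : L2 mu u <->
  cmeas u /\ (Lnorm mu 2%:E (EFin \o (normc \o u)) < +oo)%E.
Proof.
split=> [[mu_ iu]|[mu_ lu]]; split => //.
  apply: (@lty_poweRy _ _ 2); first by rewrite pnatr_eq0.
  by rewrite Lnorm2_sq//; have := integrable_lty measurableT iu.
apply/integrableP; split; first by apply/measurable_EFinP; exact: measurable_sqn.
under eq_integral do rewrite /= ger0_norm ?sqn_ge0//.
by rewrite -Lnorm2_sq// poweR_lty.
Qed.

Lemma Lnorm2_nrm u : L2 mu u ->
  Lnorm mu 2%:E (EFin \o (normc \o u)) = (nrm mu u)%:E.
Proof.
move=> Lu; have := Lnorm2_sq Lu.1; rewrite -nrm_sqE//.
have [_] := (L2_Lnorm u).1 Lu.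
have : (0 <= Lnorm mu 2%:E (EFin \o (normc \o u)))%E by exact: Lnorm_ge0.
case: (Lnorm _ _ _) => [r|//|//]; rewrite lee_fin => r0 _ /= [].
rewrite powR_mulrn// => h; congr EFin; apply/eqP.
by rewrite -(@eqrXn2 _ 2%N)// ?h// nrm_ge0.
Qed.

Lemma L1_Lnorm u : L1 u <->
  cmeas u /\ (Lnorm mu 1%:E (EFin \o (normc \o u)) < +oo)%E.
Proof.
have E : Lnorm mu 1%:E (EFin \o (normc \o u)) = (\int[mu]_x `|(Num.sqrt (sqn (u x)))%:E|)%E.
  by rewrite Lnorm1; apply: eq_integral => x _ /=; rewrite normc_sqn.
split=> [Lu|[mu_]].
  split; first exact: L1_meas.
  by rewrite E; have /integrableP[] := L1_sqrt Lu.
rewrite E => h; apply: (@L1_dominated _ (fun x => Num.sqrt (sqn (u x)))) => //.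
  apply/integrableP; split => //; apply/measurable_EFinP.
  exact: (measurableT_comp (@measurable_sqrt R) (measurable_sqn mu_)).
by move=> x; rewrite sqr_sqrtr ?sqn_ge0.
Qed.

End complex_integral.

Section fubini.
Local Open Scope complex_scope.
Context d1 d2 (T1 : measurableType d1) (T2 : measurableType d2) (R : realType).
Variables (m1 : {sigma_finite_measure set T1 -> \bar R}).
Variables (m2 : {sigma_finite_measure set T2 -> \bar R}).
Local Notation mm := (m1 \x m2)%E.

Lemma Rfubini (f : T1 * T2 -> R) : mm.-integrable setT (EFin \o f) ->
  (forall x, m2.-integrable setT (fun y => (f (x, y))%:E)) ->
  (forall y, m1.-integrable setT (fun x => (f (x, y))%:E)) ->
  Rintegral m1 setT (fun x => Rintegral m2 setT (fun y => f (x, y))) =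
    Rintegral mm setT f /\
  Rintegral m2 setT (fun y => Rintegral m1 setT (fun x => f (x, y))) =
    Rintegral mm setT f.
Proof.
move=> fi f1 f2; split; rewrite /Rintegral; congr fine.
  rewrite -[RHS]/(\int[mm]_z (EFin \o f) z)%E -(fubini1 fi).
  by apply: eq_integral => x _; rewrite fineK//; exact: integrable_fin_num.
rewrite -[RHS]/(\int[mm]_z (EFin \o f) z)%E -(fubini2 fi).
by apply: eq_integral => y _; rewrite fineK//; exact: integrable_fin_num.
Qed.

Lemma cfubini (F : T1 * T2 -> R[i]) : L1 mm F ->
  (forall x, L1 m2 (fun y => F (x, y))) -> (forall y, L1 m1 (fun x => F (x, y))) ->
  cint m1 (fun x => cint m2 (fun y => F (x, y))) = cint mm F /\
  cint m2 (fun y => cint m1 (fun x => F (x, y))) = cint mm F.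
Proof.
move=> [rF iF] F1 F2.
have [r1 r2] := Rfubini rF (fun x => (F1 x).1) (fun y => (F2 y).1).
have [i1 i2] := Rfubini iF (fun x => (F1 x).2) (fun y => (F2 y).2).
by split; rewrite /cint/=; congr (_ +i* _).
Qed.

Lemma cmeas_fst (f : T1 -> R[i]) : cmeas f -> cmeas (fun z : T1 * T2 => f z.1).
Proof.
by move=> [rf jf]; split; [apply: (measurableT_comp (f := fun x => re (f x)))
  |apply: (measurableT_comp (f := fun x => im (f x)))].
Qed.

Lemma cmeas_snd (g : T2 -> R[i]) : cmeas g -> cmeas (fun z : T1 * T2 => g z.2).
Proof.
by move=> [rf jf]; split; [apply: (measurableT_comp (f := fun x => re (g x)))
  |apply: (measurableT_comp (f := fun x => im (g x)))].
Qed.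

Lemma L1_tensor (f : T1 -> R[i]) (g : T2 -> R[i]) : L1 m1 f -> L1 m2 g ->
  L1 mm (fun z => f z.1 * g z.2).
Proof.
move=> Lf Lg.
apply: (@L1_dominated _ _ _ _ _ (fun z => Num.sqrt (sqn (f z.1)) * Num.sqrt (sqn (g z.2)))).
- by apply: cmeasM; [exact: cmeas_fst (L1_meas Lf)|exact: cmeas_snd (L1_meas Lg)].
- have mf : measurable_fun setT (fun x => Num.sqrt (sqn (f x))).
    exact: integrableR_meas (L1_sqrt Lf).
  have mg : measurable_fun setT (fun x => Num.sqrt (sqn (g x))).
    exact: integrableR_meas (L1_sqrt Lg).
  apply/integrable12ltyP.
    apply/measurable_EFinP; apply: measurable_funM.
      exact: (measurableT_comp mf).
    exact: (measurableT_comp mg).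
  pose G := (\int[m2]_y (Num.sqrt (sqn (g y)))%:E)%E.
  have G0 : (0 <= G)%E by apply: integral_ge0 => y _; rewrite lee_fin sqrtr_ge0.
  have Gf : G \is a fin_num by have := integrable_fin_num measurableT (L1_sqrt Lg).
  rewrite [X in (X < _)%E](_ : _ = (\int[m1]_x ((Num.sqrt (sqn (f x)))%:E * (fine G)%:E))%E); last first.
    apply: eq_integral => x _; rewrite fineK// -ge0_integralZl//; last exact/measurable_EFinP.
    by apply: eq_integral => y _ /=; rewrite ger0_norm ?mulr_ge0 ?sqrtr_ge0.
  rewrite ge0_integralZr//; last first.
  + by rewrite lee_fin fine_ge0.
  + exact/measurable_EFinP.
  apply: lte_mul_pinfty.
  + by apply: integral_ge0 => y _; rewrite lee_fin sqrtr_ge0.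
  + by have := integrable_fin_num measurableT (L1_sqrt Lf).
  + by rewrite ltry.
- by move=> z; rewrite exprMn !sqr_sqrtr ?sqn_ge0// sqnM.
Qed.

Lemma cint_tensor (f : T1 -> R[i]) (g : T2 -> R[i]) : L1 m1 f -> L1 m2 g ->
  cint mm (fun z => f z.1 * g z.2) = cint m1 f * cint m2 g.
Proof.
move=> Lf Lg.
have [<- _] := cfubini (L1_tensor Lf Lg) (fun x => L1Z (f x) Lg)
  (fun y => eq_ind _ (L1 m1) (L1Z (g y) Lf) _ (funext (fun x => mulrC _ _))).
rewrite [RHS]mulrC -cintZ//; apply: eq_cint => x /=.
by rewrite cintZ// mulrC.
Qed.

End fubini.

(** * The Fejer integral *)

Section fejer_integral.
Variable R : realType.
Local Notation leb := (@lebesgue_measure R).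

Lemma cvg_inv_affine (F : R -> R) (B c : R) : 0 < c ->
  (forall x, 0 <= x -> `|F x| <= B / (1 + c * x)) -> F x @[x --> +oo] --> (0 : R).
Proof.
move=> c0 FB; apply/cvgrPdist_lt => e e0.
have B0 : 0 <= B by have := FB 0 (lexx _); rewrite mulr0 addr0 divr1; exact: le_trans.
near=> x.
have x0 : 0 <= x by near: x; apply: nbhs_pinfty_ge; exact: num_real.
have x1 : B / e / c < x by near: x; apply: nbhs_pinfty_gt; exact: num_real.
rewrite sub0r normrN; apply: le_lt_trans (FB x x0) _.
have d0 : 0 < 1 + c * x by rewrite ltr_pwDl// mulr_ge0// ltW.
rewrite ltr_pdivrMr// mulrC -ltr_pdivrMr//.
have h : B / e < x * c by rewrite -ltr_pdivrMr.
by rewrite (lt_trans h)// mulrC ltrDr.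
Unshelve. all: by end_near. Qed.

Lemma halfline_FTC (f F : R -> R) (l : R) : (forall x : R, is_derive x 1 F (f x)) ->
  continuous f -> (forall x, 0 <= x -> 0 <= f x) -> F x @[x --> +oo] --> l ->
  (\int[leb]_(x in `[0%R, +oo[) (f x)%:E = (l - F 0)%:E)%E.
Proof.
move=> dF cf f0 Fl; rewrite EFinB; apply: ge0_continuous_FTC2y => //.
- exact: continuous_subspaceT.
- apply: cvg_at_right_filter; apply: differentiable_continuous.
  by apply/derivable1_diffP; have [] := dF 0.
- by move=> x _; rewrite derive1E; have [_ ->] := dF x.
Qed.

Lemma is_derive_linear (c t : R) : is_derive t 1 (fun t : R => c * t) c.
Proof. by apply: is_derive_eq; rewrite /GRing.scale/= mulr1 ?mulr0 ?addr0. Qed.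

Lemma is_derive_expRN (c t : R) :
  is_derive t 1 (fun t => expR (- (c * t))) (expR (- (c * t)) * - c).
Proof.
apply: (is_derive1_comp (f := expR) (g := fun t => - (c * t))).
by have := is_derive_linear c t => ?; apply: is_deriveN.
Qed.

Lemma expRN_le (y : R) : 0 <= y -> expR (- y) <= (1 + y)^-1.
Proof.
move=> y0; rewrite expRN lef_pV2 ?posrE ?expR_gt0 ?expR_ge1Dx//.
by rewrite ltr_pwDl.
Qed.

(** A primitive is - (t / c + 1 / c^2) e^{-c t}. *)
Lemma integral_id_expR (c : R) : 0 < c ->
  (\int[leb]_(t in `[0%R, +oo[) (t * expR (- (c * t)))%:E = (c ^- 2)%:E)%E.
Proof.
move=> c0; have cn : c != 0 by rewrite gt_eqF.
etransitivity; first apply: (@halfline_FTC _ (fun t => - (c^-1 * t + c ^- 2) * expR (- (c * t))) 0).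
- move=> t; have := is_derive_expRN c t => d1.
  have := is_derive_linear c^-1 t => d2.
  apply: is_derive_eq; rewrite /GRing.scale/=; field.
  exact: cn.
- move=> t; apply: differentiable_continuous; apply/derivable1_diffP.
  have := is_derive_expRN c t => d1.
  have : is_derive t 1 (fun t => t * expR (- (c * t))) (t * (expR (- (c * t)) * - c) + expR (- (c * t))).
    by apply: is_derive_eq; rewrite /GRing.scale/= mulr1 addrC.
  by case.
- by move=> t t0; rewrite mulr_ge0// expR_ge0.
- apply: (@cvg_inv_affine _ (2 * c ^- 2) (c / 2)); first by rewrite divr_gt0.
  move=> x x0.
  have cx : 0 <= c * x / 2 by rewrite divr_ge0// mulr_ge0// ltW.
  have p : 0 < 1 + c * x / 2 by rewrite ltr_pwDl.
  have k0 : 0 <= c^-1 * x + c ^- 2.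
    apply: addr_ge0; last by rewrite invr_ge0 exprn_ge0// ltW.
    by rewrite mulr_ge0// invr_ge0 ltW.
  rewrite normrM normrN (ger0_norm k0) (ger0_norm (expR_ge0 _)).
  have -> : - (c * x) = - (c * x / 2) + - (c * x / 2) by field.
  rewrite expRD.
  have h := expRN_le cx; have h0 := expR_ge0 (- (c * x / 2)).
  have h2 : expR (- (c * x / 2)) * expR (- (c * x / 2)) <= (1 + c * x / 2)^-1 * (1 + c * x / 2)^-1.
    by apply: ler_pM.
  apply: (le_trans (ler_wpM2l k0 h2)).
  rewrite [c / 2 * x](_ : _ = c * x / 2); last by ring.
  rewrite mulrA ler_pM2r ?invr_gt0// ler_pdivrMr//.
  have -> : c^-1 * x + c ^- 2 = c ^- 2 * (1 + c * x) by field.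
  rewrite [leRHS](_ : _ = c ^- 2 * (2 * (1 + c * x / 2))); last by ring.
  rewrite ler_pM2l ?invr_gt0 ?exprn_gt0//; lra.
- by congr EFin; rewrite /= !mulr0 oppr0 expR0; field.
Qed.

Lemma integral_versine_expR (a t : R) : 0 < t ->
  (\int[leb]_(x in `[0%R, +oo[) ((1 - cos (a * x)) * expR (- (t * x)))%:E
   = (a ^+ 2 / (t * (t ^+ 2 + a ^+ 2)))%:E)%E.
Proof.
move=> t0; have tn : t != 0 by rewrite gt_eqF.
have D0 : 0 < t ^+ 2 + a ^+ 2 by rewrite ltr_pwDl ?exprn_gt0// sqr_ge0.
have Dn : t ^+ 2 + a ^+ 2 != 0 by rewrite gt_eqF.
have dcos (x : R) : is_derive x 1 (fun x : R => cos (a * x)) (- sin (a * x) * a).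
  apply: (is_derive1_comp (f := cos) (g := fun x => a * x)); exact: is_derive_linear.
have dsin (x : R) : is_derive x 1 (fun x : R => sin (a * x)) (cos (a * x) * a).
  apply: (is_derive1_comp (f := sin) (g := fun x => a * x)); exact: is_derive_linear.
pose F x := (- t^-1 + (t / (t ^+ 2 + a ^+ 2) * cos (a * x) -
   a / (t ^+ 2 + a ^+ 2) * sin (a * x))) * expR (- (t * x)).
etransitivity; first apply: (@halfline_FTC _ F 0).
- move=> x; have := is_derive_expRN t x => d1; have := dcos x => d2; have := dsin x => d3.
  rewrite /F; apply: is_derive_eq; rewrite /GRing.scale/=; field.
  by rewrite tn Dn.
- move=> x; apply: differentiable_continuous; apply/derivable1_diffP.
  have := is_derive_expRN t x => d1; have := dcos x => d2.
  have : is_derive x 1 (fun x => (1 - cos (a * x)) * expR (- (t * x)))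
    ((1 - cos (a * x)) * (expR (- (t * x)) * - t) + expR (- (t * x)) * (sin (a * x) * a)).
    by apply: is_derive_eq; rewrite /GRing.scale/=; ring.
  by case.
- by move=> x x0; rewrite mulr_ge0 ?expR_ge0// subr_ge0 cos_le1.
- apply: (@cvg_inv_affine _ (t^-1 + (t / (t ^+ 2 + a ^+ 2) + `|a| / (t ^+ 2 + a ^+ 2))) t) => //.
  move=> x x0; rewrite /F normrM; apply: ler_pM => //.
    have n1 (k c : R) : `|c| <= 1 -> `|k * c| <= `|k|.
      by move=> h; rewrite normrM ler_piMr.
    have c1 : `|cos (a * x)| <= 1 by rewrite ler_norml cos_geN1 cos_le1.
    have s1 : `|sin (a * x)| <= 1 by rewrite ler_norml sin_geN1 sin_le1.
    apply: (le_trans (ler_normD _ _)); apply: lerD.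
      by rewrite normrN gtr0_norm// invr_gt0.
    apply: (le_trans (ler_normB _ _)); apply: lerD.
      by apply: (le_trans (n1 _ _ c1)); rewrite gtr0_norm// divr_gt0.
    by apply: (le_trans (n1 _ _ s1)); rewrite normrM normfV [`|_ + _|]gtr0_norm.
  by rewrite ger0_norm ?expR_ge0// expRN_le// mulr_ge0// ltW.
- by congr EFin; rewrite /F /= !mulr0 oppr0 expR0 cos0 sin0; field; rewrite tn Dn.
Qed.

Lemma integral_cauchy_kernel (a : R) : 0 < a ->
  (\int[leb]_(t in `[0%R, +oo[) (a ^+ 2 / (t ^+ 2 + a ^+ 2))%:E = (a * (pi / 2))%:E)%E.
Proof.
move=> a0; have an : a != 0 by rewrite gt_eqF.
have D0 (t : R) : 0 < t ^+ 2 + a ^+ 2 by rewrite ltr_wpDl ?exprn_gt0// sqr_ge0.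
have d (t : R) : is_derive t 1 (fun t => a * atan (a^-1 * t)) (a ^+ 2 / (t ^+ 2 + a ^+ 2)).
  have : is_derive t 1 (fun t => atan (a^-1 * t)) ((1 + (a^-1 * t) ^+ 2)^-1 * a^-1).
    apply: (is_derive1_comp (f := atan) (g := fun t => a^-1 * t)); exact: is_derive_linear.
  move=> ?; apply: is_derive_eq; rewrite /GRing.scale/=; field.
  by rewrite an !gt_eqF// addrC ?D0 // exprMn; exact: D0.
etransitivity; first apply: (@halfline_FTC _ (fun t => a * atan (a^-1 * t)) (a * (pi / 2))) => //.
- move=> t; apply: (@cvgM R R); first exact: cvg_cst.
  apply: (@cvgV R R); first by rewrite gt_eqF.
  by apply: (@cvgD R R^o); [exact: exprn_continuous|exact: cvg_cst].
- by move=> t _; rewrite divr_ge0 ?sqr_ge0// ltW.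
- apply: cvgMr; apply: (@cvg_comp _ _ _ (fun t => a^-1 * t) atan _ +oo).
    by apply: gt0_cvgMry => //; rewrite invr_gt0.
  exact: cvgy_atan.
- by rewrite /= mulr0 atan0 mulr0 subr0.
Qed.

(** The kernel 1 / x^2 = int_0^oo t e^{-t|x|} dt removes the singularity at 0:
    by Tonelli only elementary primitives are left. *)
Lemma integral_fejer (a : R) :
  (\int[leb]_x ((1 - cos (a * x)) / x ^+ 2)%:E = (pi * `|a|)%:E)%E.
Proof.
wlog a0 : a / 0 < a.
  move=> h; have [->|an] := eqVneq a 0.
    rewrite normr0 mulr0; apply: integral0_eq => x _.
    by rewrite mul0r cos0 subrr mul0r.
  have [|a0|a0'] := ltgtP 0 a; first exact: h; last by rewrite -a0' eqxx in an.
  rewrite -normrN -h ?oppr_gt0//; apply: eq_integral => x _.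
  by rewrite mulNr cosN.
rewrite gtr0_norm//.
pose f (z : R * R) : \bar R :=
  (\1_(`[0, +oo[%classic : set R) z.2 * ((1 - cos (a * z.1)) * (z.2 * expR (- (z.2 * `|z.1|)))))%:E.
have f0 z : (0 <= f z)%E.
  rewrite lee_fin; case: z => x t; rewrite /= indicE.
  case: (boolP (t \in _)); last by rewrite mul0r.
  rewrite inE/= in_itv/= andbT => t0; rewrite mul1r; apply: mulr_ge0.
    by rewrite subr_ge0 cos_le1.
  by rewrite mulr_ge0 ?expR_ge0.
have mf : measurable_fun [set: measurableTypeR R * measurableTypeR R] f.
  apply/measurable_EFinP; apply: measurable_funM.
    have mi : measurable_fun setT (\1_(`[0, +oo[%classic : set R) : measurableTypeR R -> R).
      by apply: measurable_indic; exact: measurable_itv.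
    exact: (measurableT_comp mi measurable_snd).
  apply: measurable_funM.
    apply: measurable_funB => //.
    have mc : measurable_fun setT (fun x : measurableTypeR R => cos (a * x)).
      apply: continuous_measurable_fun => x.
      apply: (@cvg_comp _ _ _ (fun x : R => a * x) cos _ (nbhs (a * x))); last exact: continuous_cos.
      exact: mulrl_continuous.
    exact: (measurableT_comp mc measurable_fst).
  apply: measurable_funM => //.
  apply: (measurableT_comp (f := @expR R)) => //.
  apply: measurableT_comp => //; apply: measurable_funM => //.
  exact: measurableT_comp.
etransitivity; last (etransitivity;
  first exact: (@fubini_tonelli _ _ (measurableTypeR R) (measurableTypeR R) R leb leb f mf f0)).
  apply: eq_integral => x _; have [->|xn] := eqVneq x 0.
    rewrite mulr0 cos0 subrr mul0r integral0_eq// => t _.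
    by rewrite /f/= mulr0 cos0 subrr mul0r mulr0.
  have ax : 0 < `|x| by rewrite normr_gt0.
  have -> : x ^+ 2 = `|x| ^+ 2 by rewrite real_normK ?num_real.
  rewrite EFinM -(integral_id_expR ax) -ge0_integralZl//; last first.
  - move=> t; rewrite /= in_itv/= andbT => t0.
    by rewrite lee_fin mulr_ge0 ?expR_ge0.
  - apply/measurable_EFinP; apply: measurable_funTS; apply: measurable_funM => //.
    apply: (measurableT_comp (f := @expR R)) => //.
    by apply: measurableT_comp => //; exact: measurable_funM.
  rewrite integral_mkcond; apply: eq_integral => t _.
  rewrite patchE /f/= indicE; case: ifP => _; last by rewrite mul0r.
  by rewrite mul1r [`|x| * _]mulrC.
transitivity (\int[leb]_(t in `[0%R, +oo[) (2 * (a ^+ 2 / (t ^+ 2 + a ^+ 2)))%:E)%E.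
  rewrite [RHS]integral_mkcond.
  have null : leb [set (0 : R)] = 0%E by exact: lebesgue_measure_set1.
  apply: ae_eq_integral => //.
  - by apply: (@measurable_fun_fubini_tonelli_G _ _ (measurableTypeR R) (measurableTypeR R) R leb f).
  - apply/(measurable_restrictT _ _).1 => //.
    apply/measurable_EFinP; apply: measurable_funTS; apply: measurable_funM => //.
    apply: continuous_measurable_fun => t; apply: (@cvgM R R); first exact: cvg_cst.
    apply: (@cvgV R R); first by rewrite gt_eqF// ltr_wpDl ?exprn_gt0// sqr_ge0.
    by apply: (@cvgD R R^o); [exact: exprn_continuous|exact: cvg_cst].
  exists [set 0]; split => // t /=; apply: contra_notP => /eqP tn _.
  rewrite patchE; case: ifPn => [|tneg]; last first.
    apply: integral0_eq => x _; rewrite /f/= indicE.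
    by rewrite (negbTE tneg) mul0r.
  rewrite inE/= in_itv/= andbT => t0.
  have {}t0 : 0 < t by rewrite lt_neqAle eq_sym tn.
  have tin : t \in (`[0, +oo[%classic : set R) by rewrite inE/= in_itv/= andbT ltW.
  transitivity (\int[leb]_x (t%:E * ((1 - cos (a * x)) * expR (- (t * `|x|)))%:E))%E.
    apply: eq_integral => x _; rewrite /f/= indicE tin mul1r -EFinM; congr EFin; ring.
  have g0 (x : R) : 0 <= (1 - cos (a * x)) * expR (- (t * `|x|)).
    by rewrite mulr_ge0 ?expR_ge0// subr_ge0 cos_le1.
  have cg : continuous (fun x : R => (1 - cos (a * x)) * expR (- (t * `|x|))).
    move=> x; apply: (@cvgM R R).
      apply: (@cvgB R R^o); first exact: cvg_cst.
      apply: (@cvg_comp _ _ _ (fun x : R => a * x) cos _ (nbhs (a * x))); last exact: continuous_cos.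
      exact: mulrl_continuous.
    apply: (@cvg_comp _ _ _ (fun x : R => - (t * `|x|)) expR _ (nbhs (- (t * `|x|)))); last exact: continuous_expR.
    apply: (@cvgN R R^o); apply: (@cvgMr R R^o); exact: norm_continuous.
  rewrite ge0_integralZl//; last 2 first.
  - by apply/measurable_EFinP; exact: continuous_measurable_fun.
  - by rewrite lee_fin ltW.
  rewrite ge0_symfun_integralT//; last by move=> x /=; rewrite mulrN cosN normrN.
  have -> : (\int[leb]_(x in [set x : R | (0 <= x)%R]) ((1 - cos (a * x)) * expR (- (t * `|x|)))%:E
    = \int[leb]_(x in `[0%R, +oo[) ((1 - cos (a * x)) * expR (- (t * x)))%:E)%E.
    rewrite set_itvcy; apply: eq_integral => x; rewrite inE/= => x0.
    by rewrite ger0_norm.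
  rewrite integral_versine_expR// -!EFinM; congr EFin; field.
  by rewrite tn andbT gt_eqF// ltr_wpDl ?exprn_gt0// sqr_ge0.
under eq_integral do rewrite EFinM.
rewrite ge0_integralZl//; last 2 first.
- apply/measurable_EFinP; apply: measurable_funTS.
  apply: continuous_measurable_fun => t; apply: (@cvgM R R); first exact: cvg_cst.
  apply: (@cvgV R R); first by rewrite gt_eqF// ltr_wpDl ?exprn_gt0// sqr_ge0.
  by apply: (@cvgD R R^o); [exact: exprn_continuous|exact: cvg_cst].
- by move=> t _; rewrite lee_fin divr_ge0 ?sqr_ge0// addr_ge0// sqr_ge0.
by rewrite integral_cauchy_kernel// -EFinM; congr EFin; field.
Qed.

End fejer_integral.

(** * Transforms of intervals *)

Section parameter_integral.
Local Open Scope complex_scope.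
Context d1 d2 (T1 : measurableType d1) (T2 : measurableType d2) (R : realType).
Variable m1 : {sigma_finite_measure set T1 -> \bar R}.

Lemma measurable_Rintegral (f : T1 * T2 -> R) : measurable_fun setT f ->
  measurable_fun setT (fun y => Rintegral m1 setT (fun x => f (x, y))).
Proof.
move=> mf; rewrite /Rintegral.
apply: measurableT_comp => //.
under eq_fun do rewrite integralE.
apply: emeasurable_funB.
  rewrite (_ : (fun _ => _) = fubini_G m1 ((fun z => (f z)%:E)^\+)%E).
    apply: measurable_fun_fubini_tonelli_G => //.
    by apply: measurable_funepos; exact/measurable_EFinP.
  by apply/funext => y; apply: eq_integral => x _; rewrite !funeposE.
rewrite (_ : (fun _ => _) = fubini_G m1 ((fun z => (f z)%:E)^\-)%E).
  apply: measurable_fun_fubini_tonelli_G => //.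
  by apply: measurable_funeneg; exact/measurable_EFinP.
by apply/funext => y; apply: eq_integral => x _; rewrite !funenegE.
Qed.

Lemma cmeas_cint (F : T1 * T2 -> R[i]) : cmeas F ->
  cmeas (fun y => cint m1 (fun x => F (x, y))).
Proof.
by move=> [rF iF]; split; [exact: (measurable_Rintegral rF)|exact: (measurable_Rintegral iF)].
Qed.

End parameter_integral.

Section invariance.
Variable R : realType.
Local Notation leb := (@lebesgue_measure R).
Local Notation mR := (measurableTypeR R).

Lemma lebesgue_shift (c : R) (A : set mR) : measurable A ->
  leb ((fun x : mR => x - c) @^-1` A) = leb A.
Proof.
move=> mA.
have mc : measurable_fun [set: mR] (fun x : mR => (x - c : mR)) by exact: measurable_funB.
have := @lebesgue_measure_unique R (pushforward leb (fun x : mR => (x - c : mR))).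
move=> /(_ mc _ A mA) ->// X [[a b] _ <-]; rewrite /pushforward/=.
rewrite [RHS](_ : _ = leb `]a + c, b + c]%classic); last first.
  by congr (leb _); apply/seteqP; split => x /=; rewrite !in_itv/=; lra.
by rewrite !lebesgue_measure_itv/= !lte_fin ltrD2r; case: ifP => // _; rewrite -!EFinB; congr EFin; lra.
Qed.

Lemma lebesgue_opp (A : set mR) : measurable A ->
  leb ((fun x : mR => - x) @^-1` A) = leb A.
Proof.
move=> mA.
have mc : measurable_fun [set: mR] (fun x : mR => (- x : mR)) by exact: measurable_funN.
have := @lebesgue_measure_unique R (pushforward leb (fun x : mR => (- x : mR))).
move=> /(_ mc _ A mA) ->// X [[a b] _ <-]; rewrite /pushforward/=.
rewrite [RHS](_ : _ = leb `[- b, - a[%classic); last first.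
  by congr (leb _); apply/seteqP; split => x /=; rewrite !in_itv/=; lra.
by rewrite !lebesgue_measure_itv/= !lte_fin ltrN2; case: ifP => // _; rewrite -!EFinB; congr EFin; lra.
Qed.

Lemma Rintegral_odd (f : mR -> R) : leb.-integrable setT (EFin \o f) ->
  (forall x, f (- x) = - f x) -> Rintegral leb setT f = 0.
Proof.
move=> fi fo; have mf := measurable_int _ fi.
have mc : measurable_fun [set: mR] (fun x : mR => (- x : mR)) by exact: measurable_funN.
have i2 : leb.-integrable setT (EFin \o f \o (fun x : mR => - x)).
  rewrite (_ : _ \o _ = (fun x => (-1)%:E * (f x)%:E)%E); first exact: integrableZl.
  by apply/funext => x /=; rewrite fo mulN1e.
have h : (\int[leb]_x (f x)%:E = \int[leb]_x (f (- x))%:E)%E.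
  have := @integral_pushforward _ _ mR mR R _ mc leb setT (EFin \o f) mf i2 measurableT.
  rewrite preimage_setT => <-; apply: eq_measure_integral => A mA _.
  exact/esym/lebesgue_opp.
have : Rintegral leb setT f = - Rintegral leb setT f.
  rewrite {1}/Rintegral h -[RHS]mulN1r -RintegralZl//.
  by rewrite /Rintegral; congr fine; apply: eq_integral => x _; rewrite fo mulN1r.
lra.
Qed.

End invariance.

Section interval_transform.
Local Open Scope complex_scope.
Variable R : realType.
Local Notation leb := (@lebesgue_measure R).
Local Notation mR := (measurableTypeR R).

Definition echar (t : R) : R[i] := cos t -i* sin t.

Lemma sqn_echar t : sqn (echar t) = 1.
Proof. by rewrite /sqn/= sqrrN cos2Dsin2. Qed.

Lemma echarD s t : echar (s + t) = echar s * echar t.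
Proof. by rewrite /echar cosD sinD; apply/eqP; rewrite eq_complex/=; apply/andP; split; apply/eqP; ring. Qed.

Lemma echar0 : echar 0 = 1.
Proof. by rewrite /echar cos0 sin0 oppr0. Qed.

Lemma measurable_cos : measurable_fun [set: mR] (@cos R).
Proof. by apply: continuous_measurable_fun; exact: continuous_cos. Qed.

Lemma measurable_sin : measurable_fun [set: mR] (@sin R).
Proof. by apply: continuous_measurable_fun; exact: continuous_sin. Qed.

Lemma cmeas_echar d (T : measurableType d) (f : T -> R) : measurable_fun setT f ->
  cmeas (fun x => echar (f x)).
Proof.
move=> mf; split; first exact: (measurableT_comp measurable_cos).
by apply: measurableT_comp => //; exact: (measurableT_comp measurable_sin).
Qed.

Definition ivl (p : R * R) (x : mR) : R[i] := (\1_(`]p.1, p.2]%classic : set R) x)%:C.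

Lemma measurable_ivl p : measurable_fun [set: mR] (\1_(`]p.1, p.2]%classic : set R) : mR -> R).
Proof. by apply: measurable_indic; exact: measurable_itv. Qed.

Lemma indic_sq (A : set R) x : (\1_A x : R) ^+ 2 = \1_A x.
Proof. by rewrite indicE; case: (_ \in _); rewrite ?expr1n ?expr0n. Qed.

Lemma indic_integrable p : leb.-integrable setT (EFin \o (\1_(`]p.1, p.2]%classic : set R))).
Proof. exact: integrable_indic_itv. Qed.

Lemma ivl_L1 p : L1 leb (ivl p).
Proof.
apply: (@L1_dominated _ mR R leb (ivl p) (fun x : mR => \1_(`]p.1, p.2]%classic : set R) x)).
- by apply: cmeas_real; exact: measurable_ivl.
- exact: indic_integrable.
- by move=> x; rewrite /ivl /sqn/= expr0n addr0.
Qed.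

Lemma ivl_L2 p : L2 leb (ivl p).
Proof.
split; first exact: L1_meas (ivl_L1 p).
rewrite (_ : _ \o _ = EFin \o (\1_(`]p.1, p.2]%classic : set R))); first exact: indic_integrable.
by apply/funext => x; rewrite /ivl /sqn/= expr0n addr0 indic_sq.
Qed.

Definition inv_sqrt_2pi : R := (2 * pi) `^ (- 2^-1).

Lemma inv_sqrt_2pi_sq : inv_sqrt_2pi ^+ 2 = (2 * pi)^-1.
Proof.
have p0 : 0 < 2 * pi :> R by rewrite mulr_gt0// pi_gt0.
by rewrite /inv_sqrt_2pi -powR_mulrn ?powR_ge0// -powRrM mulNr mulVf// powR_inv1// ltW.
Qed.

Definition ihat (p : R * R) (xi : mR) : R[i] :=
  inv_sqrt_2pi%:C * cint leb (fun x => echar (x * xi) * ivl p x).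

Lemma ihatE p (xi : R) : p.1 < p.2 -> xi != 0 ->
  ihat p xi = (inv_sqrt_2pi / xi)%:C *
    ((sin (p.2 * xi) - sin (p.1 * xi)) +i* (cos (p.2 * xi) - cos (p.1 * xi))).
Proof.
case: p => a b /= ab xi0; rewrite /ihat.
have FTC (f F : R -> R) : (forall x : R, is_derive x 1 F (f x)) -> continuous f ->
   Rintegral leb `]a, b] f = F b - F a.
  move=> dF cf.
  have dd x : derivable F x 1 by have [] := dF x.
  have cF : continuous F.
    by move=> x; apply: differentiable_continuous; exact/derivable1_diffP.
  rewrite /Rintegral integral_itv_obnd_cbnd; last first.
    by apply/measurable_EFinP; apply: measurable_funTS; exact: continuous_measurable_fun.
  rewrite (@continuous_FTC2 _ _ F)//.
  - exact: continuous_subspaceT.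
  - split => //.
    + by apply: cvg_at_right_filter; exact: cF.
    + by apply: cvg_at_left_filter; exact: cF.
  - by move=> x _; rewrite derive1E; have [_ ->] := dF x.
have lin (x : R) : is_derive x 1 (fun x : R => x * xi) xi.
  by apply: is_derive_eq; rewrite /GRing.scale/= mulr1 ?mulr0 ?add0r.
have cl : continuous (fun x : R => x * xi) by exact: mulrr_continuous.
have r1 : Rintegral leb setT (fun x => re (echar (x * xi) * ivl (a, b) x)) = (sin (b * xi) - sin (a * xi)) / xi.
  transitivity (Rintegral leb `]a, b] (fun x => cos (x * xi))).
    rewrite [RHS]Rintegral_mkcond; apply: eq_Rintegral => x _.
    rewrite patchE /ivl/= indicE; case: ifP => _; by rewrite ?mulr1n ?mulr0n ?mulr1 ?mulr0 ?subr0 ?add0r ?addr0.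
  etransitivity; first apply: (@FTC _ (fun x => xi^-1 * sin (x * xi))).
  - move=> x; have : is_derive x 1 (fun x : R => sin (x * xi)) (cos (x * xi) * xi).
      by apply: (is_derive1_comp (f := sin) (g := fun x => x * xi)).
    by move=> ?; apply: is_derive_eq; rewrite /GRing.scale/=; field.
  - move=> x; apply: (@cvg_comp _ _ _ (fun x : R => x * xi) cos _ (nbhs (x * xi))); [exact: cl|exact: continuous_cos].
  - by rewrite /=; field.
have i1 : Rintegral leb setT (fun x => im (echar (x * xi) * ivl (a, b) x)) = (cos (b * xi) - cos (a * xi)) / xi.
  transitivity (Rintegral leb `]a, b] (fun x => - sin (x * xi))).
    rewrite [RHS]Rintegral_mkcond; apply: eq_Rintegral => x _.
    rewrite patchE /ivl/= indicE; case: ifP => _; by rewrite ?mulr1n ?mulr0n ?mulr1 ?mulr0 ?subr0 ?add0r ?addr0.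
  etransitivity; first apply: (@FTC _ (fun x => xi^-1 * cos (x * xi))).
  - move=> x; have : is_derive x 1 (fun x : R => cos (x * xi)) (- sin (x * xi) * xi).
      by apply: (is_derive1_comp (f := cos) (g := fun x => x * xi)).
    by move=> ?; apply: is_derive_eq; rewrite /GRing.scale/=; field.
  - move=> x; apply: (@cvgN R R^o).
    apply: (@cvg_comp _ _ _ (fun x : R => x * xi) sin _ (nbhs (x * xi))); [exact: cl|exact: continuous_sin].
  - by rewrite /=; field.
rewrite /cint r1 i1; apply/eqP; rewrite eq_complex/=.
by apply/andP; split; apply/eqP; ring.
Qed.

Lemma cmeas_ihat p : cmeas (ihat p).
Proof.
apply: cmeasM; first exact: cmeas_cst.
apply: (@cmeas_cint _ _ mR mR R leb (fun z => echar (z.1 * z.2) * ivl p z.1)).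
apply: cmeasM; first by apply: cmeas_echar; exact: measurable_funM.
exact: (@cmeas_fst _ _ mR mR R (ivl p) (L1_meas (ivl_L1 p))).
Qed.

Definition versine (w : R) (x : mR) : R := (1 - cos (w * x)) / x ^+ 2.

Lemma measurable_versine w : measurable_fun [set: mR] (versine w).
Proof.
apply: measurable_funM.
  apply: measurable_funB => //.
  by apply: (measurableT_comp measurable_cos); exact: measurable_funM.
rewrite (_ : (fun _ => _) = (fun x : mR => `|x| `^ (- 2%:R))); last first.
  apply/funext => x; have [->|x0] := eqVneq x 0.
    by rewrite expr0n/= invr0 normr0 powR0// oppr_eq0 pnatr_eq0.
  by rewrite powRN powR_mulrn// real_normK ?num_real.
exact: (measurableT_comp (@measurable_powR R (- 2%:R)) (@normr_measurable R setT)).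
Qed.

Lemma versine_ge0 w x : 0 <= versine w x.
Proof. by rewrite divr_ge0 ?sqr_ge0// subr_ge0 cos_le1. Qed.

Lemma versine_integrable w : leb.-integrable setT (EFin \o versine w).
Proof.
apply/integrableP; split; first by apply/measurable_EFinP; exact: measurable_versine.
under eq_integral do rewrite /= ger0_norm ?versine_ge0//.
by rewrite integral_fejer ltry.
Qed.

Lemma Rintegral_versine w : Rintegral leb setT (versine w) = pi * `|w|.
Proof. by rewrite /Rintegral integral_fejer. Qed.

Lemma ihat0 p : p.2 <= p.1 -> ihat p = fun=> 0.
Proof.
move=> pp; apply/funext => xi; rewrite /ihat (_ : (fun _ => _) = fun=> 0).
  rewrite /cint (_ : Rintegral _ _ _ = 0); last by rewrite Rintegral_cst// mul0r.
  by rewrite mulr0.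
apply/funext => x; rewrite /ivl set_itv_ge ?indic0 ?mulr0//.
by rewrite bnd_simp -leNgt.
Qed.

(** Up to the sign conventions this is the polarised form of
    |e^{-ib xi} - e^{-ia xi}|^2 = 2 (1 - cos ((b - a) xi)). *)
Lemma ihat_mul_re a b c e (xi : R) : a < b -> c < e -> xi != 0 ->
  re (ihat (a, b) xi * (ihat (c, e) xi)^* ) = inv_sqrt_2pi ^+ 2 *
    (versine (b - c) xi + versine (a - e) xi - versine (b - e) xi - versine (a - c) xi).
Proof.
move=> ab ce xi0; rewrite !ihatE//= /versine !mulrBl !cosB.
field; exact: xi0.
Qed.

Lemma ihat_mul_im a b c e (xi : R) : a < b -> c < e ->
  im (ihat (a, b) (- xi) * (ihat (c, e) (- xi))^* ) =
  - im (ihat (a, b) xi * (ihat (c, e) xi)^* ).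
Proof.
move=> ab ce; have [->|xi0] := eqVneq xi 0.
  rewrite oppr0; suff -> : im (ihat (a, b) 0 * (ihat (c, e) 0)^* ) = 0 by rewrite oppr0.
  have im0 p : im (ihat p 0) = 0.
    rewrite /ihat/= (_ : Rintegral _ _ _ = 0) ?mulr0 ?mul0r ?addr0//.
    rewrite (_ : (fun _ => _) = fun=> 0) ?Rintegral_cst ?mul0r//.
    by apply/funext => x; rewrite /= !mulr0 sin0 oppr0 mul0r addr0.
  have := im0 (a, b); have := im0 (c, e).
  by case: (ihat (a, b) 0) (ihat (c, e) 0) => ? ? [? ?] /= -> ->; ring.
rewrite !ihatE ?oppr_eq0//= !mulrN !cosN !sinN.
field; exact: xi0.
Qed.

Lemma Rintegral_ae (f g : mR -> R) : measurable_fun setT f -> leb.-integrable setT (EFin \o g) ->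
  (forall x, x != 0 -> f x = g x) ->
  leb.-integrable setT (EFin \o f) /\ Rintegral leb setT f = Rintegral leb setT g.
Proof.
move=> mf gi fg.
have ae : ae_eq leb setT (EFin \o f) (EFin \o g).
  exists [set 0]; split => //; first exact: lebesgue_measure_set1.
  by move=> x /=; apply: contra_notP => /eqP x0 _; rewrite fg.
have mf' : measurable_fun setT (EFin \o f) by exact/measurable_EFinP.
split.
  apply/integrableP; split => //.
  have /integrableP[mg] := gi; congr (_ < _)%E.
  apply: ae_eq_integral => //; try exact: measurableT_comp.
  by apply: filterS ae => x h _; rewrite (h I).
rewrite /Rintegral; congr fine; apply: ae_eq_integral => //.
exact: measurable_int gi.
Qed.

Lemma ihat_L2 p : L2 leb (ihat p).
Proof.
split; first exact: cmeas_ihat.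
case: p => a b; have [ba|ab] := leP b a.
  rewrite ihat0// (_ : _ \o _ = cst 0%E); first exact: integrable0.
  by apply/funext => x /=; rewrite sqn0.
have := @Rintegral_ae (fun x => sqn (ihat (a, b) x)) (fun x => 2 * inv_sqrt_2pi ^+ 2 * versine (b - a) x).
case=> //.
- exact: measurable_sqn (cmeas_ihat _).
- by apply: integrableRZ; exact: versine_integrable.
- move=> x x0; have := ihat_mul_re ab ab x0.
  have -> : re (ihat (a, b) x * (ihat (a, b) x)^* ) = sqn (ihat (a, b) x).
    by case: (ihat _ _) => ? ?; rewrite /sqn/=; ring.
  move=> ->; rewrite /versine !subrr mul0r cos0 subrr mul0r !subr0 -[a - b]opprB mulNr cosN.
  by ring.
Qed.

(** The combination of distances produced by the Fejer integrals is the length of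
    an intersection of two intervals. *)
Lemma overlap_length (a b c e : R) : a < b -> c < e ->
  (`|b - c| + `|a - e| - `|b - e| - `|a - c|) / 2 =
  if Num.max a c < Num.min b e then Num.min b e - Num.max a c else 0.
Proof.
move=> ab ce.
have le_dist (x y : R) : x <= y -> `|x - y| = y - x by move=> ?; rewrite distrC ger0_norm ?subr_ge0.
have ge_dist (x y : R) : y <= x -> `|x - y| = x - y by move=> ?; rewrite ger0_norm ?subr_ge0.
rewrite maxEle minEle; case: (leP a c) => [ac|/ltW ac]; case: (leP b e) => [be|/ltW be];
  rewrite ?(le_dist _ _ ac) ?(ge_dist _ _ ac) ?(le_dist _ _ be) ?(ge_dist _ _ be);
  case: (leP b c) => [bc|/ltW bc]; rewrite ?(le_dist _ _ bc) ?(ge_dist _ _ bc);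
  case: (leP a e) => [ae|/ltW ae]; rewrite ?(le_dist _ _ ae) ?(ge_dist _ _ ae);
  rewrite /=; try (case: ltP => ?); lra.
Qed.

(** Plancherel for intervals: by the Fejer integral the left-hand side is the
    length of the overlap. The imaginary part vanishes since its integrand is odd. *)
Lemma ihat_gram p q :
  cint leb (fun xi => ihat p xi * (ihat q xi)^* ) = cint leb (fun x => ivl p x * (ivl q x)^* ).
Proof.
case: p q => a b [c e].
have zero : (b <= a) || (e <= c) -> cint leb (fun xi => ihat (a, b) xi * (ihat (c, e) xi)^* ) = cint leb (fun x => ivl (a, b) x * (ivl (c, e) x)^* ).
  move=> h; apply: eq_cint => x; case/orP: h => h.
    rewrite ihat0// /ivl set_itv_ge ?bnd_simp ?indic0 ?mul0r// -leNgt//.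
  rewrite (ihat0 (p := (c, e)))// [ivl (c, e)]/ivl set_itv_ge ?bnd_simp ?indic0 -?leNgt//.
  have cj (z w : R[i]) : w = 0 -> z * w^* = 0 by move=> ->; rewrite conjC0 mulr0.
  by rewrite !cj.
have [ba|ab] := leP b a; first by apply: zero; rewrite ba.
have [ec|ce] := leP e c; first by apply: zero; rewrite ec orbT.
have p0 : 0 < pi :> R by exact: pi_gt0.
have Lh := L2_mul (ihat_L2 (a, b)) (ihat_L2 (c, e)).
have vi := versine_integrable.
have vi2 := integrableRD (vi (b - c)) (vi (a - e)).
have vi3 := integrableRB vi2 (vi (b - e)).
have vi4 := integrableRB vi3 (vi (a - c)).
rewrite /cint; congr (_ +i* _).
  have [] := @Rintegral_ae (fun x => re (ihat (a, b) x * (ihat (c, e) x)^* )) (fun x => inv_sqrt_2pi ^+ 2 *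
    (versine (b - c) x + versine (a - e) x - versine (b - e) x - versine (a - c) x)).
  - exact: integrableR_meas Lh.1.
  - exact: integrableRZ.
  - by move=> x x0; exact: ihat_mul_re.
  move=> _ ->.
  rewrite RintegralZl// RintegralB// RintegralB// RintegralD// !Rintegral_versine inv_sqrt_2pi_sq.
  rewrite [RHS](_ : _ = Rintegral leb `]Num.max a c, Num.min b e] (fun=> 1)); last first.
    rewrite [RHS]Rintegral_mkcond; apply: eq_Rintegral => x _.
    rewrite patchE /ivl/= !indicE oppr0 mulr0 subr0.
    have -> : (x \in `]Num.max a c, Num.min b e]%classic) = (x \in `]a, b]%classic) && (x \in `]c, e]%classic).
      rewrite !mem_setE !in_itv/= gt_max le_min.
      by case: (a < x); case: (c < x); case: (x <= b); case: (x <= e).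
    by do 2 case: (_ \in _); rewrite ?mulr1 ?mulr0 ?mul0r.
  rewrite Rintegral_cst// mul1r.
  have := @lebesgue_measure_itv R `]Num.max a c, Num.min b e]; rewrite /= lte_fin => ->.
  have -> : (2 * pi)^-1 * (pi * `|b - c| + pi * `|a - e| - pi * `|b - e| - pi * `|a - c|)
    = (`|b - c| + `|a - e| - `|b - e| - `|a - c|) / 2.
    have pn : pi != 0 :> R by rewrite gt_eqF.
    transitivity ((pi^-1 * pi) * ((`|b - c| + `|a - e| - `|b - e| - `|a - c|) / 2)).
      by rewrite invfM; ring.
    by rewrite mulVf// mul1r.
  rewrite (fun_if fine) /=.
  exact: overlap_length.
rewrite Rintegral_odd; first last.
- by move=> x; exact: ihat_mul_im.
- exact: Lh.2.
rewrite (_ : (fun _ => _) = fun=> 0) ?Rintegral_cst ?mul0r//.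
by apply/funext => x; rewrite /= oppr0 mulr0 mul0r addr0.
Qed.

End interval_transform.

(** * Transforms of boxes *)

Section integration_on_Rn.
Local Open Scope complex_scope.
Variable R : realType.
Local Notation leb := (@lebesgue_measure R).
Local Notation mR := (measurableTypeR R).
Local Notation mu n := (lebesgue_Rn R n).

Definition tl n (x : Rn R n.+1) : Rn R n := [tuple of behead x].

Lemma thead_cons n (p : mR * Rn R n) : thead (cons_Rn p) = p.1.
Proof. by []. Qed.

Lemma tl_cons n (p : mR * Rn R n) : tl (cons_Rn p) = p.2.
Proof. by apply/val_inj. Qed.

Lemma measurable_thead n : measurable_fun [set: Rn R n.+1] (fun x : Rn R n.+1 => thead x : mR).
Proof. exact: measurable_tnth. Qed.

Lemma measurable_tl n : measurable_fun [set: Rn R n.+1] (@tl n).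
Proof. exact: measurable_behead. Qed.

Lemma L1_succ n (f : Rn R n.+1 -> R[i]) : cmeas f ->
  L1 (leb \x mu n)%E (fun z => f (cons_Rn z)) ->
  L1 (mu n.+1) f /\ cint (mu n.+1) f = cint (leb \x mu n)%E (fun z => f (cons_Rn z)).
Proof.
move=> [rf jf] [ri ji].
have int (g : Rn R n.+1 -> R) : measurable_fun setT g ->
  (leb \x mu n)%E.-integrable setT (EFin \o (fun z => g (cons_Rn z))) ->
  (mu n.+1).-integrable setT (EFin \o g) /\
  Rintegral (mu n.+1) setT g = Rintegral (leb \x mu n)%E setT (fun z => g (cons_Rn z)).
  move=> mg gi.
  have mg' : measurable_fun setT (EFin \o g) by exact/measurable_EFinP.
  split.
    have := @integrable_pushforward _ _ (mR * Rn R n)%type (Rn R n.+1) R (@cons_Rn R n)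
      (@measurable_cons_Rn R n) (leb \x mu n)%E setT (EFin \o g) mg' gi measurableT.
    by [].
  rewrite /Rintegral; congr fine.
  have := @integral_pushforward _ _ (mR * Rn R n)%type (Rn R n.+1) R (@cons_Rn R n)
    (@measurable_cons_Rn R n) (leb \x mu n)%E setT (EFin \o g) mg' gi measurableT.
  by rewrite preimage_setT.
have [r1 r2] := int _ rf ri; have [j1 j2] := int _ jf ji.
by split; [split|rewrite /cint r2 j2].
Qed.

Lemma integral_Rn0 (c : \bar R) : (\int[mu 0]_x c = c)%E.
Proof.
have := @integral_dirac _ (Rn R 0) [tuple] R setT measurableT (cst c) (@measurable_cst _ _ _ _ _ c).
by rewrite /= diracT mul1e.
Qed.

Lemma cint_Rn0 (c : R[i]) : L1 (mu 0) (fun=> c) /\ cint (mu 0) (fun=> c) = c.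
Proof.
have i0 (r : R) : (mu 0).-integrable setT (EFin \o cst r).
  apply/integrableP; split; first exact: (measurable_cst (r%:E)).
  exact: (eq_ind_r (fun z => z < +oo)%E (ltry _) (integral_Rn0 `|r%:E|%E)).
have r0 (r : R) : Rintegral (mu 0) setT (fun=> r) = r.
  exact: (congr1 fine (integral_Rn0 r%:E)).
by split; [split; exact: i0|rewrite /cint !r0; case: (c)].
Qed.

(** Indexed by nat rather than by ordinals, so that peeling off one coordinate is
    a shift of the family. *)
Fixpoint tens n (f : nat -> mR -> R[i]) : Rn R n -> R[i] :=
  if n is m.+1 then fun x => f 0%N (thead x) * tens (fun i => f i.+1) (tl x)
  else fun=> 1.

Lemma cmeas_tens n (f : nat -> mR -> R[i]) : (forall i, cmeas (f i)) -> cmeas (@tens n f).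
Proof.
elim: n f => [|n IH] f mf; first by split.
apply: cmeasM.
  split; [apply: (measurableT_comp (mf 0%N).1); exact: measurable_thead|].
  by apply: (measurableT_comp (mf 0%N).2); exact: measurable_thead.
have [m1 m2] := IH (fun i => f i.+1) (fun i => mf i.+1).
split; [apply: (measurableT_comp m1); exact: measurable_tl|].
by apply: (measurableT_comp m2); exact: measurable_tl.
Qed.

Lemma tens_L1 n (f : nat -> mR -> R[i]) : (forall i, L1 leb (f i)) ->
  L1 (mu n) (@tens n f) /\ cint (mu n) (@tens n f) = \prod_(i < n) cint leb (f i).
Proof.
elim: n f => [|n IH] f Lf.
  by rewrite big_ord0; exact: cint_Rn0.
have [L2' c2] := IH (fun i => f i.+1) (fun i => Lf i.+1).
have L := L1_tensor (Lf 0%N) L2'.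
have eqf : (fun z => @tens n.+1 f (cons_Rn z)) = (fun z : mR * Rn R n => f 0%N z.1 * tens (fun i => f i.+1) z.2).
  by apply/funext => z; rewrite /= thead_cons tl_cons.
have [] := @L1_succ n (@tens n.+1 f).
- by apply: cmeas_tens => i; exact: L1_meas (Lf i).
- by rewrite eqf.
move=> L3 c3; split => //.
by rewrite c3 eqf cint_tensor// c2 big_ord_recl.
Qed.

Lemma tensM n (f g : nat -> mR -> R[i]) x :
  @tens n f x * tens g x = tens (fun i y => f i y * g i y) x.
Proof.
elim: n f g x => [|n IH] f g x /=; first by rewrite mulr1.
by rewrite mulrACA IH.
Qed.

Lemma tens_conj n (f : nat -> mR -> R[i]) x : ((@tens n f x)^*)%R = tens (fun i y => ((f i y)^*)%R) x.
Proof.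
elim: n f x => [|n IH] f x /=; first exact: conjC1.
by rewrite rmorphM/= IH.
Qed.

Lemma dotS n (x y : Rn R n.+1) : dot x y = thead x * thead y + dot (tl x) (tl y).
Proof.
rewrite /dot big_ord_recl; congr (_ + _); apply: eq_bigr => i _.
have e : lift ord0 i = inord i.+1 by apply/val_inj; rewrite /= inordK// ltnS.
by rewrite e /tl -!tnth_behead.
Qed.

Lemma measurable_dot n : measurable_fun setT (fun z : Rn R n * Rn R n => dot z.1 z.2).
Proof.
rewrite /dot; apply: measurable_sum => i; apply: measurable_funM.
  by apply: (measurableT_comp (measurable_tnth i)).
by apply: (measurableT_comp (measurable_tnth i)).
Qed.

Definition fchar n (x xi : Rn R n) : R[i] := echar (dot x xi).

Lemma fourier_intE n (f : Rn R n -> R[i]) xi :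
  fourier_int f xi = (inv_sqrt_2pi R ^+ n)%:C * cint (mu n) (fun x => fchar x xi * f x).
Proof.
rewrite /fourier_int /inv_sqrt_2pi -powR_mulrn ?powR_ge0// -powRrM mulNr [2^-1 * _]mulrC.
by [].
Qed.

Lemma cmeas_fchar_mul n (f : Rn R n -> R[i]) : cmeas f ->
  cmeas (fun z : Rn R n * Rn R n => fchar z.1 z.2 * f z.1).
Proof.
move=> mf; apply: cmeasM; first by apply: cmeas_echar; exact: measurable_dot.
exact: (@cmeas_fst _ _ (Rn R n) (Rn R n) R f).
Qed.

Lemma cmeas_fourier_int n (f : Rn R n -> R[i]) : cmeas f -> cmeas (fourier_int f).
Proof.
move=> mf; rewrite (_ : fourier_int f = (fun xi => (inv_sqrt_2pi R ^+ n)%:C * cint (mu n) (fun x => fchar x xi * f x))).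
  apply: cmeasM; first exact: cmeas_cst.
  exact: (@cmeas_cint _ _ (Rn R n) (Rn R n) R (mu n) _ (cmeas_fchar_mul mf)).
by apply/funext => xi; rewrite fourier_intE.
Qed.

Lemma fchar_L1 n (f : Rn R n -> R[i]) xi : L1 (mu n) f -> L1 (mu n) (fun x => fchar x xi * f x).
Proof.
move=> Lf; apply: (@L1_bounded_mul _ _ _ _ _ _ 1) => //; last by move=> x; rewrite sqn_echar.
apply: cmeas_echar.
have := @measurable_dot n; move=> /(_ measurableT) _.
rewrite /dot; apply: measurable_sum => i; apply: measurable_funM; last by [].
exact: measurable_tnth.
Qed.

Definition box n (I : nat -> R * R) : Rn R n -> R[i] := @tens n (fun i => ivl (I i)).
Definition boxhat n (I : nat -> R * R) : Rn R n -> R[i] := @tens n (fun i => ihat (I i)).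

Lemma fourier_int_box n I : fourier_int (@box n I) = @boxhat n I.
Proof.
apply/funext => xi; rewrite fourier_intE /box /boxhat.
elim: n I xi => [|n IH] I xi.
  rewrite expr0 mul1r /= (_ : (fun _ => _) = fun=> 1); last first.
    by apply/funext => x; rewrite /fchar /dot big_ord0 echar0 mulr1.
  exact: (cint_Rn0 1).2.
pose g0 x := echar (x * thead xi) * ivl (I 0%N) x.
pose g1 (x : Rn R n) := fchar x (tl xi) * tens (fun i => ivl (I i.+1)) x.
have mt : cmeas (fun x => fchar x xi * @tens n.+1 (fun i => ivl (I i)) x).
  apply: L1_meas; apply: fchar_L1.
  by apply: (tens_L1 _ _).1 => i; exact: ivl_L1.
have eqf : (fun z : mR * Rn R n => fchar (cons_Rn z) xi * @tens n.+1 (fun i => ivl (I i)) (cons_Rn z))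
   = (fun z => g0 z.1 * g1 z.2).
  apply/funext => z; rewrite /= thead_cons tl_cons /fchar dotS thead_cons tl_cons echarD.
  by rewrite /g0 /g1 mulrACA.
have L0 : L1 leb g0.
  apply: (@L1_bounded_mul _ _ _ _ _ _ 1); last exact: ivl_L1.
  - by apply: cmeas_echar; exact: measurable_funM.
  - by move=> x; rewrite sqn_echar.
have Lt : L1 (mu n) g1.
  by apply: fchar_L1; apply: (tens_L1 _ _).1 => i; exact: ivl_L1.
have [_ ->] := @L1_succ n _ mt (eq_ind_r (L1 _) (L1_tensor L0 Lt) eqf).
rewrite eqf cint_tensor//= -(IH (fun i => I i.+1)) exprS rmorphM/= /ihat -/g0 -/g1.
by rewrite mulrACA.
Qed.

Lemma ivl_mul_L1 p q : L1 leb (fun x => ivl p x * (ivl q x)^* ).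
Proof. by apply: L2_mul; exact: ivl_L2. Qed.

Lemma box_L1 n I : L1 (mu n) (@box n I).
Proof. by apply: (tens_L1 _ _).1 => i; exact: ivl_L1. Qed.

Lemma tens_L2 n (f : nat -> mR -> R[i]) : (forall i, L2 leb (f i)) -> L2 (mu n) (@tens n f).
Proof.
move=> Lf; split; first by apply: cmeas_tens => i; exact: (Lf i).1.
have [[h _] _] := @tens_L1 n (fun i y => f i y * (f i y)^* ) (fun i => L2_mul (Lf i) (Lf i)).
rewrite (_ : _ \o _ = EFin \o (fun x => re (@tens n (fun i y => f i y * (f i y)^* ) x)))//.
apply/funext => x /=; rewrite -tensM -tens_conj.
by case: (tens f x) => a b; rewrite /sqn /=; congr EFin; ring.
Qed.

Lemma box_L2 n I : L2 (mu n) (@box n I).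
Proof. by apply: tens_L2 => i; exact: ivl_L2. Qed.

Lemma boxhat_L2 n I : L2 (mu n) (@boxhat n I).
Proof. by apply: tens_L2 => i; exact: ihat_L2. Qed.

Lemma box_gram n I J :
  cint (mu n) (fun xi => @boxhat n I xi * (@boxhat n J xi)^* ) =
  cint (mu n) (fun x => @box n I x * (@box n J x)^* ).
Proof.
have e (h : nat -> mR -> R[i]) (k : nat -> mR -> R[i]) :
  (fun x => @tens n h x * (@tens n k x)^* ) = @tens n (fun i y => h i y * (k i y)^* ).
  by apply/funext => x; rewrite -tensM -tens_conj.
rewrite /box /boxhat !e.
rewrite (tens_L1 _ (fun i => L2_mul (ihat_L2 (I i)) (ihat_L2 (J i)))).2.
rewrite (tens_L1 _ (fun i => ivl_mul_L1 (I i) (J i))).2.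
by apply: eq_bigr => i _; exact: ihat_gram.
Qed.

End integration_on_Rn.

(** * Boxes determine measures and null functions *)

Section boxes.
Local Open Scope complex_scope.
Variables (R : realType) (n : nat).
Local Notation leb := (@lebesgue_measure R).
Local Notation mR := (measurableTypeR R).
Local Notation mu := (lebesgue_Rn R n).

Definition bset (I : nat -> R * R) : set (Rn R n) :=
  [set x | forall i : 'I_n, (I i).1 < (tnth x i : R) <= (I i).2].

Lemma bsetI I J : bset I `&` bset J =
  bset (fun i => (Num.max (I i).1 (J i).1, Num.min (I i).2 (J i).2)).
Proof.
apply/seteqP; split => x.
  by move=> [xI xJ] i; have := xI i; have := xJ i; rewrite /= gt_max le_min => /andP[-> ->] /andP[-> ->].
by move=> xIJ; split => i; have := xIJ i; rewrite /= gt_max le_min => /andP[/andP[? ?] /andP[? ?]]; apply/andP.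
Qed.

Lemma bset_measurable I : measurable (bset I).
Proof.
rewrite (_ : bset I = \bigcap_(i in [set: 'I_n]) ((fun x : Rn R n => tnth x i : mR) @^-1` `](I i).1, (I i).2]%classic)).
  apply: fin_bigcap_measurable => // i _.
  by rewrite -[X in measurable X]setTI; apply: measurable_tnth.
apply/seteqP; split => x h i; first by move=> _; rewrite /= in_itv/=; exact: h.
by have := h i Logic.I; rewrite /= in_itv.
Qed.

Definition cube (k : nat) : nat -> R * R := fun=> (- k%:R, k%:R).

Lemma cube_cover (x : Rn R n) : exists k, forall m, (k <= m)%N -> bset (cube m) x.
Proof.
have [k kP] : exists k : nat, forall i : 'I_n, `|(tnth x i : R)| < k%:R.
  exists (\max_(i < n) (Num.truncn `|(tnth x i : R)|).+1)%N => i.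
  apply: lt_le_trans (truncnS_gt _) _; rewrite ler_nat.
  exact: (@leq_bigmax _ (fun i : 'I_n => (Num.truncn `|(tnth x i : R)|).+1)).
exists k => m km i; have := kP i; rewrite /= ltr_norml => /andP[h1 h2].
have : (k%:R : R) <= m%:R by rewrite ler_nat.
by move=> h3; apply/andP; split; lra.
Qed.

(** Slabs orthogonal to a coordinate axis are countable unions of boxes. *)
Lemma measurable_bset_gen : @measurable _ (Rn R n) = <<s range bset >>.
Proof.
apply/seteqP; split; last first.
  apply: smallest_sub; first exact: sigma_algebra_measurable.
  by move=> _ [I _ <-]; exact: bset_measurable.
apply: smallest_sub; first exact: smallest_sigma_algebra.
pose T' := g_sigma_algebraType (range bset).
have mt (i : 'I_n) : measurable_fun [set: T'] (fun x : T' => (tnth (x : Rn R n) i : mR)).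
  apply: (@measurability _ _ T' mR setT _ (@ocitv R)) => //.
  move=> _ [_ [[a b] _ <-] <-]; rewrite setTI.
  rewrite (_ : _ @^-1` _ = \bigcup_k (bset (fun j => if j == i then (a, b) else cube k j))); last first.
    apply/seteqP; split => x.
      rewrite /= in_itv/= => xi; have [k kP] := cube_cover x.
      exists k => // j; case: (eqVneq (j : nat) i) => [ji|_]; last exact: kP.
      by rewrite /= (_ : j = i)//; exact/val_inj.
    by move=> [k _] /(_ i); rewrite eqxx/= in_itv.
  apply: (@bigcupT_measurable _ T') => k.
  by apply: sub_gen_smallest; exists (fun j : nat => if j == i then (a, b) else cube k j).
have : (\big[setU/set0]_(i < n) preimage_set_system setT (fun x : Rn R n => tnth x i : mR) measurable) `<=` <<s range bset >>.
  elim/big_ind: _ => // [A B hA hB C [|]|i _ _ [B mB <-]]; [exact: hA|exact: hB|].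
  exact: (mt i measurableT B mB).
exact.
Qed.

Lemma box_indic I (x : Rn R n) : box I x = (\1_(bset I) x)%:C.
Proof.
rewrite /bset /box; elim: n I x => [|m IH] I x /=.
  by rewrite indicE mem_set ?rmorph1//; case.
rewrite (IH (fun i => I i.+1)) /ivl -rmorphM; congr (_%:C); rewrite !indicE.
rewrite -natrM mulnb; congr (_ %:R); congr nat_of_bool.
apply/andP/idP.
  rewrite !inE/= in_itv/= => -[h0 h] i.
  case: (unliftP ord0 i) => [j ->|-> //].
  have := h j; rewrite /tl tnth_behead.
  by rewrite (_ : inord j.+1 = lift ord0 j)//; apply/val_inj; rewrite /= inordK// ltnS.
rewrite !inE/= in_itv/= => h; split; first exact: (h ord0).
move=> j; have := h (lift ord0 j); rewrite /tl tnth_behead.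
by rewrite (_ : inord j.+1 = lift ord0 j)//; apply/val_inj; rewrite /= inordK// ltnS.
Qed.

Lemma bset_finite I : (mu (bset I) < +oo)%E.
Proof.
have [h _] := @box_L1 R n I.
have := integrable_lty measurableT h.
suff -> : (\int[mu]_x (EFin \o (fun x => re (box I x))) x)%E = mu (bset I) by [].
transitivity (\int[mu]_x (\1_(bset I) x)%:E)%E.
  by apply: eq_integral => x _; rewrite /= box_indic.
by rewrite integral_indic ?setIT//; exact: bset_measurable.
Qed.

Lemma bset_setI_closed : setI_closed (range bset).
Proof.
move=> _ _ [I _ <-] [J _ <-]; rewrite bsetI.
by exists (fun i => (Num.max (I i).1 (J i).1, Num.min (I i).2 (J i).2)).
Qed.

Lemma bset_cube_cover : \bigcup_k (bset (cube k)) = setT.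
Proof.
rewrite -subTset => x _; have [k kP] := cube_cover x.
by exists k => //; exact: kP.
Qed.

Lemma Rn_measure_unique (nu : {measure set (Rn R n) -> \bar R}) :
  (forall I, mu (bset I) = nu (bset I)) -> forall A, measurable A -> mu A = nu A.
Proof.
move=> mn; apply: (measure_unique (range bset) (fun k => bset (cube k))).
- exact: measurable_bset_gen.
- exact: bset_setI_closed.
- by move=> k; exists (cube k).
- exact: bset_cube_cover.
- by move=> _ [I _ <-]; exact: mn.
- by move=> k; exact: bset_finite.
Qed.

(** A locally integrable function whose integrals over all boxes vanish is null:
    boxes form a pi-system that generates the measurable sets. *)
Lemma box_integral0 (g : Rn R n -> R) : measurable_fun setT g ->
  (forall I, mu.-integrable setT (EFin \o (fun x => g x * \1_(bset I) x))) ->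
  (forall I, Rintegral mu setT (fun x => g x * \1_(bset I) x) = 0) ->
  {ae mu, forall x, g x = 0}.
Proof.
move=> mg gi g0.
have ei (I : nat -> R * R) : (\int[mu]_x (g x * \1_(bset I) x)%:E = 0)%E.
  have h : (Rintegral mu setT (fun x => g x * \1_(bset I) x))%:E = 0%:E by rewrite g0.
  move: h; rewrite /Rintegral fineK//.
  by have := integrable_fin_num measurableT (gi I).
pose gk k x := g x * \1_(bset (cube k)) x.
have gk0 k : {ae mu, forall x, gk k x = 0}.
  have all A : measurable A -> (\int[mu]_(x in A) (gk k x)%:E = 0)%E.
    rewrite measurable_bset_gen; move: A.
    have gkA A : measurable A -> mu.-integrable A (EFin \o gk k).
      by move=> mA; apply: (integrableS measurableT mA _ (gi (cube k))).
    apply: dynkin_induction.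
    - exact: measurable_bset_gen.
    - exact: bset_setI_closed.
    - exact: ei.
    - move=> _ [I _ <-].
      rewrite integral_mkcond -[RHS](ei (fun i => (Num.max (cube k i).1 (I i).1, Num.min (cube k i).2 (I i).2))).
      apply: eq_integral => x _; rewrite -bsetI indicI /= /gk patchE mulrA !indicE.
      by case: ifP => _; rewrite ?mulr1 ?mulr0.
    - move=> S mS S0.
      have := ei (cube k); rewrite -/(gk k) -(setUv S) => h.
      have dS : [disjoint S & ~` S] by apply/disj_setPCl.
      rewrite integral_setU// in h; first by move: h; rewrite S0 add0e.
      - exact: measurableC.
      - apply/measurable_EFinP; apply: measurable_funTS.
        exact: integrableR_meas (gi (cube k)).
    - move=> F mF tF F0; rewrite integral_bigcup//.
        by rewrite eseries0// => i _ _; exact: F0.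
      by apply: gkA; exact: bigcup_measurable.
  have := @integral_ae_eq _ _ R mu setT measurableT (cst 0%E) (EFin \o gk k) (gi (cube k)) (measurable_cst _).
  move=> /(_ _)/wrap[|].
    by move=> E _ mE; rewrite all// integral0.
  by apply: filterS => x /(_ Logic.I) [].
have : {ae mu, forall x, forall k, gk k x = 0} by apply/ae_foralln.
apply: filterS => x h; have [k kP] := cube_cover x.
have := h k; rewrite /gk indicE mem_set ?mulr1//.
exact: kP.
Qed.
End boxes.

(** * The Fourier transform on square integrable functions *)

Section plancherel.
Local Open Scope complex_scope.
Variables (R : realType) (n : nat).
Local Notation mu := (lebesgue_Rn R n).
Local Notation cfun := (Rn R n -> R[i]).
Local Notation L2 := (L2 mu).
Local Notation L1 := (L1 mu).
Local Notation nrm := (nrm mu).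
Local Notation ip := (ip mu).
Local Notation F := (@fourier_int R n).

Definition conjf (u : cfun) : cfun := fun x => ((u x)^*)%R.

Lemma sqn_conj (z : R[i]) : sqn ((z^*)%R) = sqn z.
Proof. by case: z => a b; rewrite /sqn /= sqrrN. Qed.

Lemma L2_conj u : L2 u -> L2 (conjf u).
Proof.
move=> [mu_ iu]; split; first exact: cmeas_conj.
by move: iu; congr (integrable _ _ _); apply/funext => x /=; rewrite sqn_conj.
Qed.

Lemma ip_conj u v : ip (conjf u) (conjf v) = ip u v.
Proof.
apply: eq_Rintegral => x _; rewrite /conjf.
by case: (u x) (v x) => a b [a' b'] /=; rewrite mulrNN.
Qed.

(** Step functions as an inductive predicate: every property below is linear, so
    that it is proved by adding one box at a time. *)
Inductive stepf : cfun -> Prop :=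
| stepf0 : stepf (fun=> 0)
| stepfD c I w : stepf w -> stepf (fun x => c * box I x + w x).

Lemma L1_0 : L1 (fun=> 0).
Proof. by split; exact: integrable0. Qed.

Lemma L2_0 : L2 (fun=> 0).
Proof. exact: (lin0 (L2_lin mu)). Qed.

Lemma L2_comb (c : R[i]) u v : L2 u -> L2 v -> L2 (fun x => c * u x + v x).
Proof.
move=> Lu Lv; rewrite (_ : (fun _ => _) = c *: u + v); last exact/funext.
exact: ((L2_lin mu).2 c u v Lu Lv).
Qed.

Lemma L2_scal (c : R[i]) u : L2 u -> L2 (fun x => c * u x).
Proof.
move=> Lu; rewrite (_ : (fun _ => _) = c *: u); last exact/funext.
exact: (linZ (L2_lin mu) c Lu).
Qed.

Lemma stepf_L1 w : stepf w -> L1 w.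
Proof.
elim=> [|c I {}w _ IH]; first exact: L1_0.
by apply: L1D => //; apply: L1Z; exact: box_L1.
Qed.

Lemma stepf_L2 w : stepf w -> L2 w.
Proof.
elim=> [|c I {}w _ IH]; first exact: L2_0.
exact: (L2_comb c (box_L2 n I) IH).
Qed.

Lemma stepf_lin (c : R[i]) u v : stepf u -> stepf v -> stepf (c *: u + v).
Proof.
move=> + sv; elim=> [|c' I w _ IH].
  rewrite (_ : _ + _ = v)//; apply/funext => x.
  by rewrite -[(_ + _) x]/(c * 0 + v x) mulr0 add0r.
rewrite (_ : _ + _ = (fun x => c * c' * box I x + (c *: w + v) x)); first exact: stepfD.
apply/funext => x.
by rewrite -[LHS]/(c * (c' * box I x + w x) + v x) -[(_ *: _ + _) x]/(c * w x + v x) mulrDr mulrA addrA.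
Qed.

Lemma box_conj I (x : Rn R n) : ((box I x)^*)%R = box I x.
Proof. by rewrite box_indic; exact: conjc_real. Qed.

Lemma stepf_conj w : stepf w -> stepf (conjf w).
Proof.
elim=> [|c I {}w _ IH].
  by rewrite (_ : conjf _ = fun=> 0); [exact: stepf0|apply/funext => x; exact: conjC0].
rewrite (_ : conjf _ = (fun x => (c^*)%R * box I x + ((w x)^*)%R)); first exact: stepfD.
by apply/funext => x; rewrite /conjf rmorphD rmorphM/= box_conj.
Qed.

Lemma fourier_int_lin (c : R[i]) u v : L1 u -> L1 v ->
  F (fun x => c * u x + v x) = (fun xi => c * F u xi + F v xi).
Proof.
move=> Lu Lv; apply/funext => xi; rewrite !fourier_intE.
have := fchar_L1 xi Lu; have := fchar_L1 xi Lv => h2 h1.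
rewrite mulrCA -mulrDr; congr (_ * _).
rewrite -(cintZ c h1) -(cintD (L1Z c h1) h2).
by apply: eq_cint => x; rewrite mulrDr mulrCA.
Qed.

Lemma fourier_int0 : F (fun=> 0) = fun=> 0.
Proof.
apply/funext => xi; rewrite fourier_intE (_ : (fun _ => _) = fun=> 0).
  by rewrite /cint !Rintegral_cst// !mul0r mulr0.
by apply/funext => x; rewrite mulr0.
Qed.

Lemma stepf_hat_L2 w : stepf w -> L2 (F w).
Proof.
elim=> [|c I {}w sw IH]; first by rewrite fourier_int0; exact: L2_0.
rewrite fourier_int_lin; [|exact: box_L1|exact: stepf_L1].
rewrite fourier_int_box.
exact: (L2_comb c (boxhat_L2 n I) IH).
Qed.

Lemma ip_scale (c c' : R[i]) u v : L2 u -> L2 v ->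
  ip (fun x => c * u x) (fun x => c' * v x) = re (c * (c'^*)%R * cint mu (fun x => u x * ((v x)^*)%R)).
Proof.
move=> Lu Lv; rewrite ip_cint -cintZ; last exact: L2_mul.
by congr (re _); apply: eq_cint => x; rewrite rmorphM mulrACA.
Qed.

(** The transform preserves inner products of step functions because it does so
    for boxes, hence coordinate by coordinate for intervals. *)
Lemma stepf_isometry u v : stepf u -> stepf v -> ip (F u) (F v) = ip u v.
Proof.
have fm := ip_form mu.
have Dl a b w : L2 a -> L2 b -> L2 w -> ip (fun x => a x + b x) w = ip a w + ip b w.
  by move=> La Lb Lw; exact: (pf_D fm).
have Dr a b w : L2 a -> L2 b -> L2 w -> ip w (fun x => a x + b x) = ip w a + ip w b.
  by move=> La Lb Lw; exact: (pf_Dr fm).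
have Z0 w : ip (fun=> 0) w = 0 /\ ip w (fun=> 0) = 0.
  split; rewrite /ip (_ : (fun _ => _) = fun=> 0) ?Rintegral_cst ?mul0r//;
    by apply/funext => x; rewrite /= ?mul0r ?mulr0 ?addr0.
have LZ (c : R[i]) w : L2 w -> L2 (fun x => c * w x) by exact: L2_scal.
have Fst c I w : stepf w -> F (fun x => c * box I x + w x) = fun xi => c * boxhat I xi + F w xi.
  move=> sw; rewrite fourier_int_lin ?fourier_int_box//; [exact: box_L1|exact: stepf_L1].
move=> su sv; elim: su => [|c I w sw IH].
  by rewrite fourier_int0 (Z0 _).1 (Z0 _).1.
have Lw := stepf_L2 sw; have LFw := stepf_hat_L2 sw.
have Lv := stepf_L2 sv; have LFv := stepf_hat_L2 sv.
have Lb := LZ c _ (box_L2 n I); have Lbh := LZ c _ (boxhat_L2 n I).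
rewrite Fst// (Dl _ _ _ Lbh LFw LFv) (Dl _ _ _ Lb Lw Lv) IH; congr (_ + _).
elim: sv {Lv LFv IH} => [|c' J w' sw' IH].
  by rewrite fourier_int0 (Z0 _).2 (Z0 _).2.
have Lw' := stepf_L2 sw'; have LFw' := stepf_hat_L2 sw'.
have Lb' := LZ c' _ (box_L2 n J); have Lbh' := LZ c' _ (boxhat_L2 n J).
rewrite Fst// (Dr _ _ _ Lbh' LFw' Lbh) (Dr _ _ _ Lb' Lw' Lb) IH; congr (_ + _).
by rewrite (ip_scale _ _ (boxhat_L2 n I) (boxhat_L2 n J)) (ip_scale _ _ (box_L2 n I) (box_L2 n J)) box_gram.
Qed.

Lemma stepf_box (c : R[i]) I : stepf (fun x => c * box I x).
Proof.
have := stepfD c I stepf0; congr stepf; apply/funext => x; exact: addr0.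
Qed.

(** Tested with real and imaginary multiples of boxes, to reach both parts of f
    through a form that only sees real parts. *)
Lemma stepf_total f : L2 f -> (forall m, stepf m -> ip f m = 0) -> nrm f = 0.
Proof.
move=> Lf f0.
have part (c : R[i]) (p : R[i] -> R) :
    (forall z (r : R), re z * re (c * r%:C) + im z * im (c * r%:C) = p z * r) ->
    measurable_fun setT (fun x => p (f x)) -> {ae mu, forall x, p (f x) = 0}.
  move=> cp mp; apply: box_integral0 => // I.
    have := ip_integrable Lf (stepf_L2 (stepf_box c I)).
    by congr (integrable _ _ _); apply/funext => x; rewrite /= box_indic cp.
  rewrite -[RHS](f0 _ (stepf_box c I)); apply: eq_Rintegral => x _.
  by rewrite box_indic cp.
have r0 : {ae mu, forall x, re (f x) = 0}.
  apply: (part 1); last exact: Lf.1.1.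
  by move=> [a b] r; rewrite mul1r /= mulr0 addr0.
have i0 : {ae mu, forall x, im (f x) = 0}.
  apply: (part 'i); last exact: Lf.1.2.
  by move=> [a b] r; rewrite /=; ring.
have z0 : {ae mu, forall x, 0 = f x}.
  by apply: filterS2 r0 i0 => x; case: (f x) => a b /= -> ->.
have [_ h] := ae_L2_nrm Lf (cmeas_cst (Rn R n) (0 : R[i])) z0.
have e : (fun=> 0) - f = - f :> cfun by apply/funext => x; exact: sub0r.
by rewrite e (snN (nrm_seminorm mu)) in h.
Qed.

Lemma stepf_dense f e : L2 f -> 0 < e -> exists2 m, stepf m & nrm (f - m) < e.
Proof.
move=> Lf e0; apply: (total_dense (ip_form mu) (@L2_complete _ _ R mu) (M := stepf)) => //.
- exact: stepf_L2.
- exact: stepf0.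
- by move=> a u v su sv; exact: stepf_lin.
- exact: stepf_total.
Qed.

(** Fubini, the kernel being symmetric. *)
Lemma fchar_mul_L1 (f g : cfun) : L1 f -> L1 g ->
  cint mu (fun xi => cint mu (fun x => fchar x xi * f x) * g xi) =
  cint mu (fun x => f x * cint mu (fun xi => fchar x xi * g xi)).
Proof.
move=> Lf Lg.
pose H (z : Rn R n * Rn R n) := fchar z.1 z.2 * (f z.1 * g z.2).
have mE : cmeas (fun z : Rn R n * Rn R n => fchar z.1 z.2).
  by apply: cmeas_echar; exact: measurable_dot.
have LH := L1_bounded_mul mE (fun z => eq_ind_r (fun c => c <= 1) (lexx _) (sqn_echar _))
  (L1_tensor Lf Lg).
have fcC x xi : fchar x xi = fchar xi x.
  by rewrite /fchar; congr echar; apply: eq_bigr => i _; rewrite mulrC.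
have H1 x : L1 (fun y => H (x, y)).
  rewrite (_ : (fun _ => _) = fun xi => f x * (fchar xi x * g xi)).
    by apply: L1Z; exact: fchar_L1.
  by apply/funext => xi; rewrite /H /= fcC mulrCA.
have H2 y : L1 (fun x => H (x, y)).
  rewrite (_ : (fun _ => _) = fun x => g y * (fchar x y * f x)).
    by apply: L1Z; exact: fchar_L1.
  by apply/funext => xi; rewrite /H /= [f xi * _]mulrC mulrCA.
have [e1 e2] := cfubini LH H1 H2.
transitivity (cint mu (fun y => cint mu (fun x => H (x, y)))).
  apply: eq_cint => xi; rewrite mulrC -(cintZ (g xi) (fchar_L1 xi Lf)).
  by apply: eq_cint => x; rewrite /H /= [f x * _]mulrC mulrCA.
rewrite e2 -e1; apply: eq_cint => x.
have := fchar_L1 x Lg => h.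
rewrite (_ : (fun xi => fchar x xi * g xi) = (fun xi => fchar xi x * g xi)).
  rewrite -(cintZ (f x) h).
  by apply: eq_cint => xi; rewrite /H /= fcC mulrCA.
by apply/funext => xi; rewrite fcC.
Qed.

(** The inverse transform of w. *)
Definition cofourier (w : cfun) : cfun := conjf (F (conjf w)).

Lemma fourier_int_adjoint f w : L1 f -> L2 f -> L2 (F f) -> stepf w ->
  ip (F f) w = ip f (cofourier w).
Proof.
move=> Lf L2f L2Ff sw; have scw := stepf_conj sw.
have Lcw := stepf_L1 scw; have L2Fcw := stepf_hat_L2 scw.
have k0 : (inv_sqrt_2pi R ^+ n)%:C != 0 by rewrite fmorph_eq0 expf_neq0// gt_eqF// powR_gt0// mulr_gt0// pi_gt0.
have unk (v a b : cfun) : (forall x, v x = (inv_sqrt_2pi R ^+ n)%:C * (a x * b x)) -> L1 v ->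
    cint mu v = (inv_sqrt_2pi R ^+ n)%:C * cint mu (fun x => a x * b x).
  move=> va Lv; rewrite -cintZ; first exact: eq_cint.
  have := L1Z (inv_sqrt_2pi R ^+ n)%:C^-1 Lv; congr L1; apply/funext => x.
  by rewrite va mulKf.
rewrite !ip_cint; congr (re _).
rewrite (unk (fun xi => F f xi * ((w xi)^*)%R) (fun xi => cint mu (fun x => fchar x xi * f x)) (fun x => ((w x)^*)%R)).
- rewrite (unk (fun x => f x * ((cofourier w x)^*)%R) f (fun x => cint mu (fun xi => fchar xi x * ((w xi)^*)%R))).
  + congr (_ * _); rewrite (fchar_mul_L1 Lf Lcw); apply: eq_cint => x; congr (_ * _).
    apply: eq_cint => y; congr (_ * _); rewrite /fchar; congr echar.
    by apply: eq_bigr => i _; rewrite mulrC.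
  + by move=> x; rewrite /cofourier /conjf conjCK fourier_intE mulrCA.
  + exact: L2_mul L2f (L2_conj L2Fcw).
- by move=> xi; rewrite fourier_intE mulrA.
- exact: L2_mul L2Ff (stepf_L2 sw).
Qed.

Lemma small0 (x C : R) : 0 <= C -> (forall e, 0 < e -> `|x| <= C * e) -> x = 0.
Proof.
move=> C0 h; apply/eqP; rewrite -normr_le0; apply/ler_addgt0Pr => e e0; rewrite add0r.
have C1 : 0 < C + 1 by rewrite ltr_wpDl.
apply: le_trans (h (e / (C + 1)) (divr_gt0 e0 C1)) _.
by rewrite mulrCA ger_pMr// ler_pdivrMr// mul1r lerDl.
Qed.

Lemma L2_cLp u : L2 u <-> cLp 2%:E u.
Proof. exact: L2_Lnorm. Qed.

Local Notation cLn := (@cLnorm R n 2%:E).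

(** The sequences of the definition are traded for single approximants; transforms
    of the approximants are square integrable once they are close to v. *)
Lemma is_fourierP u v : is_fourier u v <->
  [/\ L2 u, L2 v & forall e, 0 < e -> exists f,
      [/\ L1 f, L2 f, L2 (F f), nrm (f - u) < e & nrm (F f - v) < e]].
Proof.
split=> [[/L2_cLp Lu /L2_cLp Lv [f [f12 fu Ffv]]]|[Lu Lv h]].
  split=> // e e0.
  have near_lt (g : nat -> cfun) w : (cLn (g k - w)%R @[k --> \oo] --> 0)%E ->
      \forall k \near \oo, (cLn (g k - w)%R < e%:E)%E.
    move=> gw; have := gw [set x | (x < e%:E)%E]; apply.
    by apply: open_nbhs_nbhs; split; [exact: open_ereal_lt_ereal|rewrite /= lte_fin].
  near \oo => k.
  have /L1_Lnorm L1k := (f12 k).1; have /L2_cLp L2k := (f12 k).2.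
  have k1 : (cLn (f k - u)%R < e%:E)%E by near: k; exact: near_lt.
  have k2 : (cLn (F (f k) - v)%R < e%:E)%E by near: k; exact: near_lt.
  have L2d : L2 (F (f k) - v).
    apply/L2_Lnorm; split; last exact: lt_trans k2 (ltry _).
    have := cmeasD (cmeas_fourier_int (L1_meas L1k)) (cmeasM (cmeas_cst _ (-1)) Lv.1).
    by congr cmeas; apply/funext => x; rewrite mulN1r.
  have L2F : L2 (F (f k)) by rewrite -[F _](subrK v); exact: L2D.
  exists (f k); split => //.
    by move: k1; rewrite /cLnorm Lnorm2_nrm ?lte_fin//; exact: L2B.
  by move: k2; rewrite /cLnorm Lnorm2_nrm ?lte_fin.
have /choice[f fP] : forall k : nat, exists f,
    [/\ L1 f, L2 f, L2 (F f), nrm (f - u) < k.+1%:R^-1 & nrm (F f - v) < k.+1%:R^-1].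
  by move=> k; apply: h.
have cvg0 (g : nat -> cfun) w : L2 w -> (forall k, L2 (g k)) ->
    (forall k, nrm (g k - w) < k.+1%:R^-1) -> (cLn (g k - w)%R @[k --> \oo] --> 0)%E.
  move=> Lw Lg gw; have Ld k : L2 (g k - w) by exact: L2B.
  under eq_fun do rewrite /cLnorm (Lnorm2_nrm (Ld _)).
  apply: cvg_EFin; first by apply: nearW.
  apply: (@squeeze_cvgr _ _ _ _ (cst 0) (fun k => k.+1%:R^-1)).
  - by apply: nearW => k; rewrite /= nrm_ge0 ltW.
  - exact: cvg_cst.
  - exact: cvg_harmonic.
split; [exact/L2_cLp|exact/L2_cLp|exists f; split].
- by move=> k; have [a b _ _ _] := fP k; split; [exact/L1_Lnorm|exact/L2_cLp].
- by apply: cvg0 => // k; have [] := fP k.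
- by apply: (cvg0 (fun k => F (f k))) => // k; have [] := fP k.
Unshelve. all: by end_near. Qed.

Lemma cofourier_L2 w : stepf w -> L2 (cofourier w).
Proof. by move=> sw; apply/L2_conj/stepf_hat_L2/stepf_conj. Qed.

Lemma is_fourier_L2 u v : is_fourier u v -> L2 u /\ L2 v.
Proof. by move=> /is_fourierP[]. Qed.

(** This relation determines v, since step functions are dense: uniqueness and
    surjectivity below are read off it. *)
Lemma is_fourier_adjoint u v w : is_fourier u v -> stepf w -> ip v w = ip u (cofourier w).
Proof.
move=> /is_fourierP[Lu Lv h] sw; have Lw := stepf_L2 sw; have Lcw := cofourier_L2 sw.
apply/eqP; rewrite -subr_eq0; apply/eqP.
apply: (@small0 _ (nrm w + nrm (cofourier w))) => [|e e0]; first by rewrite addr_ge0// nrm_ge0.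
have [f [L1f L2f L2Ff fu Fv]] := h e e0.
have e1 : ip (F f - v) w = ip (F f) w - ip v w by rewrite (pf_B (ip_form mu)).
have e2 : ip (f - u) (cofourier w) = ip f (cofourier w) - ip u (cofourier w) by rewrite (pf_B (ip_form mu)).
have -> : ip v w - ip u (cofourier w) = ip (f - u) (cofourier w) - ip (F f - v) w.
  by rewrite e1 e2 (fourier_int_adjoint L1f L2f L2Ff sw); ring.
apply: le_trans (ler_normB _ _) _.
have c1 := ip_CS (L2B L2f Lu) Lcw; have c2 := ip_CS (L2B L2Ff Lv) Lw.
have := ler_wpM2r (nrm_ge0 mu w) (ltW Fv); have := ler_wpM2r (nrm_ge0 mu (cofourier w)) (ltW fu).
lra.
Qed.

Lemma is_fourier_unique u v v' : is_fourier u v -> is_fourier u v' -> nrm (v - v') = 0.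
Proof.
move=> h h'; have [Lu Lv] := is_fourier_L2 h; have [_ Lv'] := is_fourier_L2 h'.
apply: stepf_total => [|w sw]; first exact: L2B.
rewrite (pf_B (ip_form mu))//; last exact: stepf_L2.
by rewrite (is_fourier_adjoint h sw) (is_fourier_adjoint h' sw) subrr.
Qed.

Lemma is_fourier_eq u v u' v' : is_fourier u v -> L2 u' -> L2 v' ->
  nrm (u - u') = 0 -> nrm (v - v') = 0 -> is_fourier u' v'.
Proof.
move=> /is_fourierP[Lu Lv h] Lu' Lv' uu vv; apply/is_fourierP; split=> // e e0.
have [f [L1f L2f L2Ff fu Fv]] := h e e0; exists f; split => //.
  by apply: le_lt_trans (sn_tri3 (nrm_seminorm mu) L2f Lu Lu') _; rewrite uu addr0.
by apply: le_lt_trans (sn_tri3 (nrm_seminorm mu) L2Ff Lv Lv') _; rewrite vv addr0.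
Qed.

Lemma pow4_small e : 0 < e -> exists k, 4^-1 ^+ k < e :> R.
Proof.
move=> e0; have : (4^-1 : R) ^+ k @[k --> \oo] --> 0.
  by apply: cvg_expr; rewrite ger0_norm ?invr_ge0// invf_lt1// ltr1n.
move=> /cvgrPdist_lt/(_ e e0)[k _ /(_ k (leqnn k))]/=.
by rewrite sub0r normrN ger0_norm ?exprn_ge0 ?invr_ge0// => h; exists k.
Qed.

(** The step functions approximating u have convergent transforms, by their
    isometry and the completeness of the space. *)
Lemma is_fourier_exists u : L2 u -> exists2 v, is_fourier u v & nrm v = nrm u.
Proof.
move=> Lu; have q0 k : 0 < (4^-1 : R) ^+ k by rewrite exprn_gt0// invr_gt0.
have /choice[m mP] : forall k : nat, exists m, stepf m /\ nrm (m - u) < 4^-1 ^+ k / 2.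
  move=> k; have [m sm um] := stepf_dense Lu (divr_gt0 (q0 k) (ltr0n R 2)).
  by exists m; split => //; rewrite (sn_distC (nrm_seminorm mu))//; exact: stepf_L2.
have sm k := (mP k).1; have Lm k := stepf_L2 (sm k).
have iso w w' : stepf w -> stepf w' -> nrm (F w - F w') = nrm (w - w').
  move=> sw sw'; rewrite /nrm /fnorm (pf_sqB (ip_form mu)) ?stepf_isometry//;
    try exact: stepf_hat_L2.
  by rewrite -(pf_sqB (ip_form mu))//; exact: stepf_L2.
have [v Lv Fv] : exists2 v, L2 v & forall k, nrm (F (m k) - v) <= 4 / 3 * 4^-1 ^+ k.
  apply: (complete_rate (nrm_seminorm mu) (@L2_complete _ _ R mu)) => k.
    exact: stepf_hat_L2.
  rewrite iso//; apply: le_trans (sn_tri3 (nrm_seminorm mu) (Lm _) Lu (Lm _)) _.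
  rewrite (sn_distC (nrm_seminorm mu) Lu)//.
  by have := (mP k).2; have := (mP k.+1).2; have := q0 k; rewrite exprS; lra.
exists v.
  apply/is_fourierP; split=> // e e0; have [k ke] := pow4_small (divr_gt0 e0 (ltr0n _ 2)).
  exists (m k); split => //; [exact: stepf_L1|exact: stepf_hat_L2| |].
    by have := (mP k).2; have := q0 k; lra.
  by have := Fv k; have := q0 k; lra.
apply/eqP; rewrite -subr_eq0; apply/eqP; apply: (@small0 _ 2) => // e e0.
have [k ke] := pow4_small e0.
have h1 := sn_le_sub (nrm_seminorm mu) Lv (stepf_hat_L2 (sm k)).
have h2 := sn_le_sub (nrm_seminorm mu) (stepf_hat_L2 (sm k)) Lv.
have h3 := sn_le_sub (nrm_seminorm mu) Lu (Lm k).
have h4 := sn_le_sub (nrm_seminorm mu) (Lm k) Lu.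
rewrite (sn_distC (nrm_seminorm mu) Lv (stepf_hat_L2 (sm k))) in h1.
rewrite (sn_distC (nrm_seminorm mu) Lu (Lm k)) in h3.
have h5 : nrm (F (m k)) = nrm (m k) by rewrite /nrm /fnorm stepf_isometry.
have := Fv k; have := (mP k).2; have := q0 k => ? ? ?.
rewrite ler_norml; apply/andP; split; lra.
Qed.

Lemma is_fourier_nrm u v : is_fourier u v -> nrm v = nrm u.
Proof.
move=> h; have [Lu Lv] := is_fourier_L2 h; have [v' h' <-] := is_fourier_exists Lu.
apply: (sn_eq (nrm_seminorm mu)) => //; first by have [] := is_fourier_L2 h'.
exact: is_fourier_unique h h'.
Qed.

Lemma is_fourier_lin (c : R[i]) (u v u' v' : cfun) : is_fourier u v -> is_fourier u' v' ->
  is_fourier (c *: u + u') (c *: v + v').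
Proof.
move=> /is_fourierP[Lu Lv h] /is_fourierP[Lu' Lv' h']; have lin := (L2_lin mu).2.
apply/is_fourierP; split=> [||e e0]; try exact: lin.
pose C := Normc.normc c + 1.
have C0 : 0 < C by rewrite ltr_wpDl// normc_ge0.
have [f [L1f L2f L2Ff fu Fv]] := h (e / C / 2) (divr_gt0 (divr_gt0 e0 C0) (ltr0n _ 2)).
have [f' [L1f' L2f' L2Ff' fu' Fv']] := h' (e / 2) (divr_gt0 e0 (ltr0n _ 2)).
have bound g g' w w' : L2 g -> L2 g' -> L2 w -> L2 w' -> nrm (g - w) < e / C / 2 ->
    nrm (g' - w') < e / 2 -> nrm (c *: g + g' - (c *: w + w')) < e.
  move=> Lg Lg' Lw Lw' gw gw'.
  have -> : c *: g + g' - (c *: w + w') = c *: (g - w) + (g' - w').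
    by rewrite scalerBr opprD addrACA.
  have Lc := L2Z c (L2B Lg Lw).
  apply: le_lt_trans (sn_tri (nrm_seminorm mu) Lc (L2B Lg' Lw')) _.
  rewrite (sn_hom (nrm_seminorm mu)); last exact: L2B.
  have : Normc.normc c * nrm (g - w) <= C * (e / C / 2).
    by apply: ler_pM; rewrite ?normc_ge0 ?nrm_ge0 ?lerDl// ltW.
  rewrite (_ : C * (e / C / 2) = e / 2); first by move=> h1; move: gw' h1; clear; lra.
  by rewrite mulrA mulrCA divff ?gt_eqF// mulr1.
have FE : F (c *: f + f') = c *: F f + F f' by exact: fourier_int_lin.
exists (c *: f + f'); rewrite FE; split; try exact: lin.
- exact: (L1D (L1Z c L1f) L1f').
- exact: bound.
- exact: bound.
Qed.

Lemma ip_polar u v u' v' : L2 u -> L2 v -> L2 u' -> L2 v' ->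
  nrm u = nrm v -> nrm u' = nrm v' -> nrm (u + u') = nrm (v + v') -> ip u u' = ip v v'.
Proof.
move=> Lu Lv Lu' Lv' e1 e2 e3.
have sq w : L2 w -> ip w w = nrm w ^+ 2 by move=> Lw; rewrite nrm_sq.
have h := pf_sqD (ip_form mu) Lu Lu'; have h' := pf_sqD (ip_form mu) Lv Lv'.
rewrite !sq ?e1 ?e2 ?e3 in h h'; try exact: L2D; try by [].
lra.
Qed.

Lemma is_fourier_ip u v u' v' : is_fourier u v -> is_fourier u' v' -> ip v v' = ip u u'.
Proof.
move=> h h'; have [Lu Lv] := is_fourier_L2 h; have [Lu' Lv'] := is_fourier_L2 h'.
apply: ip_polar => //; try exact: is_fourier_nrm.
have := is_fourier_lin 1 h h'; rewrite !scale1r; exact: is_fourier_nrm.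
Qed.

Lemma step_is_fourier w : stepf w -> is_fourier w (F w).
Proof.
move=> sw; have Lw := stepf_L2 sw; have LF := stepf_hat_L2 sw; apply/is_fourierP; split=> // e e0.
by exists w; rewrite !subrr (sn0 (nrm_seminorm mu)); split => //; exact: stepf_L1.
Qed.

(** Conjugating the transform of the conjugate inverts the transform. *)
Lemma is_fourier_surj v : L2 v -> exists u, is_fourier u v.
Proof.
move=> Lv; have [a ha _] := is_fourier_exists (L2_conj Lv); have [_ La] := is_fourier_L2 ha.
have [v' hv' _] := is_fourier_exists (L2_conj La); have [_ Lv'] := is_fourier_L2 hv'.
exists (conjf a); apply: (is_fourier_eq hv') => //; first exact: L2_conj.
  by rewrite subrr (sn0 (nrm_seminorm mu)).
apply: stepf_total => [|w sw]; first exact: L2B.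
rewrite (pf_B (ip_form mu))//; last exact: stepf_L2.
rewrite (is_fourier_adjoint hv' sw) /cofourier ip_conj.
rewrite (is_fourier_ip ha (step_is_fourier (stepf_conj sw))) ip_conj.
by rewrite subrr.
Qed.

Local Notation ft := (@fourier R n).
Local Notation ift := (@fourier_inv R n).

Lemma fourierP u : L2 u -> is_fourier u (ft u).
Proof. by move=> Lu; have [v h _] := is_fourier_exists Lu; exact: (xgetI 0 h). Qed.

Lemma fourier_invP v : L2 v -> is_fourier (ift v) v.
Proof. by move=> Lv; have [u h] := is_fourier_surj Lv; exact: (@xgetI _ 0 [set u | is_fourier u v] u h). Qed.

Lemma is_fourier_ae u v v' : is_fourier u v -> is_fourier u v' ->
  {ae mu, forall x, v x = v' x}.
Proof.
move=> h h'; have [Lu Lv] := is_fourier_L2 h; have [_ Lv'] := is_fourier_L2 h'.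
have := nrm_eq0 (L2B Lv Lv') (is_fourier_unique h h').
by apply: filterS => x /eqP; rewrite subr_eq0 => /eqP.
Qed.

End plancherel.

(** * Translations and characters *)

Section translation.
Local Open Scope complex_scope.
Variables (R : realType) (n : nat).
Local Notation leb := (@lebesgue_measure R).
Local Notation mR := (measurableTypeR R).
Local Notation mu := (lebesgue_Rn R n).
Local Notation cfun := (Rn R n -> R[i]).
Local Notation L2 := (L2 mu).
Local Notation L1 := (L1 mu).
Local Notation nrm := (nrm mu).
Local Notation F := (@fourier_int R n).

Definition shift (a x : Rn R n) : Rn R n := mktuple (fun i => tnth x i + tnth a i).

Lemma measurable_shift a : measurable_fun setT (shift a).
Proof.
apply/measurable_fun_tnthP => i.
rewrite (_ : _ \o _ = fun x : Rn R n => (tnth x i + tnth a i : mR)).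
  by apply: measurable_funD => //; exact: measurable_tnth.
by apply/funext => x /=; rewrite tnth_mktuple.
Qed.

Lemma dot_shift a x xi : dot x (shift a xi) = dot x xi + dot x a.
Proof. by rewrite /dot -big_split; apply: eq_bigr => i _; rewrite tnth_mktuple mulrDr. Qed.

(** The measure of a box is a product of interval lengths, which is all that
    translation invariance needs. *)
Lemma mu_bset I : mu (bset I) = (re (\prod_(i < n) cint leb (ivl (I i))))%:E.
Proof.
have [h e] := @tens_L1 R n (fun i => ivl (I i)) (fun i => ivl_L1 (I i)).
rewrite -e /= /Rintegral fineK; last exact: integrable_fin_num h.1.
transitivity (\int[mu]_x (\1_(bset I) x)%:E)%E.
  by rewrite integral_indic ?setIT//; exact: bset_measurable.
by apply: eq_integral => x _; rewrite -/(box I) box_indic.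
Qed.

Lemma cint_ivl p : cint leb (ivl p) = (fine (leb `]p.1, p.2]%classic))%:C.
Proof.
rewrite /cint /ivl; congr (_ +i* _).
  rewrite /Rintegral; congr fine.
  by rewrite (@integral_indic _ _ _ leb setT measurableT _ (measurable_itv _)) setIT.
by rewrite Rintegral_cst// mul0r.
Qed.

Lemma shift_measure a A : measurable A -> mu (shift a @^-1` A) = mu A.
Proof.
move=> mA; apply/esym.
have -> : mu (shift a @^-1` A) = pushforward mu (shift a) A by [].
apply: (Rn_measure_unique (nu := pushforward mu (shift a))) => [|? I|//]; first exact: measurable_shift.
pose J j : (R * R)%type := ((I j).1 - nth 0 a j, (I j).2 - nth 0 a j).
rewrite -[RHS]/(mu (shift a @^-1` bset I)) (_ : shift a @^-1` bset I = bset J).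
  rewrite !mu_bset; congr (re _)%:E; apply: eq_bigr => i _.
  rewrite !cint_ivl; congr (fine _)%:C.
  rewrite -(lebesgue_shift (- nth 0 a i)); last exact: measurable_itv.
  congr (leb _); apply/seteqP; split => x; rewrite /= !in_itv/=; lra.
apply/seteqP; split => x h i; have := h i; rewrite /J tnth_mktuple (tnth_nth 0 a)/=; lra.
Qed.

Lemma ge0_integral_shift a (f : Rn R n -> \bar R) : measurable_fun setT f ->
  (forall x, (0 <= f x)%E) -> (\int[mu]_x f (shift a x) = \int[mu]_x f x)%E.
Proof.
move=> mf f0.
have h := @ge0_integral_pushforward _ _ (Rn R n) (Rn R n) R (shift a)
  (measurable_shift a) mu setT f measurableT mf.
rewrite -(h (fun x _ => f0 x)).
by apply: eq_measure_integral => [|? A mA _]; [exact: measurable_shift|exact: shift_measure].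
Qed.

Lemma L2_shift a v : L2 v -> L2 (v \o shift a) /\ nrm (v \o shift a) = nrm v.
Proof.
move=> Lv.
have mv : cmeas (v \o shift a).
  by split; [apply: (measurableT_comp Lv.1.1)|apply: (measurableT_comp Lv.1.2)]; exact: measurable_shift.
have E : (\int[mu]_x (sqn (v (shift a x)))%:E = \int[mu]_x (sqn (v x))%:E)%E.
  apply: (ge0_integral_shift a (f := fun x => (sqn (v x))%:E)).
    exact/measurable_EFinP/measurable_sqn/Lv.1.
  by move=> x; rewrite lee_fin sqn_ge0.
have Lva : L2 (v \o shift a).
  split=> //; apply/integrableP; split; first exact/measurable_EFinP/measurable_sqn.
  under eq_integral do rewrite /= ger0_norm ?sqn_ge0//.
  by rewrite E -nrm_sqE// ltry.
split=> //; apply/eqP; rewrite -(@eqrXn2 _ 2%N) ?nrm_ge0//.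
by rewrite -eqe !nrm_sqE// -E.
Qed.

(** Multiplication by a character translates the transform. *)
Definition modul (a : Rn R n) (u : cfun) : cfun := fun x => fchar x a * u x.

Lemma fourier_int_modul a f : F (modul a f) = F f \o shift a.
Proof.
apply/funext => xi; rewrite /= !fourier_intE; congr (_ * _); apply: eq_cint => x.
by rewrite /modul mulrA /fchar -echarD dot_shift.
Qed.

Lemma cmeas_fchar a : cmeas (fun x : Rn R n => fchar x a).
Proof.
apply: cmeas_echar; apply: measurable_sum => i; apply: measurable_funM => //; exact: measurable_tnth.
Qed.

Lemma L1_modul a f : L1 f -> L1 (modul a f).
Proof.
move=> Lf; apply: (@L1_bounded_mul _ _ _ _ _ _ 1) => //; first exact: cmeas_fchar.
by move=> x; rewrite sqn_echar.
Qed.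

Lemma sqn_modul a f x : sqn (modul a f x) = sqn (f x).
Proof. by rewrite sqnM sqn_echar mul1r. Qed.

Lemma L2_modul a f : L2 f -> L2 (modul a f).
Proof.
move=> [mf If]; split; first exact: cmeasM (cmeas_fchar a) mf.
by move: If; congr (integrable _ _ _); apply/funext => x; rewrite /= sqn_modul.
Qed.

Lemma nrm_modul a f : nrm (modul a f) = nrm f.
Proof.
rewrite /nrm /fnorm !ip_sqn; congr (Num.sqrt _).
by apply: eq_Rintegral => x _; rewrite sqn_modul.
Qed.

Lemma is_fourier_modul a u v : is_fourier u v -> is_fourier (modul a u) (v \o shift a).
Proof.
move=> /is_fourierP[Lu Lv h]; apply/is_fourierP.
split=> [||e e0]; [exact: L2_modul|exact: (L2_shift a Lv).1|].
have [f [L1f L2f L2Ff fu Fv]] := h e e0; exists (modul a f).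
have eB : modul a f - modul a u = modul a (f - u).
  by apply/funext => x; rewrite /modul -[LHS]/(_ * _ - _ * _) -mulrBr.
have eF : F (modul a f) - (v \o shift a) = (F f - v) \o shift a by rewrite fourier_int_modul.
split; [exact: L1_modul|exact: L2_modul|rewrite fourier_int_modul; exact: (L2_shift a L2Ff).1| |].
  by rewrite eB nrm_modul.
by rewrite eF (L2_shift a (L2B L2Ff Lv)).2.
Qed.

End translation.

(** * Sobolev spaces as weighted spaces *)

Section weights.
Local Open Scope complex_scope.
Variables (R : realType) (d : nat).
Local Notation mu := (lebesgue_Rn R d).
Local Notation cfun := (Rn R d -> R[i]).
Local Notation L2 := (L2 mu).
Local Notation nrm := (nrm mu).
Local Notation ip := (ip mu).
Local Notation ft := (@fourier R d).
Local Notation ift := (@fourier_inv R d).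
Local Notation J := (@japanese R d).

Lemma dot_ge0 (x : Rn R d) : 0 <= dot x x.
Proof. by apply: sumr_ge0 => i _; rewrite -expr2 sqr_ge0. Qed.

Lemma japanese_ge1 x : 1 <= J x.
Proof. by rewrite lerDr dot_ge0. Qed.

Lemma japanese_gt0 x : 0 < J x.
Proof. exact: lt_le_trans ltr01 (japanese_ge1 x). Qed.

Lemma measurable_japanese : measurable_fun setT J.
Proof.
apply: measurable_funD => //; apply: measurable_sum => i.
by apply: measurable_funM; exact: measurable_tnth.
Qed.

Lemma measurable_japaneseX p : measurable_fun setT (fun x => J x `^ p).
Proof. apply: (measurableT_comp (f := fun y : R => y `^ p)); [exact: measurable_powR|exact: measurable_japanese]. Qed.

Definition wt (p : R) (v : cfun) : cfun := fun x => (J x `^ p)%:C * v x.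

Lemma cmeas_wt p v : cmeas v -> cmeas (wt p v).
Proof. by move=> mv; apply: cmeasM => //; apply: cmeas_real; exact: measurable_japaneseX. Qed.

Lemma sqn_real (r : R) (z : R[i]) : sqn (r%:C * z) = r ^+ 2 * sqn z.
Proof. by rewrite sqnM /sqn /= expr0n /= addr0. Qed.

Lemma wt0 v : wt 0 v = v.
Proof. by apply/funext => x; rewrite /wt powRr0 mul1r. Qed.

Lemma wtD p q v : wt p (wt q v) = wt (p + q) v.
Proof.
apply/funext => x; rewrite /wt mulrA -rmorphM -powRD//.
by rewrite (gt_eqF (japanese_gt0 x)) implybT.
Qed.

Lemma wt_lin p (c : R[i]) u v : wt p (c *: u + v) = c *: wt p u + wt p v.
Proof.
apply/funext => x; rewrite /wt.
by rewrite -[(c *: u + v) x]/(c * u x + v x) -[RHS]/(c * (_ * u x) + _ * v x) mulrDr mulrCA.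
Qed.

Lemma wt_le p q v : p <= q -> cmeas v -> L2 (wt q v) -> L2 (wt p v) /\ nrm (wt p v) <= nrm (wt q v).
Proof.
move=> pq mv Lq; have [|Lp] := @L2_dominated _ _ R mu 1 (wt q v) (wt p v) ler01 (cmeas_wt p mv) Lq.
  apply: nearW => x; rewrite mul1r !sqn_real ler_wpM2r ?sqn_ge0//.
  rewrite ler_pXn2r ?nnegrE ?powR_ge0//; apply: ler_powR => //; exact: japanese_ge1.
by rewrite mul1r ler_pXn2r ?nnegrE ?nrm_ge0.
Qed.

Lemma cut_wt k p v : cut J k (wt p v) = wt p (cut J k v).
Proof. by apply/funext => x; rewrite /cut /wt; case: ifP => // _; rewrite mulr0. Qed.

(** On the set where J <= k the weight is at most k^p. *)
Lemma wt_cut_L2 p k v : 0 <= p -> L2 v -> L2 (wt p (cut J k v)).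
Proof.
move=> p0 Lv; have mJ := measurable_japanese.
have mc : cmeas (wt p (cut J k v)) by apply: cmeas_wt; apply: cmeas_cut; [exact: mJ|exact: Lv.1].
have [|Lp _] := @L2_dominated _ _ R mu ((k `^ p) ^+ 2) v (wt p (cut J k v)) (sqr_ge0 _) mc Lv; last exact: Lp.
apply: nearW => x; rewrite sqn_real /cut; case: ifP => [xk|_]; last first.
  by rewrite sqn0 mulr0 mulr_ge0 ?sqr_ge0 ?sqn_ge0.
rewrite ler_wpM2r ?sqn_ge0// ler_pXn2r ?nnegrE ?powR_ge0//.
have J0 := ltW (japanese_gt0 x).
by apply: ge0_ler_powR => //; rewrite nnegrE//; exact: le_trans J0 xk.
Qed.

Lemma ip_eq u u' v v' : L2 u -> L2 v -> cmeas u' -> cmeas v' ->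
  {ae mu, forall x, u' x = u x} -> {ae mu, forall x, v' x = v x} -> ip u' v' = ip u v.
Proof.
move=> Lu Lv mu' mv' uu vv.
have [Lu' u0] := ae_L2_nrm Lu mu' uu; have [Lv' v0] := ae_L2_nrm Lv mv' vv.
have z w f : L2 w -> L2 f -> nrm w = 0 -> ip w f = 0.
  move=> Lw Lf w0; apply/eqP; rewrite -normr_le0.
  by apply: le_trans (ip_CS Lw Lf) _; rewrite w0 mul0r.
apply/eqP; rewrite -subr_eq0.
have -> : ip u' v' - ip u v = ip (u' - u) v' + ip (v' - v) u.
  by rewrite !(pf_B (ip_form mu))// (ipC mu v' u) (ipC mu v u); ring.
by rewrite !z ?addr0//; exact: L2B.
Qed.

Lemma nrm_eq_ae u u' : L2 u -> cmeas u' -> {ae mu, forall x, u' x = u x} -> nrm u' = nrm u.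
Proof. by move=> Lu mu' uu; rewrite /nrm /fnorm (ip_eq Lu Lu). Qed.

Lemma ip_hom (c : R[i]) u v : L2 u -> L2 v ->
  ip (c *: u) (c *: v) = Normc.normc c ^+ 2 * ip u v.
Proof.
move=> Lu Lv; rewrite -[LHS]/(ip (fun x => c * u x) (fun x => c * v x)) ip_scale// ip_cint.
case: c => a b; rewrite sqr_sqrtr ?addr_ge0 ?sqr_ge0//.
by case: cint => x y /=; ring.
Qed.

Lemma ft_L2 u : L2 u -> L2 (ft u).
Proof. by move=> /fourierP/is_fourier_L2[]. Qed.

Lemma ft_nrm u : L2 u -> nrm (ft u) = nrm u.
Proof. by move=> /fourierP/is_fourier_nrm. Qed.

Lemma is_fourier_ft (u v : cfun) : is_fourier u v -> {ae mu, forall x, ft u x = v x}.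
Proof. by move=> h; have [Lu _] := is_fourier_L2 h; exact: is_fourier_ae (fourierP Lu) h. Qed.

Lemma ft_lin (c : R[i]) u v : L2 u -> L2 v ->
  {ae mu, forall x, ft (c *: u + v) x = (c *: ft u + ft v) x}.
Proof. by move=> Lu Lv; apply: is_fourier_ft; exact: is_fourier_lin (fourierP Lu) (fourierP Lv). Qed.

Lemma wt_ae p (u v : cfun) : {ae mu, forall x, u x = v x} -> {ae mu, forall x, wt p u x = wt p v x}.
Proof. by apply: filterS => x uv; rewrite /wt uv. Qed.

(** The norm of the Sobolev space H^r is the L2 norm of this function. *)
Definition sobw r (u : cfun) : cfun := wt (r / 2) (ft u).

Lemma sobolev_sqnorm_sqn r u : sobolev_sqnorm r u = (\int[mu]_x (sqn (sobw r u x))%:E)%E.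
Proof.
apply: eq_integral => x _; rewrite sqn_normc sqn_real; congr (_ * _)%:E.
by rewrite -powR_mulrn ?powR_ge0// -powRrM divfK.
Qed.

Lemma sobolevP r u : sobolev r u <-> L2 u /\ L2 (sobw r u).
Proof.
rewrite /sobolev/= sobolev_sqnorm_sqn; split=> [[/L2_cLp Lu s]|[Lu Ls]]; split=> //; try exact/L2_cLp.
  have m := cmeas_wt (r / 2) (ft_L2 Lu).1.
  split=> //; apply/integrableP; split; first exact/measurable_EFinP/measurable_sqn.
  under eq_integral do rewrite /= ger0_norm ?sqn_ge0//.
  exact: s.
by rewrite -nrm_sqE// ltry.
Qed.

Lemma sobolev_sqnormE r u : sobolev r u -> sobolev_sqnorm r u = (nrm (sobw r u) ^+ 2)%:E.
Proof.
by move=> /sobolevP[Lu Ls]; rewrite nrm_sqE//; exact: sobolev_sqnorm_sqn.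
Qed.

Lemma sobw_lin r (c : R[i]) u v : L2 u -> L2 v ->
  {ae mu, forall x, sobw r (c *: u + v) x = (c *: sobw r u + sobw r v) x}.
Proof. by move=> Lu Lv; rewrite -wt_lin; apply: wt_ae; exact: ft_lin. Qed.

Lemma cmeas_sobw r u : L2 u -> cmeas (sobw r u).
Proof. by move=> Lu; apply: cmeas_wt; exact: (ft_L2 Lu).1. Qed.

Lemma sobolev_lin r : lin_closed (@sobolev R d r).
Proof.
split=> [|c u v /sobolevP[Lu Lsu] /sobolevP[Lv Lsv]]; apply/sobolevP.
  have L0 := lin0 (L2_lin mu); split=> //.
  have e : {ae mu, forall x, sobw r 0 x = (0 : cfun) x}.
    have := sobw_lin r (-1) L0 L0; rewrite scaleN1r oppr0 addr0.
    by apply: filterS => x ->; rewrite scaleN1r addNr.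
  exact: (ae_L2_nrm L0 (cmeas_sobw r L0) e).1.
have L := (L2_lin mu).2 c u v Lu Lv; split=> //.
exact: (ae_L2_nrm ((L2_lin mu).2 c _ _ Lsu Lsv) (cmeas_sobw r L) (sobw_lin r c Lu Lv)).1.
Qed.

Lemma sobolev_le r r' (u : cfun) : r <= r' -> sobolev r' u -> sobolev r u.
Proof.
move=> rr /sobolevP[Lu Ls]; apply/sobolevP; split=> //.
by apply: (wt_le _ (ft_L2 Lu).1 Ls).1; rewrite ler_pM2r.
Qed.

Lemma sobw_ge r (u : cfun) : 0 <= r -> sobolev r u -> nrm u <= nrm (sobw r u).
Proof.
move=> r0 /sobolevP[Lu Ls]; rewrite -(ft_nrm Lu) -[X in nrm X <= _]wt0.
by apply: (wt_le _ (ft_L2 Lu).1 Ls).2; rewrite divr_ge0.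
Qed.

(** Membership in H^r is tested on any representative v of the transform, since
    [fourier u] is only known up to a null set. *)
Lemma sobolev_of r (u v : cfun) : is_fourier u v -> L2 (wt (r / 2) v) ->
  sobolev r u /\ {ae mu, forall x, sobw r u x = wt (r / 2) v x}.
Proof.
move=> h Lv; have [Lu _] := is_fourier_L2 h; have e := wt_ae (r / 2) (is_fourier_ft h).
split=> //; apply/sobolevP; split=> //; exact: (ae_L2_nrm Lv (cmeas_sobw r Lu) e).1.
Qed.

Lemma bessel_fourier r (u : cfun) : sobolev r u -> is_fourier (bessel (r / 2) u) (sobw r u).
Proof. by move=> /sobolevP[_ Ls]; exact: fourier_invP Ls. Qed.

(** The weight of H^s splits into two equal halves: this cancels the conservative
    part of the generator in the energy. *)
Lemma bessel_ip s (u v : cfun) : sobolev s u -> sobolev (s / 2) v ->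
  ip (bessel (s / 2) u) v = ip (sobw (s / 2) u) (sobw (s / 2) v).
Proof.
move=> su /sobolevP[Lv Lsv].
rewrite -(is_fourier_ip (bessel_fourier su) (fourierP Lv)).
apply: eq_Rintegral => x _; rewrite /sobw /wt.
have -> : J x `^ (s / 2) = J x `^ (s / 2 / 2) * J x `^ (s / 2 / 2).
  by rewrite -powRD ?(gt_eqF (japanese_gt0 x)) ?implybT// -splitr.
case: (ft u x) (ft v x) => a b [a' b'] /=; ring.
Qed.

End weights.

(** * The energy space *)

Section energy.
Local Open Scope complex_scope.
Variables (R : realType) (d : nat) (s : R).
Hypothesis s0 : 0 < s.
Local Notation mu := (lebesgue_Rn R d).
Local Notation cfun := (Rn R d -> R[i]).
Local Notation L2 := (L2 mu).
Local Notation nrm := (nrm mu).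
Local Notation ip := (ip mu).
Local Notation ft := (@fourier R d).
Local Notation ift := (@fourier_inv R d).
Local Notation J := (@japanese R d).
Local Notation X := (@energy_space R d s).
Local Notation N := (@energy_norm R d s).
Local Notation W := (sobw (s / 2)).

Let s2_ge0 : 0 <= s / 2. Proof. by rewrite divr_ge0// ltW. Qed.

Definition eform (U V : state R d) : R := ip (W U.1) (W V.1) + ip U.2 V.2.

Lemma energy_spaceP U : X U <-> [/\ L2 U.1, L2 (W U.1) & L2 U.2].
Proof.
split=> [[/sobolevP[L1 Lw] /L2_cLp L2']|[L1 Lw L2']]; first by split.
by split; [exact/sobolevP|exact/L2_cLp].
Qed.

Lemma energy_lin : lin_closed X.
Proof.
split=> [|c U V [sU /L2_cLp LU] [sV /L2_cLp LV]].
  split; first exact: (lin0 (@sobolev_lin R d (s / 2))).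
  by apply/L2_cLp; exact: (lin0 (L2_lin mu)).
split; first exact: ((@sobolev_lin R d (s / 2)).2 c _ _ sU sV).
by apply/L2_cLp; exact: ((L2_lin mu).2 c _ _ LU LV).
Qed.

Lemma ipZl (a : R) u v w : L2 u -> L2 v -> L2 w -> ip (a%:C *: u + v) w = a * ip u w + ip v w.
Proof. exact: (pf_linl (ip_form mu)). Qed.

Lemma ip_sobw_lin (c : R[i]) u v f : X (u, 0) -> X (v, 0) -> L2 f ->
  ip (W (c *: u + v)) f = ip (c *: W u + W v) f.
Proof.
move=> /energy_spaceP[/= Lu Lsu _] /energy_spaceP[/= Lv Lsv _] Lf.
apply: (ip_eq _ Lf _ Lf.1) => //.
- exact: ((L2_lin mu).2 c _ _ Lsu Lsv).
- by apply: cmeas_sobw; exact: ((L2_lin mu).2 c _ _ Lu Lv).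
- exact: sobw_lin.
- by apply: nearW.
Qed.

Lemma energy_fst (U : state R d) : X U -> X (U.1, 0).
Proof.
move=> /energy_spaceP[Lu Ls _]; apply/energy_spaceP; split=> //; exact: (lin0 (L2_lin mu)).
Qed.

Lemma sobw_hom (c : R[i]) u v : X (u, 0) -> X (v, 0) ->
  ip (W (c *: u)) (W (c *: v)) = Normc.normc c ^+ 2 * ip (W u) (W v).
Proof.
move=> /[dup] Xu /energy_spaceP[/= Lu Lsu L0] /[dup] Xv /energy_spaceP[/= Lv Lsv _].
have X0 : X (0, 0) by exact: (lin0 energy_lin).
have [_ Lw0 _] := (energy_spaceP (0, 0)).1 X0.
have ae (f : cfun) : L2 f -> L2 (W f) -> {ae mu, forall x, W (c *: f) x = (c *: W f) x}.
  move=> Lf Lsf; have h1 := sobw_lin (s / 2) c Lf L0.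
  have h2 := sobw_lin (s / 2) (-1) L0 L0.
  rewrite scaleN1r oppr0 !addr0 in h1 h2.
  apply: filterS2 h1 h2 => x -> h.
  have {}h : W (0 : cfun) x = 0 by rewrite h scaleN1r addNr.
  by rewrite -[LHS]/(_ + W (0 : cfun) x) h addr0.
rewrite -ip_hom//; apply: ip_eq.
- exact: L2Z.
- exact: L2Z.
- by apply: cmeas_sobw; exact: L2Z.
- by apply: cmeas_sobw; exact: L2Z.
- exact: ae.
- exact: ae.
Qed.

Lemma eform_pos : pos_form X eform.
Proof.
split.
- exact: energy_lin.
- by move=> U V _ _; rewrite /eform ipC (ipC mu U.2).
- move=> a [u1 u2] [v1 v2] [z1 z2] XU XV XZ; have /energy_spaceP[_ LsU LU] := XU.
  have /energy_spaceP[_ LsV LV] := XV; have /energy_spaceP[_ LsZ LZ] := XZ.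
  have e1 := ip_sobw_lin a%:C (energy_fst XU) (energy_fst XV) LsZ.
  have e2 := ipZl a LsU LsV LsZ; have e3 := ipZl a LU LV LZ.
  transitivity (ip (W (a%:C *: u1 + v1)) (W z1) + ip (a%:C *: u2 + v2) z2); first reflexivity.
  rewrite e1 e2 e3.
  have eE x1 x2 : eform (x1, x2) (z1, z2) = ip (W x1) (W z1) + ip x2 z2 by [].
  rewrite !eE mulrDr.
  exact: addrACA.
- move=> U /energy_spaceP[_ LsU LU].
  by rewrite addr_ge0//; exact: (pf_ge0 (ip_form mu)).
- move=> c [u v] XU; have /energy_spaceP[_ _ LU] := XU.
  transitivity (ip (W (c *: u)) (W (c *: u)) + ip (c *: v) (c *: v)); first reflexivity.
  by rewrite (sobw_hom _ (energy_fst XU) (energy_fst XU)) (ip_hom c LU LU) -mulrDr.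
Qed.

Lemma energy_normE U : X U -> N U = fnorm eform U.
Proof.
move=> [sU /L2_cLp LU]; have /sobolevP[Lu Ls] := sU.
by rewrite /energy_norm sobolev_sqnormE// /cLnorm Lnorm2_nrm//= !nrm_sq.
Qed.

Lemma energy_sq U : X U -> N U ^+ 2 = nrm (W U.1) ^+ 2 + nrm U.2 ^+ 2.
Proof.
move=> XU; have /energy_spaceP[_ Ls LU] := XU.
by rewrite energy_normE// (fnorm_sq eform_pos)// /eform !nrm_sq.
Qed.

Lemma energy_seminorm : seminorm_on X N.
Proof.
have [XL h1 h2] := pf_seminorm eform_pos.
split=> [//|U V XU XV|c U XU].
  by rewrite !energy_normE//; [exact: h1|exact: linD].
by rewrite !energy_normE//; [exact: h2|exact: linZ].
Qed.

Lemma energy_le U : X U -> N U <= nrm (W U.1) + nrm U.2.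
Proof.
move=> XU; rewrite -(@ler_pXn2r _ 2%N)// ?nnegrE ?addr_ge0 ?nrm_ge0 ?(sn_ge0 energy_seminorm)//.
rewrite energy_sq//; have := nrm_ge0 mu (W U.1); have := nrm_ge0 mu U.2; nra.
Qed.

Lemma energy_ge U : X U -> nrm (W U.1) <= N U /\ nrm U.2 <= N U.
Proof.
move=> XU; have := energy_sq XU; have := sn_ge0 energy_seminorm XU.
have := nrm_ge0 mu (W U.1); have := nrm_ge0 mu U.2.
by move: (N U) (nrm (W U.1)) (nrm U.2) => a b c *; split; nra.
Qed.

Lemma energy_fstB U V : X U -> X V -> nrm (W (U - V).1) = nrm (W U.1 - W V.1).
Proof.
move=> /energy_spaceP[Lu Lsu _] /energy_spaceP[Lv Lsv _].
apply: nrm_eq_ae; first exact: L2B.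
  by apply: cmeas_sobw; exact: L2B Lu Lv.
have := sobw_lin (s / 2) (-1) Lv Lu.
rewrite !scaleN1r addrC [- _ + _]addrC; exact.
Qed.

Lemma energy_complete : complete_on X N.
Proof.
move=> U XU Ucau; have XB k : X (U k.+1 - U k) by exact: (linB energy_lin).
have nS := nrm_seminorm mu.
have Ls k := let: And3 a b c := (energy_spaceP (U k)).1 (XU k) in (conj a (conj b c)).
have [g Lg Ug] : exists2 g, L2 g & forall k, nrm (W (U k).1 - g) <= 4 / 3 * 4^-1 ^+ k.
  apply: (complete_rate nS (@L2_complete _ _ R mu)) => k; first exact: (Ls k).2.1.
  by rewrite -energy_fstB//; apply: le_trans (Ucau k); exact: (energy_ge (XB k)).1.
have [v Lv Uv] : exists2 v, L2 v & forall k, nrm ((U k).2 - v) <= 4 / 3 * 4^-1 ^+ k.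
  apply: (complete_rate nS (@L2_complete _ _ R mu)) => k; first exact: (Ls k).2.2.
  by apply: le_trans (Ucau k); exact: (energy_ge (XB k)).2.
(* The first component of the limit is recovered by dividing its weighted
   transform by a weight that is at least 1. *)
pose p := s / 2 / 2.
have gE : wt p (wt (- p) g) = g by rewrite wtD subrr wt0.
have Lg' : L2 (wt (- p) g).
  have p0 : - p <= 0 by rewrite oppr_le0 !divr_ge0// ltW.
  exact: (wt_le p0 Lg.1 (eq_ind_r L2 Lg (wt0 g))).1.
have hf := fourier_invP Lg'.
have [su ue] := sobolev_of (r := s / 2) hf (eq_ind_r L2 Lg gE).
pose V : state R d := (ift (wt (- p) g), v).
have XV : X V by split=> //; exact/L2_cLp.
exists V => //.
have bd k : N (U k - V) <= 8 / 3 * 4^-1 ^+ k.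
  have XD := linB energy_lin (XU k) XV.
  apply: le_trans (energy_le XD) _; rewrite energy_fstB//.
  have -> : nrm (W (U k).1 - W V.1) = nrm (W (U k).1 - g).
    have Lk := (Ls k).2.1; apply: (nrm_eq_ae (L2B Lk Lg)).
      exact: (L2B Lk ((sobolevP _ _).1 su).2).1.
    move: ue; apply: filterS => x e.
    rewrite gE in e; exact: (congr1 (fun z => W (U k).1 x - z) e).
  have := Uv k; have := Ug k; rewrite -[(U k - V).2]/((U k).2 - v).
  by move: (nrm _) (nrm _) => a b; clear; lra.
apply: (@squeeze_cvgr _ _ _ _ (cst 0) (fun k => 8 / 3 * 4^-1 ^+ k)).
- by apply: nearW => k; rewrite (sn_ge0 energy_seminorm (linB energy_lin (XU k) XV)) bd.
- exact: cvg_cst.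
- rewrite -(mulr0 (8 / 3)); apply: cvgMr; apply: cvg_expr.
  by rewrite ger0_norm ?invr_ge0// invf_lt1// ltr1n.
Qed.

End energy.

(** * Decay under damping bounded below *)

Section dissipative_form.
Local Open Scope complex_scope.
Variables (R : realType) (V : lmodType R[i]) (X : set V) (q : V -> V -> R).
Hypothesis qX : pos_form X q.

(** Cauchy-Schwarz for q U (U - h Z), divided by the norm of U. *)
Lemma form_dissipative (kap h : R) (U Z : V) : X U -> X Z -> 0 < h ->
  q U Z <= - kap * q U U ->
  (1 + kap * h) * fnorm q U <= fnorm q (U - h%:C *: Z).
Proof.
move=> XU XZ h0 UZ; have XhZ := linZ (pf_lin qX) h%:C XZ.
have XB := linB (pf_lin qX) XU XhZ.
have := le_trans (ler_norm _) (pf_CS qX XU XB).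
rewrite (pf_Br qX)// (pf_Zr qX)// -(fnorm_sq qX XU) in UZ *.
have := ler_wpM2l (ltW h0) UZ; have := fnorm_ge0 q U; have := fnorm_ge0 q (U - h%:C *: Z).
move: (fnorm q (U - h%:C *: Z)) (fnorm q U) (q U Z) => a b c; clear -h0.
move=> a0; rewrite [0 <= b]le_eqVlt eq_sym => /orP[/eqP ->|b0 h1 h2]; first by rewrite mulr0.
by rewrite -(ler_pM2l b0); lra.
Qed.

End dissipative_form.

Section damping.
Local Open Scope complex_scope.
Variables (R : realType) (d : nat) (s : R) (gamma : Rn R d -> R).
Hypothesis s0 : 0 < s.
Local Notation mu := (lebesgue_Rn R d).
Local Notation cfun := (Rn R d -> R[i]).
Local Notation L2 := (L2 mu).
Local Notation nrm := (nrm mu).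
Local Notation ip := (ip mu).
Local Notation ft := (@fourier R d).
Local Notation ift := (@fourier_inv R d).
Local Notation J := (@japanese R d).
Local Notation X := (@energy_space R d s).
Local Notation N := (@energy_norm R d s).
Local Notation D := (@KG_domain R d s).
Local Notation A := (@KG_op R d s gamma).
Local Notation W := (sobw (s / 2)).
Local Notation bform := (@eform R d s).

Variable M : R.
Hypotheses (M0 : 0 <= M) (mg : measurable_fun setT gamma).
Hypothesis gM : {ae mu, forall x, 0 <= gamma x <= M}.

Let s2_ge0 : 0 <= s / 2. Proof. by rewrite divr_ge0// ltW. Qed.
Let s2_le : s / 2 <= s. Proof. by rewrite ler_pdivrMr// ler_peMr ?ler1n// ltW. Qed.

Definition damp (v : cfun) : cfun := fun x => (gamma x)%:C * v x.

Lemma damp_L2 v : L2 v -> L2 (damp v) /\ nrm (damp v) <= M * nrm v.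
Proof.
move=> Lv; have mv : cmeas (damp v) by apply: cmeasM; [exact: cmeas_real|exact: Lv.1].
have [|L h] := @L2_dominated _ _ R mu (M ^+ 2) v (damp v) (sqr_ge0 _) mv Lv.
  apply: filterS gM => x /andP[g0 g1]; rewrite sqn_real ler_wpM2r ?sqn_ge0//.
  by rewrite ler_pXn2r// nnegrE.
split; first exact: L.
by rewrite -(@ler_pXn2r _ 2%N)// ?nnegrE ?mulr_ge0 ?nrm_ge0// exprMn.
Qed.

Lemma ip_damp (c : R) v : L2 v -> {ae mu, forall x, c <= gamma x} ->
  c * nrm v ^+ 2 <= ip v (damp v).
Proof.
move=> Lv gc; have [Lg _] := damp_L2 Lv.
rewrite nrm_sq// /ip -RintegralZl//; last exact: ip_integrable.
have i1 := ip_integrable Lv Lv; have i2 := ip_integrable Lv Lg.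
rewrite -subr_ge0 -RintegralB//; last exact: integrableRZ.
pose f x := re (v x) * re (damp v x) + im (v x) * im (damp v x) -
  c * (re (v x) * re (v x) + im (v x) * im (v x)).
have fi : mu.-integrable setT (EFin \o f) := integrableRB i2 (integrableRZ c i1).
have mf := measurable_int _ fi.
apply: fine_ge0.
rewrite (@ae_eq_integral _ _ _ mu setT (abse \o (EFin \o f)) (EFin \o f)).
- by apply: integral_ge0 => x _; exact: abse_ge0.
- exact: measurableT.
- exact: mf.
- by apply: measurableT_comp.
- apply: filterS gc => x cg _; rewrite /= ger0_norm//.
  have -> : f x = (gamma x - c) * sqn (v x).
    by rewrite /f /damp /sqn; case: (v x) => p q /=; ring.
  by rewrite mulr_ge0 ?subr_ge0 ?sqn_ge0.
Qed.

Lemma KG_opE U : A U = (U.2, - bessel (s / 2) U.1 - damp U.2).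
Proof. by []. Qed.

Lemma KG_domainP U : D U ->
  [/\ sobolev s U.1, sobolev (s / 2) U.2, L2 U.1, L2 U.2 & L2 (bessel (s / 2) U.1)].
Proof.
move=> [s1 s2']; have /sobolevP[L1 _] := s1; have /sobolevP[L2' _] := s2'.
split=> //; exact: (is_fourier_L2 (bessel_fourier s1)).1.
Qed.

Lemma KG_domain_sub U : D U -> X U /\ X (A U).
Proof.
move=> /KG_domainP[s1 s2' L1 L2' LB]; split; split.
- exact: sobolev_le s2_le s1.
- exact/L2_cLp.
- exact: s2'.
- apply/L2_cLp; rewrite KG_opE /=; apply: L2B; last exact: (damp_L2 L2').1.
  exact: (linN (L2_lin mu) LB).
Qed.

(** Cutting off high frequencies puts a state into the domain. *)
Lemma KG_domain_dense U e : X U -> 0 < e -> exists2 Z, D Z & N (U - Z) < e.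
Proof.
move=> XU e0; have /(energy_spaceP _)[Lu Ls Lv] := XU; have mJ := @measurable_japanese R d.
have e2 : 0 < e / 2 by rewrite divr_gt0.
have [k hk] := L2_truncation mJ Ls e2.
have [l hl] := L2_truncation mJ (ft_L2 Lv) e2.
pose u' := ift (cut J k%:R (ft U.1)); pose v' := ift (cut J l%:R (ft U.2)).
have fu : is_fourier u' (cut J k%:R (ft U.1)) by apply: fourier_invP; apply: L2_cut => //; exact: ft_L2.
have fv : is_fourier v' (cut J l%:R (ft U.2)) by apply: fourier_invP; apply: L2_cut => //; exact: ft_L2.
have pos (r : R) : 0 <= r -> 0 <= r / 2 by move=> r0; rewrite divr_ge0.
have su := sobolev_of (r := s) fu (wt_cut_L2 k%:R s2_ge0 (ft_L2 Lu)).
have su' := sobolev_of (r := s / 2) fu (wt_cut_L2 k%:R (pos _ s2_ge0) (ft_L2 Lu)).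
have sv := sobolev_of (r := s / 2) fv (wt_cut_L2 l%:R (pos _ s2_ge0) (ft_L2 Lv)).
have DZ : D (u', v') by split; [exact: su.1|exact: sv.1].
exists (u', v') => //; have [XZ _] := KG_domain_sub DZ.
have XB := linB (energy_lin d s) XU XZ.
have le := energy_le XB.
apply: le_lt_trans le _.
rewrite (splitr e); apply: ltrD.
  rewrite energy_fstB//; apply: le_lt_trans hk; rewrite le_eqVlt; apply/orP; left; apply/eqP.
  have Lc := L2_cut k%:R mJ Ls; apply: (nrm_eq_ae (L2B Ls Lc)).
    exact: (L2B Ls ((sobolevP _ _).1 su'.1).2).1.
  move: su'.2; apply: filterS => x h; rewrite cut_wt.
  exact: (congr1 (fun z => W U.1 x - z) h).
apply: le_lt_trans hl; rewrite le_eqVlt; apply/orP; left; apply/eqP.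
have h := is_fourier_lin (-1) fv (fourierP Lv).
have := is_fourier_nrm h; rewrite !scaleN1r addrC [- _ + _]addrC => ->.
by [].
Qed.

Section decay.
Variable c : R.
Hypotheses (c0 : 0 < c) (gc : {ae mu, forall x, c <= gamma x}).

(** Below 1/2 the modified form is equivalent to the energy; the other bound lets
    the damping absorb what the cross term costs, namely ep |v|^2 and the
    interaction of u with gamma v. *)
Let ep : R := Num.min (2^-1) (c / (3 / 2 + M ^+ 2 / 2)).
Let den0 : 0 < 3 / 2 + M ^+ 2 / 2 :> R.
Proof. by have := sqr_ge0 M; lra. Qed.
Let ep0 : 0 < ep.
Proof. by rewrite lt_min invr_gt0 ltr0n/= divr_gt0. Qed.
Let ep_half : ep <= 2^-1. Proof. by rewrite ge_min lexx. Qed.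
Let ep_c : ep * (3 / 2 + M ^+ 2 / 2) <= c.
Proof. by rewrite -ler_pdivlMr// ge_min lexx orbT. Qed.

(** The energy modified by a small multiple of the cross term, which transfers
    the dissipation from the velocity to the position. *)
Definition qform (U V : state R d) : R :=
  bform U V + ep * (ip U.1 V.2 + ip V.1 U.2).

Lemma qform_sq U : X U -> qform U U = N U ^+ 2 + 2 * ep * ip U.1 U.2.
Proof.
move=> XU; rewrite /qform energy_normE// (fnorm_sq (eform_pos d s))//; ring.
Qed.

Lemma cross_le U : X U -> `|2 * ip U.1 U.2| <= N U ^+ 2.
Proof.
move=> XU; have [Lu Ls Lv] := (energy_spaceP _ _).1 XU.
rewrite energy_sq// normrM (@ger0_norm _ 2)//; have := ip_CS Lu Lv.
have := sobw_ge s2_ge0 XU.1; have := nrm_ge0 mu U.1; have := nrm_ge0 mu U.2.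
move: (nrm U.1) (nrm U.2) (nrm (W U.1)) `|_| => a b w z b0 a0 aw zab.
by have := ler_wpM2r b0 aw; have := sqr_ge0 (w - b); lra.
Qed.

Lemma qform_bounds U : X U -> N U ^+ 2 / 2 <= qform U U <= 3 / 2 * N U ^+ 2.
Proof.
move=> XU; have := cross_le XU; rewrite qform_sq// ler_norml => /andP[h1 h2].
have e0 := ltW ep0; have := ler_wpM2l e0 h1; have := ler_wpM2l e0 h2.
have := ler_wpM2r (sqr_ge0 (N U)) ep_half.
move: (N U ^+ 2) (ip _ _) => a b *; apply/andP; split; lra.
Qed.

Lemma qform_pos : pos_form X qform.
Proof.
have fm := ip_form mu; have em := eform_pos d s.
split.
- exact: energy_lin.
- move=> U V XU XV; rewrite /qform (pf_sym em)//; congr (_ + _ * _); exact: addrC.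
- move=> a U V Z XU XV XZ; rewrite /qform (pf_linl em)//.
  have [Lu _ Lu'] := (energy_spaceP _ _).1 XU; have [Lv _ Lv'] := (energy_spaceP _ _).1 XV.
  have [Lz _ Lz'] := (energy_spaceP _ _).1 XZ.
  have e1 : ip (a%:C *: U + V).1 Z.2 = a * ip U.1 Z.2 + ip V.1 Z.2 by exact: (pf_linl fm).
  have e2 : ip Z.1 (a%:C *: U + V).2 = a * ip Z.1 U.2 + ip Z.1 V.2.
    by rewrite ipC (ipC mu Z.1) (ipC mu Z.1 V.2); exact: (pf_linl fm).
  rewrite e1 e2; ring.
- move=> U XU; have /andP[+ _] := qform_bounds XU; apply: le_trans.
  by rewrite divr_ge0 ?sqr_ge0.
- move=> k U XU; rewrite /qform (pf_hom em)//.
  have [Lu _ Lu'] := (energy_spaceP _ _).1 XU.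
  have -> : ip (k *: U).1 (k *: U).2 = Normc.normc k ^+ 2 * ip U.1 U.2 by exact: ip_hom.
  ring.
Qed.

(** The cross term contributes - ep |u|^2 in H^{s/2}, and Young's inequality splits
    the damping term between this gain and the dissipation of v. *)
Lemma qform_dissip U : D U -> qform U (A U) <= - (ep / 3) * qform U U.
Proof.
move=> DU; have [XU XAU] := KG_domain_sub DU.
have [s1 s2' Lu Lv LB] := KG_domainP DU; have [Lg gv] := damp_L2 Lv.
have fm := ip_form mu; have Nb := linN (L2_lin mu) LB.
have nonneg : 0 <= ep / 3 by rewrite divr_ge0// ltW.
have /andP[_ qb] := qform_bounds XU.
have := ler_wpM2l nonneg qb; rewrite energy_sq//.
have damped := ip_damp Lv gc.
have cross : `|ip U.1 (damp U.2)| <= nrm (W U.1) * (M * nrm U.2).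
  apply: le_trans (ip_CS Lu Lg) _.
  by apply: ler_pM => //; [exact: nrm_ge0|exact: nrm_ge0|exact: sobw_ge s2_ge0 XU.1].
have bA : bform U (A U) = - ip U.2 (damp U.2).
  rewrite /eform KG_opE /= (pf_Br fm)// (pf_sym fm Lv Nb) (pf_N fm)// (bessel_ip s1 s2').
  ring.
have b1 : ip U.1 (A U).2 = - nrm (W U.1) ^+ 2 - ip U.1 (damp U.2).
  rewrite KG_opE /= (pf_Br fm)// (pf_sym fm Lu Nb) (pf_N fm)//.
  have [_ Ls _] := (energy_spaceP _ _).1 XU.
  by rewrite (bessel_ip s1 XU.1) nrm_sq.
have b2 : ip (A U).1 U.2 = nrm U.2 ^+ 2 by rewrite nrm_sq.
have cr2 : - ip U.1 (damp U.2) <= (nrm (W U.1) ^+ 2 + M ^+ 2 * nrm U.2 ^+ 2) / 2.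
  have := le_trans (ler_norm _) (eq_ind_r (fun z => z <= _) cross (normrN (ip U.1 (damp U.2)))).
  have := sqr_ge0 (nrm (W U.1) - M * nrm U.2).
  move: (nrm (W U.1)) (nrm U.2) (ip _ _) => a b z *; nra.
rewrite [qform U (A U)]/qform bA b1 b2.
have e0 := ltW ep0.
have := ler_wpM2l e0 cr2; have := ler_wpM2r (sqr_ge0 (nrm U.2)) ep_c.
move: damped; move: (nrm (W U.1) ^+ 2) (nrm U.2 ^+ 2) (ip _ (damp _)) (ip _ (damp _)) (qform U U) (M ^+ 2) => a b z z' Q M2.
move=> *; lra.
Qed.

Lemma qnorm_bounds U : X U -> N U / 2 <= fnorm qform U <= 2 * N U.
Proof.
move=> XU; have /andP[h1 h2] := qform_bounds XU.
have N0 := sn_ge0 (energy_seminorm d s) XU; have q0 := fnorm_ge0 qform U.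
rewrite -(fnorm_sq qform_pos XU) in h1 h2.
have sq0 := sqr_ge0 (N U).
apply/andP; split; rewrite -(@ler_pXn2r _ 2%N) ?nnegrE ?divr_ge0 ?mulr_ge0//.
  by apply: le_trans h1; rewrite expr_div_n; lra.
by apply: le_trans h2 _; rewrite exprMn; lra.
Qed.

Lemma damped_decay (T : R -> state R d -> state R d) : generates X N D A T ->
  exists C omega : R, [/\ 0 < C, 0 < omega &
    forall U, X U -> forall t, 0 <= t ->
      N (T t U) <= C * expR (- (omega * t)) * N (T 0 U)].
Proof.
move=> TG; have XN := energy_seminorm d s.
have kap0 : 0 < ep / 3 by rewrite divr_gt0.
exists 4, (ep / 3 / 2); split=> //; first by rewrite divr_gt0.
move=> U XU t t0.
have dec : fnorm qform (T t U) <= expR (- (ep / 3 / 2 * t)) * fnorm qform U.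
  apply: (dissipative_decay XN TG KG_domain_sub (energy_complete s0) (pf_seminorm qform_pos)
    (ler0n _ 2) kap0) => //.
  - by move=> Z XZ; have /andP[] := qnorm_bounds XZ.
  - move=> Z h DZ h0; have [XZ XAZ] := KG_domain_sub DZ.
    exact: (form_dissipative qform_pos XZ XAZ h0 (qform_dissip DZ)).
  - by move=> Z e XZ e0; exact: KG_domain_dense.
have XT : X (T t U) := C0_X TG.1 t0 XU.
rewrite (C0_id XN TG.1 XU).
have /andP[h1 _] := qnorm_bounds XT; have /andP[_ h2] := qnorm_bounds XU.
have := ler_wpM2l (expR_ge0 (- (ep / 3 / 2 * t))) h2.
by move: h1 dec; move: (expR _) (fnorm _ _) (fnorm _ _) (N _) (N _) => *; lra.
Qed.

End decay.
End damping.

(** * Wave packets *)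

Section symbol.
Variable R : realType.

(** Concavity: with r = x / b both r^p and r lie on the same side of 1, and r^p is
    the closer one. *)
Lemma powR_dist (p x b : R) : 0 < p <= 1 -> 0 < x -> 0 < b ->
  `|x `^ p - b `^ p| <= b `^ (p - 1) * `|x - b|.
Proof.
move=> /andP[p0 p1] x0 b0; pose r := x / b.
have r0 : 0 < r by rewrite divr_gt0.
have xE : x = b * r by rewrite /r mulrCA divff ?gt_eqF// mulr1.
have bp : b `^ p = b `^ (p - 1) * b.
  by rewrite -{3}(powRr1 (ltW b0)) -powRD ?subrK// gt_eqF ?implybT.
rewrite {1}xE (powRM _ (ltW b0) (ltW r0)) -{2}[b `^ p]mulr1 -mulrBr normrM ger0_norm ?powR_ge0//.
rewrite bp -mulrA ler_wpM2l ?powR_ge0//.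
have -> : x - b = b * (r - 1) by rewrite xE; ring.
rewrite normrM (gtr0_norm b0) (ler_wpM2l (ltW b0))//.
have [r1|r1] := leP 1 r.
  have h1 : r `^ p <= r by rewrite -{2}(powRr1 (ltW r0)) ler_powR.
  have h2 : 1 <= r `^ p by rewrite -(powRr0 r) ler_powR// ltW.
  by rewrite !ger0_norm ?subr_ge0// lerB.
have h1 : r `^ p <= 1.
  have -> : 1 = 1 `^ p :> R by rewrite powR1.
  by apply: ge0_ler_powR; rewrite ?nnegrE; lra.
have h2 : r <= r `^ p.
  by rewrite -{1}(powRr1 (ltW r0)); apply: ger_powR => //; rewrite r0/= ltW.
rewrite !ler0_norm ?subr_le0//; lra.
Qed.

Variable d : nat.
Local Notation J := (@japanese R d).

(** |xi|^2 - |a|^2 for xi = y - a is |y|^2 - 2 y.a; the mixed term is bounded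
    through the squares |a + q y|^2 and |a - q y|^2. *)
Lemma japanese_shift (a x : Rn R d) r : 1 <= r -> J (shift a x) <= r ->
  `|J x - J a| <= 3 * r * Num.sqrt (J a).
Proof.
move=> r1 hr; pose q := Num.sqrt (J a); pose y := shift a x.
have Ja0 := japanese_gt0 a.
have q1 : 1 <= q by rewrite -sqrtr1 ler_wsqrtr// japanese_ge1.
have q0 : 0 < q by exact: lt_le_trans ltr01 q1.
have q2 : q ^+ 2 = J a by rewrite sqr_sqrtr// ltW.
have dotE : J x - J a = dot y y - 2 * dot y a.
  rewrite /japanese opprD addrACA subrr addr0 /dot mulr_sumr -!sumrB.
  by apply: eq_bigr => i _; rewrite tnth_mktuple; ring.
have sq (e : R) : 0 <= dot a a + 2 * (e * q) * dot y a + (e * q) ^+ 2 * dot y y.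
  rewrite /dot !mulr_sumr -!big_split/=; apply: sumr_ge0 => i _.
  rewrite (_ : _ + _ = (tnth a i + e * q * tnth y i) ^+ 2) ?sqr_ge0//; ring.
have y0 := dot_ge0 y; have a0 := dot_ge0 a.
have yr : dot y y <= r - 1 by move: hr; rewrite -/y /japanese; lra.
have aq : dot a a <= q ^+ 2 by rewrite q2 /japanese; lra.
have h1 : 2 * dot y a <= q * r.
  have := sq (-1); rewrite -(ler_pM2l q0); have := ler_wpM2l (sqr_ge0 q) yr; nra.
have h2 : - (2 * dot y a) <= q * r.
  have := sq 1; rewrite -(ler_pM2l q0); have := ler_wpM2l (sqr_ge0 q) yr; nra.
have rq : r <= r * q by rewrite ler_peMr//; lra.
rewrite dotE -/q ler_norml; apply/andP; split; lra.
Qed.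

Lemma japanese_unbounded (B : R) : (0 < d)%N -> exists a : Rn R d, B < J a.
Proof.
move=> d0; pose t := `|B| + 1; exists (mktuple (fun=> t)).
have B0 := normr_ge0 B; have BB := ler_norm B.
rewrite /japanese /dot (eq_bigr (fun=> t * t)); last by move=> i _; rewrite tnth_mktuple.
rewrite sumr_const card_ord -mulr_natl.
have : (1 : R) <= d%:R by rewrite ler1n.
move=> d1; have := ler_wpM2r (sqr_ge0 t) d1; rewrite /t; nra.
Qed.

End symbol.

Section packets.
Local Open Scope complex_scope.
Variables (R : realType) (d : nat) (s : R) (gamma : Rn R d -> R).
Hypotheses (s0 : 0 < s) (s2 : s < 2).
Local Notation mu := (lebesgue_Rn R d).
Local Notation cfun := (Rn R d -> R[i]).
Local Notation L2 := (L2 mu).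
Local Notation nrm := (nrm mu).
Local Notation ip := (ip mu).
Local Notation ft := (@fourier R d).
Local Notation ift := (@fourier_inv R d).
Local Notation J := (@japanese R d).
Local Notation X := (@energy_space R d s).
Local Notation N := (@energy_norm R d s).
Local Notation D := (@KG_domain R d s).
Local Notation A := (@KG_op R d s gamma).
Local Notation damp := (@damp R d gamma).

Variable M : R.
Hypotheses (M0 : 0 <= M) (mg : measurable_fun setT gamma).
Hypothesis gM : {ae mu, forall x, 0 <= gamma x <= M}.

Local Notation p := (s / 2).
Let p0 : 0 < p. Proof. by rewrite divr_gt0. Qed.
Let p1 : p < 1. Proof. by rewrite ltr_pdivrMr// mul1r. Qed.

Section one_packet.
Variables (v0 : cfun) (r : R) (phi : cfun) (a : Rn R d).
Hypotheses (Lv0 : L2 v0) (r1 : 1 <= r) (hphi : is_fourier phi (cut J r v0)).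

Let v := cut J r v0 \o shift a.
Let u := modul a phi.
Let q := Num.sqrt (J a).
Let lam := J a `^ (p / 2).

Let Lphi : L2 phi. Proof. by have [] := is_fourier_L2 hphi. Qed.
Let Lc : L2 (cut J r v0). Proof. by have [] := is_fourier_L2 hphi. Qed.
Let Lu : L2 u. Proof. exact: L2_modul. Qed.
Let Lv : L2 v. Proof. exact: (L2_shift a Lc).1. Qed.
Let hu : is_fourier u v. Proof. exact: is_fourier_modul. Qed.
Let vnrm : nrm v = nrm phi.
Proof. by rewrite (L2_shift a Lc).2 (is_fourier_nrm hphi). Qed.
Let unrm : nrm u = nrm phi. Proof. exact: nrm_modul. Qed.

(** A translate of a band-limited transform is supported in a ball again. *)
Let v_cut : v = cut J (J a + 3 * r * q) v.
Proof.
apply/funext => x; rewrite /v /cut /=; case: ifP => [xr|_]; last by rewrite if_same.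
have := japanese_shift r1 xr; rewrite ler_norml -/q => /andP[_ h].
by rewrite (_ : J x <= _)//; move: h; rewrite lerBlDl.
Qed.

Let wt_v t : 0 <= t -> L2 (wt t v).
Proof. by move=> t0; rewrite v_cut; exact: wt_cut_L2. Qed.

Let lam0 : 0 < lam. Proof. by rewrite powR_gt0// japanese_gt0. Qed.
Let lam_sq : lam ^+ 2 = J a `^ p.
Proof. by rewrite -powR_mulrn ?powR_ge0// -powRrM divfK. Qed.

Let su : sobolev s u /\ {ae mu, forall x, sobw s u x = wt p v x}.
Proof. exact: sobolev_of hu (wt_v (ltW p0)). Qed.

Let U : state R d := (u, (0 +i* lam) *: u).

Lemma packet_domain : D U.
Proof.
split; first exact: su.1.
have := (sobolev_lin d p); move=> h; apply: (linZ h).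
by apply: sobolev_le su.1; rewrite ler_pdivrMr// ler_peMr ?ler1n// ltW.
Qed.

(** For s < 2 the symbol J^{s/2} is concave in J, so that it varies by
    O (J(a)^{s/2 - 1/2}) on the support of the transform of u. *)
Lemma packet_symbol : nrm (bessel p u - (lam ^+ 2)%:C *: u) <=
  3 * r * q * J a `^ (p - 1) * nrm phi.
Proof.
have [s_u su_ae] := su; have Ls := ((sobolevP _ _).1 s_u).2.
have Lw := wt_v (ltW p0).
have h := is_fourier_lin (- (lam ^+ 2)%:C) hu (bessel_fourier s_u).
have -> : bessel p u - (lam ^+ 2)%:C *: u = - (lam ^+ 2)%:C *: u + bessel p u.
  by rewrite addrC scaleNr.
rewrite -(is_fourier_nrm h).
have c0 : 0 <= 3 * r * q * J a `^ (p - 1).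
  have r0 : 0 <= r := le_trans ler01 r1.
  by rewrite mulr_ge0 ?powR_ge0// mulr_ge0 ?sqrtr_ge0// mulr_ge0.
have [|_ le] := @L2_dominated _ _ R mu ((3 * r * q * J a `^ (p - 1)) ^+ 2) v
    (- (lam ^+ 2)%:C *: v + sobw s u) (sqr_ge0 _) ((L2_lin mu).2 _ _ _ Lv Ls).1 Lv.
  apply: filterS su_ae => x e.
  rewrite -[X in sqn X]/(- (lam ^+ 2)%:C * v x + sobw s u x) e /wt -mulrDl addrC.
  rewrite -rmorphN -rmorphD sqn_real.
  have [xr|xr] := leP (J (shift a x)) r; last first.
    by rewrite (_ : v x = 0) ?sqn0 ?mulr0// /v /cut /= leNgt xr.
  rewrite ler_wpM2r ?sqn_ge0// -real_normK ?num_real// ler_pXn2r//.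
  have p01 : 0 < p <= 1 by rewrite p0 ltW.
  rewrite lam_sq; apply: le_trans (powR_dist p01 (japanese_gt0 x) (japanese_gt0 a)) _.
  by rewrite mulrC ler_wpM2r ?powR_ge0//; exact: japanese_shift.
rewrite -vnrm -(@ler_pXn2r _ 2%N)// ?nnegrE ?nrm_ge0//; first by rewrite [leRHS]exprMn.
by rewrite mulr_ge0 ?nrm_ge0.
Qed.

(** The first component of A U - i lam U cancels by the choice of U. *)
Lemma packet_residual : N (A U - (0 +i* lam) *: U) <=
  3 * r * q * J a `^ (p - 1) * nrm phi + lam * nrm (damp phi).
Proof.
have DU := packet_domain; have [XU XAU] := KG_domain_sub s0 M0 mg gM DU.
have XB := linB (energy_lin d s) XAU (linZ (energy_lin d s) (0 +i* lam) XU).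
have Lg := (damp_L2 M0 mg gM Lphi).1.
have Lm := L2Z (0 +i* lam) (L2_modul a Lg).
have Lb : L2 (bessel p u - (lam ^+ 2)%:C *: u).
  by apply: L2B (L2Z _ Lu); exact: (is_fourier_L2 (bessel_fourier su.1)).1.
apply: le_trans (energy_le XB) _.
have -> : (A U - (0 +i* lam) *: U).1 = 0 by exact: subrr.
have -> : (A U - (0 +i* lam) *: U).2 =
    - (bessel p u - (lam ^+ 2)%:C *: u) - (0 +i* lam) *: modul a (damp phi).
  apply/funext => x.
  rewrite -[LHS]/(- bessel p u x - (gamma x)%:C * ((0 +i* lam) * (fchar x a * phi x)) -
     (0 +i* lam) * ((0 +i* lam) * (fchar x a * phi x))).
  rewrite -[RHS]/(- (bessel p u x - (lam ^+ 2)%:C * (fchar x a * phi x)) -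
     (0 +i* lam) * (fchar x a * ((gamma x)%:C * phi x))).
  have -> : (lam ^+ 2)%:C = - ((0 +i* lam) * (0 +i* lam)).
    by apply/eqP; rewrite eq_complex /=; apply/andP; split; apply/eqP; ring.
  ring.
have X0 := lin0 (energy_lin d s).
have W0 : nrm (sobw p 0) <= 0.
  by apply: le_trans (energy_ge X0).1 _; rewrite (sn0 (energy_seminorm d s)).
have h1 := sn_triB (nrm_seminorm mu) (linN (L2_lin mu) Lb) Lm.
rewrite (snN (nrm_seminorm mu) Lb) (sn_hom (nrm_seminorm mu)) ?nrm_modul in h1; last exact: L2_modul.
have nl : Normc.normc (0 +i* lam) = lam by rewrite /= expr0n /= add0r sqrtr_sqr gtr0_norm.
rewrite nl in h1.
by have := packet_symbol; move: h1 W0; move: (nrm _) (nrm _) (nrm _) (lam * _) => *; lra.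
Qed.

Lemma packet_ge : lam * nrm phi <= N U.
Proof.
have [XU _] := KG_domain_sub s0 M0 mg gM packet_domain.
apply: le_trans (energy_ge XU).2.
rewrite [leRHS](sn_hom (nrm_seminorm mu))//.
by rewrite /= expr0n /= add0r sqrtr_sqr gtr0_norm// unrm.
Qed.

End one_packet.

Lemma japanese_powN_small (k e : R) : (0 < d)%N -> 0 < k -> 0 < e ->
  exists a : Rn R d, J a `^ (- k) < e.
Proof.
move=> d0 k0 e0; have [a ha] := japanese_unbounded (e^-1 `^ k^-1) d0; exists a.
have h : e^-1 < J a `^ k.
  rewrite -[e^-1](powRr1 (ltW _)) ?invr_gt0// -{1}(mulVf (lt0r_neq0 k0)) powRrM.
  by apply: gt0_ltr_powR; rewrite ?nnegrE ?powR_ge0// ltW// japanese_gt0.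
by rewrite powRN invf_plt ?posrE// powR_gt0// japanese_gt0.
Qed.

Section bound.
Variable K : R.
Hypotheses (d0 : (0 < d)%N) (K0 : 0 <= K).
Hypothesis resolvent : forall U (l : R), D U -> N U <= K * N (A U - (0 +i* l) *: U).

(** The resolvent bound divided by lam, at frequencies tending to infinity. *)
Lemma band_limited_bound v0 r phi : L2 v0 -> 1 <= r -> is_fourier phi (cut J r v0) ->
  nrm phi <= K * nrm (damp phi).
Proof.
move=> Lv0 r1 hphi.
have k0 : 0 < (1 - p) / 2 by rewrite divr_gt0// subr_gt0.
pose B := K * (3 * r * nrm phi).
have B0 : 0 <= B by rewrite !mulr_ge0 ?nrm_ge0//; exact: le_trans ler01 r1.
have B1 : 0 < B + 1 by rewrite ltr_wpDl.
apply/ler_addgt0Pr => e e0.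
have [a ha] := japanese_powN_small d0 k0 (divr_gt0 e0 B1).
have Ja := japanese_gt0 a.
pose lam := J a `^ (p / 2); have lam0 : 0 < lam by rewrite powR_gt0.
have : lam * nrm phi <= K * (3 * r * Num.sqrt (J a) * J a `^ (p - 1) * nrm phi +
    lam * nrm (damp phi)) := le_trans (packet_ge a r1 hphi) (le_trans (resolvent lam (packet_domain a r1 hphi))
  (ler_wpM2l K0 (packet_residual a r1 hphi))).
have -> : 3 * r * Num.sqrt (J a) * J a `^ (p - 1) = 3 * r * J a `^ (- ((1 - p) / 2)) * lam.
  rewrite -powR12_sqrt ?ltW// -mulrA -[RHS]mulrA; congr (_ * _).
  have D t t' : J a `^ t * J a `^ t' = J a `^ (t + t') by rewrite powRD// (gt_eqF Ja) implybT.
  by rewrite /lam !D; congr (_ `^ _); field.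
have -> : K * (3 * r * J a `^ (- ((1 - p) / 2)) * lam * nrm phi + lam * nrm (damp phi)) =
    lam * (B * J a `^ (- ((1 - p) / 2)) + K * nrm (damp phi)) by rewrite /B; ring.
rewrite ler_pM2l// => /le_trans; apply.
rewrite addrC lerD2l.
apply: le_trans (ler_wpM2l B0 (ltW ha)) _.
by rewrite mulrCA ger_pMr// ler_pdivrMr// mul1r lerDl.
Qed.

Lemma damping_bound phi : L2 phi -> nrm phi <= K * nrm (damp phi).
Proof.
move=> Lp; have nS := nrm_seminorm mu; have mJ := @measurable_japanese R d.
apply/ler_addgt0Pr => e e0.
have C0 : 0 < 1 + K * M by rewrite ltr_pwDl// mulr_ge0.
have [k hk] := L2_truncation mJ (ft_L2 Lp) (divr_gt0 e0 C0).
pose f := cut J k%:R (ft phi); pose phi' := ift f.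
have Lf : L2 f by apply: L2_cut; [exact: mJ|exact: ft_L2].
have hf : is_fourier phi' f := fourier_invP Lf.
have Lp' : L2 phi' by have [] := is_fourier_L2 hf.
have hphi' : is_fourier phi' (cut J k.+1%:R f).
  rewrite (_ : cut J _ f = f)//; apply/funext => x; rewrite /f /cut.
  case: ifP => // /negP h; case: ifP => // xk; exfalso; apply: h.
  by apply: le_trans xk _; rewrite ler_nat.
have k1 : 1 <= k.+1%:R :> R by rewrite ler1n.
have hb := band_limited_bound Lf k1 hphi'.
have hd : nrm (phi - phi') < e / (1 + K * M).
  have h := is_fourier_lin (-1) hf (fourierP Lp).
  have := is_fourier_nrm h; rewrite !scaleN1r addrC [- _ + _]addrC.
  by move=> <-; exact: hk.
have [Ld hM] := damp_L2 M0 mg gM (L2B Lp' Lp).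
have Lg := (damp_L2 M0 mg gM Lp).1; have Lg' := (damp_L2 M0 mg gM Lp').1.
have h1 := sn_le_sub nS Lp Lp'.
have h2 := sn_le_sub nS Lg' Lg.
have dE : damp phi' - damp phi = damp (phi' - phi).
  by apply/funext => x; rewrite -[LHS]/(_ * _ - _ * _) -mulrBr.
rewrite dE in h2; rewrite (sn_distC nS Lp' Lp) in hM.
have h3 := ler_wpM2l K0 (le_trans h2 (lerD (lexx _) hM)).
have h4 : (1 + K * M) * nrm (phi - phi') <= e.
  by have := ltW hd; rewrite ler_pdivlMr// mulrC.
move: h1 hb h3 h4; move: (nrm _) (nrm _) (nrm _) (nrm _) (nrm _) => *; lra.
Qed.

End bound.
End packets.

(** * Equivalence of decay and lower bound *)

Section decay_resolvent.
Local Open Scope complex_scope.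
Variables (R : realType) (V : lmodType R[i]) (X : set V) (N : V -> R).
Hypothesis XN : seminorm_on X N.
Variables (D : set V) (A : V -> V) (T : R -> V -> V).
Hypothesis TG : generates X N D A T.
Hypothesis DX : forall U, D U -> X U /\ X (A U).

(** After a time at which the decay has halved the norm, the resolvent estimate
    can be solved for N U. *)
Lemma decay_resolvent (C om : R) : 0 < C -> 0 < om ->
  (forall U, X U -> forall t, 0 <= t -> N (T t U) <= C * expR (- (om * t)) * N (T 0 U)) ->
  exists2 K, 0 <= K & forall U (l : R), D U -> N U <= K * N (A U - (0 +i* l) *: U).
Proof.
move=> C0 om0 dec; pose t := 2 * C / om.
have t0 : 0 < t by rewrite !(divr_gt0, mulr_gt0).
have bnd r Z : 0 <= r -> X Z -> N (T r Z) <= C * N Z.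
  move=> r0 XZ; apply: le_trans (dec Z XZ r r0) _.
  rewrite (C0_id XN TG.1 XZ) ler_wpM2r ?(sn_ge0 XN)// ger_pMr//.
  by rewrite -expR0 ler_expR oppr_le0 mulr_ge0// ltW.
exists (2 * (t * C)) => [|U l DU]; first by rewrite mulr_ge0// mulr_ge0// ltW.
have [XU XAU] := DX DU.
have h1 := resolvent_estimate XN TG DX l (ltW C0) t0 DU bnd.
have h2 := dec U XU t (ltW t0); rewrite (C0_id XN TG.1 XU) in h2.
have half : C * expR (- (om * t)) <= 2^-1.
  rewrite /t mulrCA divff ?gt_eqF// mulr1 expRN.
  have := expR_ge1Dx (2 * C); have e0 := expR_gt0 (2 * C).
  by rewrite ler_pdivrMr//; lra.
have := ler_wpM2r (sn_ge0 XN XU) half; lra.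
Qed.

End decay_resolvent.

Section lower_bound.
Local Open Scope complex_scope.
Variables (R : realType) (d : nat) (gamma : Rn R d -> R).
Local Notation mu := (lebesgue_Rn R d).
Local Notation nrm := (nrm mu).

(** A space of measure zero is treated apart: there the norm does not bound the
    function, but every almost everywhere statement holds. *)
Lemma Linfty_bound : gamma \in Lfun mu +oo%E -> (\forall x \ae mu, 0 <= gamma x) ->
  measurable_fun setT gamma /\
  exists2 M : R, 0 <= M & \forall x \ae mu, 0 <= gamma x <= M.
Proof.
rewrite inE => /andP[mg fg] g0.
split; first by move: mg; rewrite inE.
have fin : (Lnorm mu +oo (EFin \o gamma) < +oo)%E by move: fg; rewrite inE.
suff [M gM] : exists M : R, \forall x \ae mu, gamma x <= M.
  exists `|M| => //; apply: filterS2 g0 gM => x -> /le_trans -> //; exact: ler_norm.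
move: fin; rewrite unlock; case: ifPn => [_ fin|mu0 _].
  have [M gM] := ess_supr_bounded (f := Num.norm \o gamma) fin.
  by exists M; apply: filterS gM => x; apply: le_trans; exact: ler_norm.
exists 0; have {}mu0 : mu setT = 0%E by apply/eqP; rewrite eq_le measure_ge0 andbT leNgt.
exists setT; split=> //; exact: measurableT.
Qed.

Variables (M K : R).
Hypotheses (M0 : 0 <= M) (K0 : 0 <= K) (mg : measurable_fun setT gamma).
Hypothesis gM : {ae mu, forall x, 0 <= gamma x <= M}.
Hypothesis bound : forall phi, L2 mu phi -> nrm phi <= K * nrm (damp gamma phi).

(** Tested on the indicator of a bounded piece of {gamma < c}, the bound forces
    that piece to be null when K c < 1. *)
Lemma damping_bounded_below : exists2 c, 0 < c & {ae mu, forall x, c <= gamma x}.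
Proof.
have K1 : 0 < 2 * (K + 1) by rewrite mulr_gt0// ltr_wpDl.
pose c := (2 * (K + 1))^-1; have c0 : 0 < c by rewrite invr_gt0.
exists c => //.
pose b k (x : Rn R d) : R[i] := if gamma x < c then box (cube R k) x else 0.
have Lb k : L2 mu (b k).
  have mb : cmeas (b k).
    by apply: cmeas_if; [exact: measurable_fun_ltr|exact: (box_L2 d _).1|exact: cmeas_cst].
  have [|L _] := @L2_dominated _ _ R mu 1 (box (cube R k)) (b k) ler01 mb (box_L2 d _); last exact: L.
  by apply: nearW => x; rewrite mul1r /b; case: ifP => // _; rewrite sqn0 sqn_ge0.
have b0 k : nrm (b k) = 0.
  have [Lg _] := damp_L2 M0 mg gM (Lb k).
  have [|_ h] := @L2_dominated _ _ R mu (c ^+ 2) (b k) (damp gamma (b k)) (sqr_ge0 _) Lg.1 (Lb k).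
    apply: filterS gM => x /andP[g0 _]; rewrite sqn_real /b; case: ifP => gc.
      rewrite ler_wpM2r ?sqn_ge0// ler_pXn2r ?nnegrE ?(ltW c0)//; exact: ltW.
    by rewrite sqn0 !mulr0.
  have h' : nrm (damp gamma (b k)) <= c * nrm (b k).
    by rewrite -(@ler_pXn2r _ 2%N)// ?nnegrE ?mulr_ge0 ?nrm_ge0 ?(ltW c0)// exprMn.
  apply/eqP; rewrite eq_le nrm_ge0 andbT.
  have := le_trans (bound (Lb k)) (ler_wpM2l K0 h').
  have Kc : K * c <= 2^-1.
    by rewrite /c ler_pdivrMr// mulrA mulVf// mul1r lerDl.
  have := ler_wpM2r (nrm_ge0 mu (b k)) Kc; lra.
have : {ae mu, forall x, forall k, b k x = 0}.
  by apply/ae_foralln => k; exact: nrm_eq0 (Lb k) (b0 k).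
apply: filterS => x h; rewrite leNgt; apply/negP => gc.
have [k kP] := cube_cover x; have := h k; rewrite /b gc box_indic indicE mem_set; last exact: kP.
by move=> /eqP; rewrite oner_eq0.
Qed.

End lower_bound.

Theorem theorem1p5 (R : realType) (d : nat) (s : R) (gamma : Rn R d -> R)
    (T : R -> state R d -> state R d) :
  (1 <= d)%N ->
  0 < s < 2 ->
  gamma \in Lfun (lebesgue_Rn R d) +oo%E ->
  (\forall x \ae lebesgue_Rn R d, 0 <= gamma x) ->
  generates (energy_space s) (energy_norm s)
    (KG_domain s) (KG_op s gamma) T ->
  (exists C omega : R, [/\ 0 < C, 0 < omega &
     forall U : state R d, energy_space s U -> forall t : R, 0 <= t ->
       energy_norm s (T t U)
         <= C * expR (- (omega * t)) * energy_norm s (T 0 U)])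
  <-> (0 < ess_inf (lebesgue_Rn R d) (fun x => (gamma x)%:E))%E.
Proof.
move=> d1 /andP[s0 s2] gL g0 TG.
have [mg [M M0 gM]] := Linfty_bound gL g0.
have DX := KG_domain_sub s0 M0 mg gM.
split=> [[C [om [C0 om0 dec]]]|ess].
  have [K K0 res] := decay_resolvent (energy_seminorm d s) TG DX C0 om0 dec.
  have [c c0 gc] := damping_bounded_below M0 K0 mg gM (damping_bound s0 s2 M0 mg gM d1 K0 res).
  apply: (@lt_le_trans _ _ c%:E); first by rewrite lte_fin.
  by apply/ess_infP; apply: filterS gc => x; rewrite lee_fin.
have [c c0 gc] : exists2 c : R, 0 < c & {ae lebesgue_Rn R d, forall x, c <= gamma x}.
  have le := ess_inf_le (lebesgue_Rn R d) (fun x => (gamma x)%:E).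
  case: ess_inf ess le => [c| |]//; rewrite ?lte_fin => c0 le; last first.
    by exists 1 => //; apply: filterS le => x; rewrite leye_eq.
  by exists c => //; apply: filterS le => x; rewrite lee_fin.
exact: (damped_decay s0 M0 mg gM c0 gc TG).
Qed.
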